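(* For every $n\ge 1$, there exists a countable $\omega$-categorical structure $\mathbb{D}$ with a finite relational signature such that $\mathrm{CSP}(\mathbb{D})$ is $\Sigma_{2n+1}^{\mathrm{P}}$-complete, and there exists a countable $\omega$-categorical structure $\mathbb{D}'$ with a finite relational signature such that $\mathrm{CSP}(\mathbb{D}')$ is $\Pi_{2n}^{\mathrm{P}}$-complete.
   Context: A countable structure is $\omega$-categorical if for every $k\ge1$ only finitely many $k$-ary relations are first-order definable (without parameters) in it. For a structure $\mathbb{D}$ with finite relational signature $\sigma$, $\mathrm{CSP}(\mathbb{D})$ is the decision problem of whether a given finite $\sigma$-structure admits a homomorphism to $\mathbb{D}$. $\Sigma_k^{\mathrm{P}}$ and $\Pi_k^{\mathrm{P}}$ denote the levels of the polynomial hierarchy; completeness is with respect to polynomial-time reductions. *)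

(* Defs.v *)
From mathcomp Require Import all_boot all_order all_algebra.
From mathcomp Require Import all_classical.

Set Implicit Arguments.
Unset Strict Implicit.
Unset Printing Implicit Defensive.

Local Open Scope classical_set_scope.

Variant direction := MoveLeft | Stay | MoveRight.

(* [None] is the blank symbol; the binary input alphabet embeds as
   [Some (inl b)] and [aux] provides the additional work symbols. *)
Definition symbol_over (aux : finType) := option (bool + aux).

(* A deterministic machine with [extra_tapes.+1] tapes.  It halts when the
   transition function returns [None]. *)
Record machine := Machine {
  extra_tapes : nat;
  aux : finType;
  state : finType;
  start : state;
  delta : state -> {ffun 'I_extra_tapes.+1 -> symbol_over aux} ->
          option (state *
                  {ffun 'I_extra_tapes.+1 -> symbol_over aux * direction})
}.

Section Machine.
Variable M : machine.

Definition symbol := symbol_over (aux M).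

(* A two-way infinite tape: the cells strictly to the left of the head, nearest
   first, and the cells from the head rightwards.  Cells beyond the ends of the
   two lists are blank. *)
Definition tape := (seq symbol * seq symbol)%type.

Definition scanned (t : tape) : symbol := head None t.2.

Definition write_move (t : tape) (a : symbol * direction) : tape :=
  let: (l, r) := (t.1, a.1 :: behead t.2) in
  match a.2 with
  | MoveLeft => (behead l, head None l :: r)
  | Stay => (l, r)
  | MoveRight => (a.1 :: l, behead r)
  end.

Definition config := (state M * {ffun 'I_(extra_tapes M).+1 -> tape})%type.

Definition step (c : config) : option config :=
  if delta c.1 [ffun i => scanned (c.2 i)] is Some (q, a)
  then Some (q, [ffun i => write_move (c.2 i) (a i)])
  else None.

(* The halting configuration reached from [c] in at most [k] steps, if any. *)
Fixpoint run (k : nat) (c : config) : option config :=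
  if step c is Some c' then
    if k is k'.+1 then run k' c' else None
  else Some c.

(* The input is written on the first tape, the other tapes being blank. *)
Definition init (w : seq bool) : config :=
  (start M,
   [ffun i => if i == ord0 then ([::], [seq Some (inl b) | b <- w])
              else ([::], [::])]).

Fixpoint read_bits (s : seq symbol) : seq bool :=
  if s is Some (inl b) :: s' then b :: read_bits s' else [::].

(* The output is the longest binary word on the last tape that starts at the
   head. *)
Definition output (c : config) : seq bool := read_bits (c.2 ord_max).2.

End Machine.

Definition polytime (f : seq bool -> seq bool) : Prop :=
  exists (M : machine) (p : {poly nat}), forall w : seq bool,
    exists2 c : config M,
      run (p.[size w])%R (init M w) = Some c & output c = f w.

Definition language := set (seq bool).

Definition class_P (L : language) : Prop :=
  exists2 f, polytime f & forall w, L w <-> f w = [:: true].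

(* A prefix-free encoding of [x], followed by [y]. *)
Definition pair_word (x y : seq bool) : seq bool :=
  flatten [seq [:: true; b] | b <- x] ++ false :: y.

(* Sigma_0 = P, and L is in Sigma_{k+1} when
   x \in L <-> exists y, |y| <= p(|x|) /\ <x, y> \in V
   for some polynomial p and some V in Pi_k. *)
Fixpoint Sigma_P (k : nat) (L : language) : Prop :=
  if k is k'.+1 then
    exists (V : language) (p : {poly nat}),
      Sigma_P k' (~` V) /\
      forall x, L x <->
        exists2 y, (size y <= (p.[size x])%R)%N & V (pair_word x y)
  else class_P L.

Definition Pi_P (k : nat) (L : language) : Prop := Sigma_P k (~` L).

Definition poly_reduces (L L' : language) : Prop :=
  exists2 f, polytime f & forall w, L w <-> L' (f w).

Definition complete_for (C : language -> Prop) (L : language) : Prop :=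
  C L /\ forall L', C L' -> poly_reduces L' L.

Record signature := Signature {
  rsymb : finType;
  arity : rsymb -> nat;
  arity_gt0 : forall R, 0 < arity R
}.

Record structure (sigma : signature) := Structure {
  dom :> Type;
  interp : forall R : rsymb sigma, set ((arity R).-tuple dom)
}.

Definition homomorphism (sigma : signature) (A B : structure sigma)
    (h : A -> B) : Prop :=
  forall (R : rsymb sigma) (t : (arity R).-tuple A),
    interp t -> interp (map_tuple h t).

(* First-order formulas with equality whose free variables are among
   0, ..., k-1.  [FEx] binds variable 0 and shifts the others by one. *)
Inductive formula (sigma : signature) : nat -> Type :=
| FFalse k : formula sigma k
| FEq k (i j : 'I_k) : formula sigma k
| FRel k (R : rsymb sigma) (args : (arity R).-tuple 'I_k) : formula sigma k
| FNot k (phi : formula sigma k) : formula sigma k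
| FAnd k (phi psi : formula sigma k) : formula sigma k
| FEx k (phi : formula sigma k.+1) : formula sigma k.

Fixpoint sat (sigma : signature) (D : structure sigma) (k : nat)
    (phi : formula sigma k) : k.-tuple D -> Prop :=
  match phi in formula _ k return k.-tuple D -> Prop with
  | FFalse _ => fun _ => False
  | FEq _ i j => fun v => tnth v i = tnth v j
  | FRel _ _ args => fun v => interp (map_tuple (tnth v) args)
  | FNot _ phi => fun v => ~ sat phi v
  | FAnd _ phi psi => fun v => sat phi v /\ sat psi v
  | FEx _ phi => fun v => exists d : D, sat phi (cons_tuple d v)
  end.

Definition definable (sigma : signature) (D : structure sigma) (k : nat)
    (S : set (k.-tuple D)) : Prop :=
  exists phi : formula sigma k, S = [set v | sat phi v].

Definition omega_categorical (sigma : signature) (D : structure sigma) : Prop :=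
  countable [set: D] /\
  forall k, 1 <= k -> finite_set [set S : set (k.-tuple D) | definable S].

(* Finite structures, with domain {0, ..., fin_card-1} without loss of
   generality. *)
Record fin_structure (sigma : signature) := FinStructure {
  fin_card : nat;
  fin_rel : forall R : rsymb sigma, {set (arity R).-tuple 'I_fin_card}
}.

Definition structure_of_fin (sigma : signature) (A : fin_structure sigma) :
    structure sigma :=
  @Structure sigma 'I_(fin_card A) (fun R => [set t | t \in fin_rel A R]).

(* The lexicographic enumeration.  The library's [enum {: k.-tuple T}] is
   sealed, so that its order is unspecified. *)
Fixpoint lex_tuples (T : Type) (s : seq T) (k : nat) : seq (k.-tuple T) :=
  if k is k'.+1
  then [seq cons_tuple x t | x <- s, t <- lex_tuples s k']
  else [:: [tuple]].

(* The cardinality in unary, followed by the characteristic bit string of each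
   relation.  As the signature is fixed, its length is polynomial in the
   cardinality. *)
Definition encode (sigma : signature) (A : fin_structure sigma) : seq bool :=
  nseq (fin_card A) true ++ false ::
  flatten [seq [seq t \in fin_rel A R | t <- lex_tuples (enum 'I_(fin_card A)) (arity R)]
          | R <- enum (rsymb sigma)].

Definition CSP (sigma : signature) (D : structure sigma) : language :=
  [set w | exists A : fin_structure sigma,
     w = encode A /\
     exists h : structure_of_fin A -> D, homomorphism h].

(* Main.v *)
(* Fix a quantifier prefix.  Over a relational structure, two players alternately
   colour the elements of a unary relation (existential player) and choose a clique
   of a binary relation, whose elements become true (universal player); in the end
   the existential player extends the outcome to a satisfying assignment of the
   clauses [x /\ y -> z], [x \/ y \/ z] and [~ x] given by three further relations.
   Homomorphisms push cliques forward and pull colourings back, so the structures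
   that the existential player wins form a class closed under inverse homomorphisms
   and disjoint unions.

   A clique of two structures glued along [k] common elements lies in one of them.
   Hence the outcome on a glued structure depends on each part only through a type
   from a finite set.  For such a class, glue successively every finite structure
   over every tuple, with fresh elements, as long as the class allows it: two tuples
   of the union over which the same types are realized are related by a
   back-and-forth system, so the union is omega-categorical.

   Membership in the right level of the hierarchy holds by definition of the game.
   For hardness, the players choose the quantified words letter by letter; the
   letter alternatives of a universal word form a graph whose maximal cliques are
   the words.  Horn clauses then derive the paired words and the computation of the
   verifier, and refute a rejecting one. *)

Require Import Defs.
From mathcomp Require Import all_boot.
From HB Require Import structures.
From mathcomp Require Import boolp classical_sets cardinality.
From mathcomp Require Import ssralg poly zify.

Set Implicit Arguments.
Unset Strict Implicit.
Unset Printing Implicit Defensive.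

(** * Structured programs on several tapes *)

(** A homomorphism may identify elements, so the marks of the universal player can be pushed forward
    only if they are all of one kind; universal letters therefore cannot be colours. With positive
    marks alone, no clause could prevent two letters from being marked at one position, since
    further marks never hurt the universal player; the clique condition excludes this inside the
    structure. The same condition keeps a universal move local when structures are glued.

    The innermost quantifier needs no move: it is the choice of the satisfying assignment. The game
    thus serves the prefixes that end existentially, which are those of Sigma at odd levels and of
    Pi at even levels, and [k.+1] quantifiers take [k] moves. The condition [b (+) odd k] says this
    for both families at once.

    Machines are concrete, so the verifier and the reduction have to be produced as tape machines.
    Both are written as expressions with bounded sums, strong enough for bounded quantifiers and yet
    polynomially bounded in value; only this language is compiled. *)

Fixpoint steps (M : machine) (n : nat) (c : config M) : option (config M) :=
  if n is n'.+1 then obind (steps n') (step c) else Some c.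

Lemma steps_add (M : machine) n m (c : config M) :
  steps (n + m) c = obind (steps m) (steps n c).
Proof. by elim: n c => //= n IH c; case: (step c). Qed.

Lemma steps_run (M : machine) n k (c c' : config M) :
  steps n c = Some c' -> step c' = None -> n <= k -> run k c = Some c'.
Proof.
elim: n k c => [|n IH] k c /=; first by case=> -> e _; case: k => /= [|k]; rewrite e.
case e: (step c) => [d|] //= ed hd; case: k => // k lk /=.
by rewrite e (IH k).
Qed.

Lemma stepsS (M : machine) n (c d : config M) r :
  step c = Some d -> steps n d = r -> steps n.+1 c = r.
Proof. by move=> /= ->. Qed.

Section Programs.
Variable K : nat.
Local Notation sym := (symbol_over void).
Local Notation syms := {ffun 'I_K.+1 -> sym}.
Local Notation action := (sym * direction)%type.
Local Notation tapes := {ffun 'I_K.+1 -> seq sym * seq sym}.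

(* A tape as two infinite sequences of cells, those to the left of the head and
   those from the head on: this forgets the trailing blanks. *)
Definition cells := ((nat -> sym) * (nat -> sym))%type.
Definition memory := 'I_K.+1 -> cells.

Record prog := Prog {
  pstate : finType;
  pstart : pstate;
  pdelta : pstate -> syms -> option (pstate * {ffun 'I_K.+1 -> action})
}.

Definition mach (P : prog) : machine := @Machine K void (pstate P) (pstart P) (@pdelta P).

Definition cells_of (t : seq sym * seq sym) : cells := (nth None t.1, nth None t.2).
Definition memory_of (T : tapes) : memory := fun i => cells_of (T i).

Definition ncons_fun (a : sym) (f : nat -> sym) (k : nat) : sym :=
  if k is k'.+1 then f k' else a.

Definition cells_move (c : cells) (a : action) : cells :=
  let r := ncons_fun a.1 (c.2 \o succn) in
  match a.2 with
  | MoveLeft => (c.1 \o succn, ncons_fun (c.1 0) r)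
  | Stay => (c.1, r)
  | MoveRight => (ncons_fun a.1 c.1, c.2 \o succn)
  end.

Lemma cells_of_move (P : prog) (t : tape (mach P)) (a : symbol (mach P) * direction) :
  cells_of (write_move t a) = cells_move (cells_of t) a.
Proof.
case: t => l r; case: a => a d; rewrite /write_move /cells_of /cells_move.
have nthB (T : Type) (x : T) (s : seq T) k : nth x (behead s) k = nth x s k.+1.
  by case: s => //=; rewrite nth_nil.
by case: d => /=; congr pair; apply/funext => k; case: k => [|[|k]] //=;
  rewrite ?nthB ?nth0.
Qed.

Lemma cells_move_id (c : cells) : cells_move c (c.2 0, Stay) = c.
Proof. by case: c => L R /=; rewrite /cells_move /=; congr pair; apply/funext; case. Qed.

(** Stated for all tapes with the given contents, since tapes that differ by trailing blanks carry
    the same [memory]. As [t] only bounds the time from above, the branches of a program can share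
    it. *)
Definition does (P : prog) (A B : memory) (t : nat) : Prop :=
  forall T : tapes, memory_of T = A ->
  exists n (q : pstate P) (T' : tapes),
    [/\ n <= t, memory_of T' = B,
        steps n ((pstart P, T) : config (mach P)) = Some (q, T') &
        step ((q, T') : config (mach P)) = None].

Lemma does_weaken P A B t t' : does P A B t -> t <= t' -> does P A B t'.
Proof.
move=> h le T /h [n [q [T' [ln e1 e2 e3]]]]; exists n, q, T'.
by split=> //; apply: leq_trans le.
Qed.

Definition update (A : memory) i c : memory := fun j => if j == i then c else A j.

Lemma stay_memory (P : prog) (T : tapes) (f : 'I_K.+1 -> action) A i a :
  memory_of T = A ->
  (forall j, f j = if j == i then a else ((A j).2 0, Stay)) ->
  memory_of [ffun j => @write_move (mach P) (T j) (f j)] =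
  update A i (cells_move (A i) a).
Proof.
move=> <- hf; apply/funext => j; rewrite /memory_of ffunE cells_of_move hf /update.
by case: eqP => [->|_] //; rewrite cells_move_id.
Qed.

Lemma idle_memory (P : prog) (T : tapes) (f : 'I_K.+1 -> action) A :
  memory_of T = A -> (forall j, f j = ((A j).2 0, Stay)) ->
  memory_of [ffun j => @write_move (mach P) (T j) (f j)] = A.
Proof.
move=> <- hf; apply/funext => j.
by rewrite /memory_of ffunE cells_of_move hf cells_move_id.
Qed.

Definition idle (s : syms) : {ffun 'I_K.+1 -> action} := [ffun i => (s i, Stay)].

Lemma scanned_memory (P : prog) (T : tapes) i :
  @scanned (mach P) (T i) = (memory_of T i).2 0.
Proof. by rewrite /scanned /memory_of /cells_of /= nth0. Qed.

Definition prim (i : 'I_K.+1) (g : sym -> action) : prog :=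
  @Prog bool false (fun q s => if q then None else
    Some (true, [ffun j => if j == i then g (s i) else (s j, Stay)])).

Lemma does_prim i g A :
  does (prim i g) A (update A i (cells_move (A i) (g ((A i).2 0)))) 1.
Proof.
move=> T hT.
exists 1, true, [ffun j => @write_move (mach (prim i g)) (T j)
   (if j == i then g ((A i).2 0) else ((A j).2 0, Stay))].
split=> //; first exact: stay_memory hT _.
rewrite /= /step /=; congr (Some (_, _)); apply/ffunP => j.
by rewrite !ffunE -hT -!(scanned_memory (prim i g)).
Qed.

Definition seqp (P Q : prog) : prog :=
  @Prog (pstate P + pstate Q)%type (inl (pstart P)) (fun q s =>
    match q with
    | inl q => if pdelta q s is Some (q', a) then Some (inl q', a)
               else Some (inr (pstart Q), idle s)
    | inr q => if pdelta q s is Some (q', a) then Some (inr q', a) else None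
    end).

Definition condp (i : 'I_K.+1) (b : sym -> bool) (P Q : prog) : prog :=
  @Prog (option (pstate P + pstate Q)) None (fun q s =>
    match q with
    | None => Some (Some (if b (s i) then inl (pstart P) else inr (pstart Q)), idle s)
    | Some (inl q) => if pdelta q s is Some (q', a) then Some (Some (inl q'), a) else None
    | Some (inr q) => if pdelta q s is Some (q', a) then Some (Some (inr q'), a) else None
    end).

Definition whilep (i : 'I_K.+1) (b : sym -> bool) (P : prog) : prog :=
  @Prog (option (pstate P)) None (fun q s =>
    match q with
    | None => if b (s i) then Some (Some (pstart P), idle s) else None
    | Some q => if pdelta q s is Some (q', a) then Some (Some q', a)
                else Some (None, idle s)
    end).

(** A composite program changes the behaviour of a component only where the component halts. Hence
    one simulation along an embedding of states serves sequences, conditionals and loops. *)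
Lemma steps_embed (P Q : prog) (h : pstate P -> pstate Q) :
  (forall q s q' a, pdelta q s = Some (q', a) -> pdelta (h q) s = Some (h q', a)) ->
  forall n q (T : tapes) q' T',
  steps n ((q, T) : config (mach P)) = Some (q', T') ->
  steps n ((h q, T) : config (mach Q)) = Some (h q', T').
Proof.
move=> hd; elim=> [|n IH] q T q' T' /=; first by case=> -> ->.
rewrite {1 2}/step /=.
case e: (pdelta _ _) => [[q1 a]|] //= /IH <-.
by rewrite (hd _ _ _ _ e).
Qed.

Lemma step_halt (P : prog) (q : pstate P) (T : tapes) :
  step ((q, T) : config (mach P)) = None ->
  pdelta q [ffun i => @scanned (mach P) (T i)] = None.
Proof. by rewrite /step /=; case: (pdelta _ _) => [[]|]. Qed.

Lemma idle_step (P : prog) (q q' : pstate P) (T : tapes) :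
  (forall s, s = [ffun i => @scanned (mach P) (T i)] -> pdelta q s = Some (q', idle s)) ->
  exists2 T' : tapes, memory_of T' = memory_of T &
    step ((q, T) : config (mach P)) = Some (q', T').
Proof.
move=> h; eexists; last by rewrite /step /= h.
by apply: idle_memory => // j; rewrite !ffunE -(scanned_memory P).
Qed.

Lemma does_seq P Q A B C t u :
  does P A B t -> does Q B C u -> does (seqp P Q) A C (t + u).+1.
Proof.
move=> hP hQ T /hP [n [q [T1 [ln e1 e2 /step_halt e3]]]].
have [|T2 m2 s2] := @idle_step (seqp P Q) (inl q) (inr (pstart Q)) T1.
  by move=> s -> /=; rewrite e3.
move: m2; rewrite e1 => /hQ [m [q' [T3 [lm f1 f2 /step_halt f3]]]].
exists (n + m.+1), (inr q'), T3; split=> //; first by lia.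
  rewrite steps_add (@steps_embed P (seqp P Q) inl _ _ _ _ _ _ e2) /=;
    last by move=> ? ? ? ? /= ->.
  apply: (stepsS s2); apply: (@steps_embed Q (seqp P Q) inr _ _ _ _ _ _ f2).
  by move=> ? ? ? ? /= ->.
by rewrite /step /= f3.
Qed.

Lemma does_cond i b P Q A B t :
  does (if b ((A i).2 0) then P else Q) A B t -> does (condp i b P Q) A B t.+1.
Proof.
move=> h T hT.
have [|T2 m2 s2] := @idle_step (condp i b P Q) None
  (Some (if b ((A i).2 0) then inl (pstart P) else inr (pstart Q))) T.
  by move=> s -> /=; rewrite ffunE scanned_memory hT.
move: m2 s2; rewrite hT.
case: (b _) h => h m2 s2; case: (h _ m2) => n [q [T' [ln e1 e2 /step_halt e3]]].
  exists n.+1, (Some (inl q)), T'; split=> //; last by rewrite /step /= e3.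
  apply: (stepsS s2); apply: (@steps_embed P (condp i b P Q) (Some \o inl) _ _ _ _ _ _ e2).
  by move=> ? ? ? ? /= ->.
exists n.+1, (Some (inr q)), T'; split=> //; last by rewrite /step /= e3.
apply: (stepsS s2); apply: (@steps_embed Q (condp i b P Q) (Some \o inr) _ _ _ _ _ _ e2).
by move=> ? ? ? ? /= ->.
Qed.

Lemma does_while0 i (b : sym -> bool) P A : b ((A i).2 0) = false -> does (whilep i b P) A A 0.
Proof.
move=> hb T hT; exists 0, None, T; split=> //.
by rewrite /step /= ffunE scanned_memory hT hb.
Qed.

Lemma does_whileS i (b : sym -> bool) P A B C t u : b ((A i).2 0) ->
  does P A B t -> does (whilep i b P) B C u -> does (whilep i b P) A C (t + u).+2.
Proof.
move=> hb hP hW T hT.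
have [|T2 m2 s2] := @idle_step (whilep i b P) None (Some (pstart P)) T.
  by move=> s -> /=; rewrite ffunE scanned_memory hT hb.
move: m2; rewrite hT => /hP [n [q [T3 [ln e1 e2 /step_halt e3]]]].
have [|T4 m4 s4] := @idle_step (whilep i b P) (Some q) None T3.
  by move=> s -> /=; rewrite e3.
move: m4; rewrite e1 => /hW [m [q' [T5 [lm f1 f2 f3]]]].
exists (n + m.+1).+1, q', T5; split=> //; first by lia.
apply: (stepsS s2); rewrite steps_add.
rewrite (@steps_embed P (whilep i b P) Some _ _ _ _ _ _ e2); last by move=> ? ? ? ? /= ->.
exact: stepsS s4 f2.
Qed.

End Programs.

(** * Bounded sums of the letters of a word, and their evaluation in polynomial time *)

Lemma poly_mono (p : {poly nat}) m n : m <= n -> (p.[m])%R <= (p.[n])%R.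
Proof.
move=> le; rewrite !horner_coef.
elim/big_ind2: _ => // [a b c d|i _]; first exact: leq_add.
apply: leq_mul => //; elim: (nat_of_ord i) => // k IH.
by rewrite !GRing.exprS; apply: leq_mul.
Qed.

Definition poly_bounded (f : nat -> nat) := exists p : {poly nat}, forall n, f n <= (p.[n])%R.

Lemma poly_bounded_poly (p : {poly nat}) : poly_bounded (fun n => (p.[n])%R).
Proof. by exists p. Qed.

Lemma poly_bounded_const c : poly_bounded (fun _ => c).
Proof. by exists (c%:P)%R => n; rewrite hornerC. Qed.

Lemma poly_bounded_id : poly_bounded id.
Proof. by exists ('X)%R => n; rewrite hornerX. Qed.

Lemma poly_bounded_add f g :
  poly_bounded f -> poly_bounded g -> poly_bounded (fun n => f n + g n).
Proof. by move=> [p hp] [q hq]; exists (p + q)%R => n; rewrite hornerD; apply: leq_add. Qed.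

Lemma poly_bounded_mul f g :
  poly_bounded f -> poly_bounded g -> poly_bounded (fun n => f n * g n).
Proof.
by move=> [p hp] [q hq]; exists (p * q)%R => n; rewrite hornerM; apply: leq_mul.
Qed.

Lemma poly_bounded_comp f g :
  poly_bounded f -> poly_bounded g -> poly_bounded (fun n => f (g n)).
Proof.
move=> [p hp] [q hq]; exists (p \Po q)%R => n; rewrite horner_comp.
exact: leq_trans (hp _) (poly_mono _ (hq n)).
Qed.

Inductive expr : Type :=
| Var of nat
| One
| Len
| Bit of expr
| Plus of expr & expr
| Monus of expr & expr
| Sum of expr & expr.

(* [Sum a b] binds variable 0 of [b] and shifts the others by one. *)
Fixpoint eval (w : seq bool) (v : seq nat) (e : expr) : nat :=
  match e with
  | Var i => nth 0 v i
  | One => 1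
  | Len => size w
  | Bit e => nth false w (eval w v e)
  | Plus a b => eval w v a + eval w v b
  | Monus a b => eval w v a - eval w v b
  | Sum a b => \sum_(0 <= i < eval w v a) eval w (i :: v) b
  end.

Inductive emit : Type :=
| EBit of expr
| ELoop of expr & emit
| ESeq of emit & emit.

Fixpoint out (w : seq bool) (v : seq nat) (p : emit) : seq bool :=
  match p with
  | EBit e => [:: 0 < eval w v e]
  | ELoop e p => flatten [seq out w (i :: v) p | i <- iota 0 (eval w v e)]
  | ESeq p q => out w v p ++ out w v q
  end.

(** The bound is uniform over all environments below [n]. Under a sum the new variable ranges up to
    the value of the upper limit, so the body is bounded at [n + f n] and polynomials get composed;
    the nesting depth is fixed by [e]. *)
Lemma eval_bounded e : exists2 f, poly_bounded f &
  forall w v n, size w <= n -> (forall x, x \in v -> x <= n) -> eval w v e <= f n.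
Proof.
elim: e => [i|||e [f hf fP]|a [f hf fP] b [g hg gP]|a [f hf fP] b [g hg gP]|a [f hf fP] b [g hg gP]].
- exists id; first exact: poly_bounded_id.
  move=> w v n _ /= h; have [lt|ge] := ltnP i (size v); last by rewrite nth_default.
  exact/h/mem_nth.
- by exists (fun => 1) => //; apply: poly_bounded_const.
- by exists id => //; apply: poly_bounded_id.
- by exists (fun => 1) => [|w v n _ _ /=]; [apply: poly_bounded_const | case: nth].
- exists (fun n => f n + g n); first exact: poly_bounded_add.
  by move=> w v n hw hv; apply: leq_add; auto.
- by exists f => // w v n hw hv /=; apply: leq_trans (leq_subr _ _) (fP _ _ _ hw hv).
- exists (fun n => f n * g (n + f n)).
    apply: poly_bounded_mul => //; apply: (poly_bounded_comp hg).
    exact: poly_bounded_add poly_bounded_id hf.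
  move=> w v n hw hv /=; have le := fP _ _ _ hw hv.
  apply: (@leq_trans (\sum_(0 <= i < eval w v a) g (n + f n))).
    rewrite big_seq [leqRHS]big_seq; apply: leq_sum => i; rewrite mem_index_iota => hi.
    apply: gP; first by lia.
    by move=> x; rewrite inE => /predU1P [->|/hv]; lia.
  by rewrite sum_nat_const_nat subn0 leq_mul2r le orbT.
Qed.

(** * Unary registers, input and output on tapes *)

Definition setr (rho : nat -> nat) x n := fun y => if y == x then n else rho y.

Section Registers.
Variable K : nat.
Hypothesis K_gt0 : 0 < K.

Local Notation sym := (symbol_over void).
Definition bsym (b : bool) : sym := Some (inl b).

(* Tape 0 is the input with the head on cell [ipos] of [None :: w], tape [K] is
   the output, and tape [x.+1] holds register [x] in unary. *)
Record registers := Registers { ipos : nat; regs : nat -> nat; outp : seq bool }.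

Definition input_cell (w : seq bool) k : sym := nth None (None :: map bsym w) k.

Definition view_input w p : cells :=
  ((fun k => if k < p then input_cell w (p - k.+1) else None),
   (fun k => input_cell w (p + k))).
Definition view_reg n : cells :=
  ((fun=> None), (fun k => if k < n then bsym true else None)).
Definition view_output o : cells := ((fun=> None), nth None (map bsym o)).

Definition view w (s : registers) : memory K := fun i =>
  if i == ord0 then view_input w (ipos s)
  else if i == ord_max then view_output (outp s)
  else view_reg (regs s i.-1).

Definition reg x : 'I_K.+1 := inord x.+1.

Definition doesr w P s s' t := does P (view w s) (view w s') t.

Lemma view_at_reg w s x : x.+1 < K -> view w s (reg x) = view_reg (regs s x).
Proof.
move=> hx; rewrite /view -!val_eqE /= /reg inordK; last by lia.
by have -> : (x.+1 == K) = false by lia.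
Qed.

Lemma view_at_output w s : view w s ord_max = view_output (outp s).
Proof. by rewrite /view eqxx -val_eqE /=; have -> : (K == 0) = false by lia. Qed.

Lemma update_reg w p rho o x n : x.+1 < K ->
  update (view w (Registers p rho o)) (reg x) (view_reg n) =
  view w (Registers p (setr rho x n) o).
Proof.
move=> hx; apply/funext => i; rewrite /update /view -!val_eqE /= /reg inordK; last by lia.
rewrite /setr; case: i => [[|i] hi] //=; rewrite eqSS.
by have [e1|_] := eqVneq i x; have [e2|_] := eqVneq i.+1 K => //; lia.
Qed.

Lemma update_input w p q rho o :
  update (view w (Registers p rho o)) ord0 (view_input w q) =
  view w (Registers q rho o).
Proof. by apply/funext => i; rewrite /update /view; case: eqP. Qed.

Lemma update_output w p rho o o' :
  update (view w (Registers p rho o)) ord_max (view_output o') =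
  view w (Registers p rho o').
Proof.
apply/funext => i; rewrite /update /view; case: (i =P ord_max) => [->|_] //.
by rewrite -val_eqE /=; have -> : (K == 0) = false by lia.
Qed.

Lemma update_update (A : memory K) i c d : update (update A i c) i d = update A i d.
Proof. by apply/funext => j; rewrite /update; case: eqP. Qed.

Lemma update_at (A : memory K) i c : update A i c i = c.
Proof. by rewrite /update eqxx. Qed.

(** Registers and output grow to the left, so the head always rests on the first mark and no program
    has to search for the end of a block. *)
Definition incp x := seqp (prim (reg x) (fun a => (a, MoveLeft)))
                          (prim (reg x) (fun _ => (bsym true, Stay))).
Definition decp x := prim (reg x) (fun _ => (None, MoveRight)).
Definition rightp := prim (ord0 : 'I_K.+1) (fun a => (a, MoveRight)).
Definition leftp := prim (ord0 : 'I_K.+1) (fun a => (a, MoveLeft)).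
Definition emitp b := seqp (prim (ord_max : 'I_K.+1) (fun a => (a, MoveLeft)))
                           (prim (ord_max : 'I_K.+1) (fun _ => (bsym b, Stay))).
Definition skipp := whilep (ord0 : 'I_K.+1) (fun _ => false) rightp.

Lemma does_skip w s t : doesr w skipp s s t.
Proof. exact: does_weaken (does_while0 _ _) _. Qed.

Lemma does_weakenr w P s s' t t' : doesr w P s s' t -> t <= t' -> doesr w P s s' t'.
Proof. exact: does_weaken. Qed.

Lemma does_prim2 (A : memory K) i g a :
  does (seqp (prim i g) (prim i (fun _ => a))) A
       (update A i (cells_move (cells_move (A i) (g ((A i).2 0))) a)) 3.
Proof.
apply: (@does_seq _ _ _ _ _ _ 1 1); first exact: does_prim.
set c := cells_move (A i) _.
rewrite -(update_update A i c (cells_move c a)) -{3}(update_at A i c); exact: does_prim.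
Qed.

Lemma does_inc w p rho o x : x.+1 < K ->
  doesr w (incp x) (Registers p rho o) (Registers p (setr rho x (rho x).+1) o) 3.
Proof.
move=> hx; rewrite /doesr -update_reg // /incp.
rewrite (_ : view_reg _ =
  cells_move (cells_move (view w (Registers p rho o) (reg x))
    ((view w (Registers p rho o) (reg x)).2 0, MoveLeft)) (bsym true, Stay)).
  exact: does_prim2.
rewrite view_at_reg //= /view_reg /cells_move /=; congr pair; apply/funext => -[|[|k]] //=.
Qed.

Lemma does_dec w p rho o x : x.+1 < K -> 0 < rho x ->
  doesr w (decp x) (Registers p rho o) (Registers p (setr rho x (rho x).-1) o) 1.
Proof.
move=> hx h; rewrite /doesr -update_reg //.
rewrite (_ : view_reg _ = cells_move (view w (Registers p rho o) (reg x)) (None, MoveRight)).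
  exact: does_prim.
rewrite view_at_reg //= /view_reg /cells_move /=; congr pair; apply/funext => k /=.
  by case: k.
by rewrite -[in RHS](prednK h) ltnS.
Qed.

Lemma does_right w p rho o :
  doesr w rightp (Registers p rho o) (Registers p.+1 rho o) 1.
Proof.
rewrite /doesr -(@update_input w p p.+1).
rewrite (_ : view_input w p.+1 = cells_move (view w (Registers p rho o) ord0)
  ((view w (Registers p rho o) ord0).2 0, MoveRight)); first exact: does_prim.
rewrite /view /= /view_input /cells_move /=; congr pair; apply/funext => k /=.
  by case: k => [|k] /=; rewrite ?subn1 ?addn0 ?subSS.
by rewrite addSnnS.
Qed.

Lemma does_left w p rho o : 0 < p ->
  doesr w leftp (Registers p rho o) (Registers p.-1 rho o) 1.
Proof.
move=> hp; rewrite /doesr -(@update_input w p p.-1).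
rewrite (_ : view_input w p.-1 = cells_move (view w (Registers p rho o) ord0)
  ((view w (Registers p rho o) ord0).2 0, MoveLeft)); first exact: does_prim.
case: p hp => // p _; rewrite /view /= /view_input /cells_move /=.
congr pair; apply/funext => k /=.
by case: k => [|[|k]] /=; congr input_cell; lia.
Qed.

Lemma does_emit w p rho o b :
  doesr w (emitp b) (Registers p rho o) (Registers p rho (b :: o)) 3.
Proof.
rewrite /doesr -(update_output w p rho o (b :: o)) /emitp.
rewrite (_ : view_output _ =
  cells_move (cells_move (view w (Registers p rho o) ord_max)
    ((view w (Registers p rho o) ord_max).2 0, MoveLeft)) (bsym b, Stay)).
  exact: does_prim2.
rewrite view_at_output /= /view_output /cells_move /=; congr pair; apply/funext => -[|[|k]] //=.
Qed.

Lemma does_seqr w P Q s s1 s2 t u :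
  doesr w P s s1 t -> doesr w Q s1 s2 u -> doesr w (seqp P Q) s s2 (t + u).+1.
Proof. exact: does_seq. Qed.

Definition marked (a : sym) := a != None.

Lemma marked_reg w s x : x.+1 < K -> marked ((view w s (reg x)).2 0) = (0 < regs s x).
Proof. by move=> hx; rewrite view_at_reg //=; case: (regs s x). Qed.

Lemma marked_input w s : marked ((view w s ord0).2 0) = (0 < ipos s <= size w).
Proof.
rewrite /view /= addn0 /input_cell; case: (ipos s) => //= k; rewrite /marked.
have [lt|ge] := ltnP k (size w); first by rewrite (nth_map false).
by rewrite nth_default // size_map.
Qed.

(** The invariant is given as an explicit sequence [J] of states. The two extra steps per pass are
    the successful test and the return to it. *)
Lemma while_steps w i (b : sym -> bool) P (J : nat -> registers) n t :
  (forall k, k < n -> b ((view w (J k) i).2 0)) ->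
  b ((view w (J n) i).2 0) = false ->
  (forall k, k < n -> doesr w P (J k) (J k.+1) t) ->
  doesr w (whilep i b P) (J 0) (J n) (n * t.+2).
Proof.
elim: n J => [|n IH] J h1 h2 h3; first exact: does_while0.
rewrite mulSn.
apply: (does_weaken (does_whileS (h1 0 _) (h3 0 _) (IH (J \o succn) _ _ _))) => //.
- by move=> k hk; apply: h1.
- by move=> k hk; apply: h3.
Qed.

Lemma while_reg w x P (J : nat -> registers) n t : x.+1 < K ->
  (forall k, k <= n -> regs (J k) x = n - k) ->
  (forall k, k < n -> doesr w P (J k) (J k.+1) t) ->
  doesr w (whilep (reg x) marked P) (J 0) (J n) (n * t.+2).
Proof.
move=> hx h1 h2; apply: while_steps => // [k hk|]; rewrite marked_reg // h1; lia.
Qed.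

End Registers.

Ltac solve_setr := rewrite /setr; repeat (case: eqP => ?); subst; try lia.

Ltac solve_bounded := repeat first
  [ assumption | apply: poly_bounded_add | apply: poly_bounded_mul
  | apply: poly_bounded_const | apply: poly_bounded_id ].

(** * Compilation of expressions and output programs *)

Section Compiler.
Variable K : nat.
Hypothesis K_gt0 : 0 < K.

Lemma does_inc_eq w p rho rho' o x : x.+1 < K -> rho' =1 setr rho x (rho x).+1 ->
  doesr w (incp K x) (Registers p rho o) (Registers p rho' o) 3.
Proof. by move=> hx /funext ->; apply: does_inc. Qed.

Lemma does_dec_eq w p rho rho' o x :
  x.+1 < K -> 0 < rho x -> rho' =1 setr rho x (rho x).-1 ->
  doesr w (decp K x) (Registers p rho o) (Registers p rho' o) 1.
Proof. by move=> hx h /funext ->; apply: does_dec. Qed.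

Lemma while_reg_eq w x P (J : nat -> registers) s s' n t : x.+1 < K ->
  s = J 0 -> s' = J n ->
  (forall k, k <= n -> regs (J k) x = n - k) ->
  (forall k, k < n -> doesr w P (J k) (J k.+1) t) ->
  doesr w (whilep (@reg K x) marked P) s s' (n * t.+2).
Proof. by move=> hx -> ->; apply: while_reg. Qed.

Lemma does_condr w i b P Q s s' t :
  doesr w (if b ((view w s i).2 0) then P else Q) s s' t ->
  doesr w (@condp K i b P Q) s s' t.+1.
Proof. exact: does_cond. Qed.

Definition loopp x P := whilep (@reg K x) marked P.

Definition movep d r := loopp d (seqp (decp K d) (incp K r)).
(** Reading a unary register destroys it, so the value passes through the scratch register [d],
    which then refills [x] along with [r]. *)
Definition copyp x r d :=
  seqp (movep x d) (loopp d (seqp (decp K d) (seqp (incp K x) (incp K r)))).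

Lemma does_move w p rho rho' o d r : d.+1 < K -> r.+1 < K -> d != r ->
  rho' =1 setr (setr rho r (rho r + rho d)) d 0 ->
  doesr w (movep d r) (Registers p rho o) (Registers p rho' o) (rho d * 7).
Proof.
move=> hd hr /eqP dr /funext ->.
pose J k := setr (setr rho r (rho r + k)) d (rho d - k).
apply: (@while_reg_eq _ _ _ (fun k => Registers p (J k) o)) => //.
- by congr Registers; apply/funext => y; rewrite /J; solve_setr.
- by congr Registers; apply/funext => y; rewrite /J; solve_setr.
- by move=> k hk; rewrite /J /=; solve_setr.
move=> k hk; apply: (does_seqr (t := 1) (u := 3)
  (s1 := Registers p (setr (J k) d (rho d - k.+1)) o)).
  by apply: does_dec_eq => // [|y]; rewrite /J; solve_setr.
by apply: does_inc_eq => // y; rewrite /J; solve_setr.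
Qed.

Lemma does_copy w p rho rho' o x d r : x.+1 < K -> d.+1 < K -> r.+1 < K ->
  d != r -> d != x -> r != x -> rho d = 0 ->
  rho' =1 setr rho r (rho r + rho x) ->
  doesr w (copyp x r d) (Registers p rho o) (Registers p rho' o) (rho x * 18).+1.
Proof.
move=> hx hd hr /eqP dr /eqP dx /eqP rx d0 /funext ->.
pose J k := setr (setr (setr rho r (rho r + k)) x k) d (rho x - k).
rewrite (_ : rho x * 18 = rho x * 7 + rho x * 11); last by lia.
apply: (does_seqr (s1 := Registers p (J 0) o)).
  apply: does_move => // [|y]; first by apply/eqP => ?; subst.
  by rewrite /J; solve_setr.
apply: (@while_reg_eq _ _ _ (fun k => Registers p (J k) o)) => //.
- by congr Registers; apply/funext => y; rewrite /J; solve_setr.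
- by move=> k hk; rewrite /J /=; solve_setr.
move=> k hk; apply: (does_seqr (t := 1) (u := 7)
  (s1 := Registers p (setr (J k) d (rho x - k.+1)) o)).
  by apply: does_dec_eq => // [|y]; rewrite /J; solve_setr.
apply: (does_seqr (t := 3) (u := 3)
  (s1 := Registers p (setr (setr (J k) d (rho x - k.+1)) x k.+1) o)).
  by apply: does_inc_eq => // y; rewrite /J; solve_setr.
by apply: does_inc_eq => // y; rewrite /J; solve_setr.
Qed.

(* The first move is needed when the head is on the blank cell after the word. *)
Definition rewindp :=
  seqp (leftp K) (seqp (whilep (@ord0 K) marked (leftp K)) (rightp K)).
Definition lenp r :=
  seqp (whilep (@ord0 K) marked (seqp (rightp K) (incp K r))) rewindp.
Definition bitp x r :=
  seqp (loopp x (seqp (decp K x) (condp (@ord0 K) marked (rightp K) (skipp K))))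
    (seqp (condp (@ord0 K) (fun a => a == bsym true) (incp K r) (skipp K)) rewindp).

Lemma does_rewind w p rho o : p <= size w ->
  doesr w rewindp (Registers p.+1 rho o) (Registers 1 rho o) ((size w) * 3 + 4).
Proof.
move=> hp; rewrite (_ : _ + 4 = (1 + (size w * 3 + 1).+1).+1); last by lia.
apply: (does_seqr (s1 := Registers p rho o)); first exact: does_left.
apply: (does_seqr (s1 := Registers 0 rho o)); last exact: does_right.
apply: (@does_weaken _ _ _ _ (p * 3)); last by rewrite leq_mul2r hp orbT.
have := @while_steps K w ord0 marked (leftp K) (fun k => Registers (p - k) rho o) p 1.
rewrite subn0 subnn; apply => [k hk||k hk].
- by rewrite marked_input /=; lia.
- by rewrite marked_input.
by rewrite subnS; apply: does_left; lia.
Qed.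

Lemma does_len w rho rho' o r : r.+1 < K -> rho' =1 setr rho r (rho r + size w) ->
  doesr w (lenp r) (Registers 1 rho o) (Registers 1 rho' o) (size w * 10 + 5).
Proof.
move=> hr /funext ->.
rewrite (_ : _ + 5 = (size w * 7 + (size w * 3 + 4)).+1); last by lia.
apply: (does_seqr (s1 := Registers (size w).+1 (setr rho r (rho r + size w)) o));
  last exact: does_rewind.
have := @while_steps K w ord0 marked (seqp (rightp K) (incp K r))
  (fun k => Registers k.+1 (setr rho r (rho r + k)) o) (size w) 5.
rewrite (_ : setr rho r (rho r + 0) = rho); last by apply/funext => y; solve_setr.
apply => [k hk||k hk].
- by rewrite marked_input /=; lia.
- by rewrite marked_input /=; lia.
apply: (does_seqr (t := 1) (u := 3)
  (s1 := Registers k.+2 (setr rho r (rho r + k)) o)); first exact: does_right.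
by apply: does_inc_eq => // y; solve_setr.
Qed.

Lemma does_bit w rho rho' o x r : x.+1 < K -> r.+1 < K -> x != r ->
  rho' =1 setr (setr rho r (rho r + nth false w (rho x))) x 0 ->
  doesr w (bitp x r) (Registers 1 rho o) (Registers 1 rho' o)
    (rho x * 6 + size w * 3 + 10).
Proof.
move=> hx hr /eqP xr /funext ->.
rewrite (_ : _ + 10 = (rho x * 6 + (4 + (size w * 3 + 4)).+1).+1); last by lia.
(* The head stops on the blank behind the word, however large the index; a blank differs from
   [bsym true], in agreement with the default [false] of [nth]. *)
pose pos k := minn k (size w).
apply: (does_seqr (s1 := Registers (pos (rho x)).+1 (setr rho x 0) o)).
  apply: (@while_reg_eq _ _ _ (fun k => Registers (pos k).+1 (setr rho x (rho x - k)) o)) => //.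
  - by congr Registers; [rewrite /pos min0n | apply/funext => y; solve_setr].
  - by congr Registers; apply/funext => y; solve_setr.
  - by move=> k hk /=; solve_setr.
  move=> k hk; apply: (does_seqr (t := 1) (u := 2)
    (s1 := Registers (pos k).+1 (setr rho x (rho x - k.+1)) o)).
    by apply: does_dec_eq => // [|y]; solve_setr.
  apply: does_condr; rewrite marked_input /= /pos.
  case: (boolP (k < size w)) => h.
    rewrite ifT; last by lia.
    rewrite (_ : minn k.+1 (size w) = (minn k (size w)).+1); last by lia.
    exact: does_right.
  rewrite ifF; last by lia.
  rewrite (_ : minn k.+1 (size w) = minn k (size w)); last by lia.
  exact: does_skip.
apply: (does_seqr (s1 := Registers (pos (rho x)).+1
  (setr (setr rho r (rho r + nth false w (rho x))) x 0) o)).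
  apply: does_condr; rewrite /= /input_cell /= addn0 -/(pos _).
  rewrite (_ : _ == _ = nth false w (rho x)).
    case: ifP => h; first by apply: does_inc_eq => // y; solve_setr.
    rewrite (_ : setr (setr _ _ _) _ _ = setr rho x 0).
      exact: does_skip.
    by apply/funext => y; solve_setr.
  rewrite /pos; case: ltnP => [lt|ge]; first by rewrite (nth_map false) //; case: nth.
  by rewrite !nth_default ?size_map.
by apply: does_rewind; rewrite /pos; lia.
Qed.

Fixpoint need (e : expr) : nat :=
  match e with
  | Var _ => 1
  | One | Len => 0
  | Bit e => (need e).+1
  | Plus a b => maxn (need a) (need b)
  | Monus a b => (maxn (need a) (need b)).+2
  | Sum a b => (maxn (need a) (need b)).+1
  end.

(* Adds the value of [e] to register [r]; variable [i] is in register [nth 0 vs i]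
   and the registers from [d] on are free. *)
Fixpoint comp (e : expr) (vs : seq nat) (r d : nat) : prog K :=
  match e with
  | Var i => if i < size vs then copyp (nth 0 vs i) r d else skipp K
  | One => incp K r
  | Len => lenp r
  | Bit e => seqp (comp e vs d d.+1) (bitp d r)
  | Plus a b => seqp (comp a vs r d) (comp b vs r d)
  | Monus a b =>
      seqp (comp a vs d d.+2) (seqp (comp b vs d.+1 d.+2)
        (seqp (loopp d.+1 (seqp (decp K d.+1) (condp (@reg K d) marked (decp K d) (skipp K))))
              (movep d r)))
  | Sum a b =>
      seqp (comp a vs d d.+1) (loopp d (seqp (decp K d) (comp b (d :: vs) r d.+1)))
  end.

Definition ready n (vs : seq nat) d (rho : nat -> nat) :=
  (forall x, x \in vs -> x < d /\ rho x <= n) /\ (forall x, d <= x -> rho x = 0).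

Lemma ready_set n vs d d' r v rho :
  ready n vs d rho -> r < d' -> d <= d' -> r \notin vs -> ready n vs d' (setr rho r v).
Proof.
move=> [h1 h2] rd dd /negP rvs; split=> x hx.
  by have [? ?] := h1 x hx; split; first lia; rewrite /setr; case: eqP => // ?; subst.
by rewrite /setr; case: eqP => [|_]; [lia | apply: h2; lia].
Qed.

Lemma map_setr (vs : seq nat) rho r v :
  r \notin vs -> [seq setr rho r v x | x <- vs] = [seq rho x | x <- vs].
Proof.
move=> /negP h; apply/eq_in_map => x hx; rewrite /setr; case: eqP => // ?; subst.
by case: h.
Qed.

Lemma ready_notin n vs d rho x : ready n vs d rho -> d <= x -> x \notin vs.
Proof. by move=> [h _] le; apply/negP => /h []; lia. Qed.

Lemma ready_le n vs d rho : ready n vs d rho ->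
  forall x, x \in [seq rho x | x <- vs] -> x <= n.
Proof. by move=> [h _] x /mapP [y /h [_ ?] ->]. Qed.

(** Since [rho'] differs from [rho] at [r] only, the scratch registers from [d] on are zero again
    afterwards, which is what [ready] asks for the next subexpression. The time depends on [n] alone
    and so is the same for all passes of a loop. *)
Lemma does_comp e : exists2 f, poly_bounded f & forall w n vs r d rho rho' o,
  size w <= n -> ready n vs d rho -> r < d -> r \notin vs -> d + need e < K ->
  rho' =1 setr rho r (rho r + eval w [seq rho x | x <- vs] e) ->
  doesr w (comp e vs r d) (Registers 1 rho o) (Registers 1 rho' o) (f n).
Proof.
elim: e => [i|||e [f hf fP]|a [f hf fP] b [g hg gP]|a [f hf fP] b [g hg gP]|a [f hf fP] b [g hg gP]].
- exists (fun n => n * 18 + 1); first by solve_bounded.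
  move=> w n vs r d rho rho' o hw [h1 h2] rd rvs hK; rewrite /= in hK *.
  case: ifP => hi.
    rewrite (nth_map 0) // => e; set x := nth 0 vs i in e *.
    have xvs : x \in vs by apply: mem_nth.
    have [? ?] := h1 x xvs; have ? : x <> r by move=> ?; subst; rewrite xvs in rvs.
    apply: (@does_weakenr _ _ _ _ _ (rho x * 18).+1); last by lia.
    by apply: does_copy => //; try lia; [apply/eqP; lia.. | apply: h2].
  move=> /funext ->; rewrite nth_default ?size_map; last by lia.
  rewrite (_ : setr _ _ _ = rho); first exact: does_skip.
  by apply/funext => y; solve_setr.
- exists (fun => 3); first by solve_bounded.
  move=> w n vs r d rho rho' o hw _ rd rvs hK; rewrite /= in hK *.
  by rewrite addn1 => h; apply: does_inc_eq => //; lia.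
- exists (fun n => n * 10 + 5); first by solve_bounded.
  move=> w n vs r d rho rho' o hw _ rd rvs hK; rewrite /= in hK * => h.
  by apply: (@does_weakenr _ _ _ _ _ (size w * 10 + 5)); [apply: does_len => //; lia | lia].
- have [v hv vP] := eval_bounded e.
  exists (fun n => f n + (v n * 6 + n * 3 + 11)); first by solve_bounded.
  move=> w n vs r d rho rho' o hw rdy rd rvs hK; rewrite /= in hK *.
  set x := eval _ _ e => h; have d0 := rdy.2 d (leqnn d).
  have le : x <= v n by apply: vP => //; apply: ready_le rdy.
  have dvs := ready_notin rdy (leqnn d).
  apply: (@does_weakenr _ _ _ _ _ (f n + (x * 6 + size w * 3 + 10)).+1); last by lia.
  apply: (does_seqr (s1 := Registers 1 (setr rho d x) o)).
    apply: fP => //; try lia; last by move=> y; rewrite d0.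
    by split=> [y /rdy.1 []|y ?]; [lia | apply: rdy.2; lia].
  rewrite [X in X * 6](_ : x = setr rho d x d); last by rewrite /setr eqxx.
  apply: does_bit => //; [lia | lia | by apply/eqP; lia |].
  by move=> y; rewrite h; solve_setr.
- exists (fun n => f n + (g n + 1)); first by solve_bounded.
  move=> w n vs r d rho rho' o hw rdy rd rvs hK; rewrite /= in hK *.
  set x := eval _ _ a => h; apply: (@does_weakenr _ _ _ _ _ (f n + g n).+1); last by lia.
  apply: (does_seqr (s1 := Registers 1 (setr rho r (rho r + x)) o)).
    by apply: fP => //; lia.
  apply: gP => //; [exact: ready_set rdy _ _ _ | lia |].
  by move=> y; rewrite h map_setr // /setr eqxx; case: eqP; rewrite ?addnA.
- have [u hu uP] := eval_bounded a; have [v hv vP] := eval_bounded b.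
  exists (fun n => f n + (g n + (v n * 7 + u n * 7 + 3))); first by solve_bounded.
  move=> w n vs r d rho rho' o hw rdy rd rvs hK; rewrite /= in hK *.
  set x := eval _ _ a; set y := eval _ _ b => h.
  have d0 := rdy.2 d (leqnn d); have d1 := rdy.2 d.+1 (leqnSn d).
  have lex : x <= u n by apply: uP => //; apply: ready_le rdy.
  have ley : y <= v n by apply: vP => //; apply: ready_le rdy.
  have dvs := ready_notin rdy (leqnn d); have dvs1 := ready_notin rdy (leqnSn d).
  apply: (@does_weakenr _ _ _ _ _ (f n + (g n + (y * 7 + (x - y) * 7).+1).+1).+1); last by lia.
  apply: (does_seqr (s1 := Registers 1 (setr rho d x) o)).
    apply: fP => //; try lia; last by move=> z; rewrite d0.
    by split=> [z /rdy.1 []|z ?]; [lia | apply: rdy.2; lia].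
  apply: (does_seqr (s1 := Registers 1 (setr (setr rho d x) d.+1 y) o)).
    apply: gP => //; [by apply: ready_set rdy _ _ _ => //; lia |lia|].
    move=> z; rewrite map_setr // -/y; congr (setr _ _ _ _).
    by rewrite /setr; case: eqP => [|_]; [lia | rewrite d1].
  apply: (does_seqr (s1 := Registers 1 (setr (setr rho d (x - y)) d.+1 0) o)).
    apply: (@while_reg_eq _ _ _
      (fun k => Registers 1 (setr (setr rho d (x - k)) d.+1 (y - k)) o)); first by lia.
    - by congr Registers; apply/funext => z; solve_setr.
    - by congr Registers; apply/funext => z; solve_setr.
    - by move=> k hk /=; solve_setr.
    move=> k hk; apply: (does_seqr (t := 1) (u := 3)
      (s1 := Registers 1 (setr (setr rho d (x - k)) d.+1 (y - k.+1)) o)).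
      by apply: does_dec_eq => [||z]; try lia; solve_setr.
    apply: does_condr; rewrite marked_reg /=; try lia.
    case: ifP => hc; last first.
      rewrite (_ : setr _ _ _ = setr (setr rho d (x - k.+1)) d.+1 (y - k.+1)).
        exact: does_skip.
      have xk : x - k = 0 by move: hc; solve_setr.
      by apply/funext => z; solve_setr.
    apply: (@does_weakenr _ _ _ _ _ 1) => //.
    by apply: does_dec_eq => [||z]; try lia; solve_setr.
  apply: (@does_weakenr _ _ _ _ _ (setr (setr rho d (x - y)) d.+1 0 d * 7));
    last by rewrite leq_mul2r; solve_setr.
  apply: does_move; [lia | lia | by apply/eqP; lia |].
  by move=> z; rewrite h; solve_setr.
- have [u hu uP] := eval_bounded a.
  exists (fun n => f n + (u n * (g (n + u n) + 4) + 1)).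
    by solve_bounded; apply: (poly_bounded_comp hg); solve_bounded.
  move=> w n vs r d rho rho' o hw rdy rd rvs hK; rewrite /= in hK *.
  set vv := [seq rho x | x <- vs]; set x := eval _ _ a => h.
  have d0 := rdy.2 d (leqnn d); have dvs := ready_notin rdy (leqnn d).
  have le : x <= u n by apply: uP => //; apply: ready_le rdy.
  apply: (@does_weakenr _ _ _ _ _ (f n + x * (1 + g (n + u n)).+3).+1); last first.
    have : x * (g (n + u n) + 4) <= u n * (g (n + u n) + 4) by rewrite leq_mul2r le orbT.
    by lia.
  apply: (does_seqr (s1 := Registers 1 (setr rho d x) o)).
    apply: fP => //; try lia; last by move=> z; rewrite d0.
    by split=> [z /rdy.1 []|z ?]; [lia | apply: rdy.2; lia].
  (* The counter is decremented before the body runs, so the body sees the indices from [x - 1] down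
     to 0 and the sum fills up from its upper end. *)
  pose J k := setr (setr rho r (rho r + \sum_(x - k <= i < x) eval w (i :: vv) b)) d (x - k).
  apply: (@while_reg_eq _ _ _ (fun k => Registers 1 (J k) o)); first by lia.
  - by congr Registers; apply/funext => z; rewrite /J subn0 big_geq //; solve_setr.
  - congr Registers; apply/funext => z; rewrite h /J subnn; solve_setr.
  - by move=> k hk /=; rewrite /J; solve_setr.
  move=> k hk; apply: (does_seqr (s1 := Registers 1 (setr (J k) d (x - k.+1)) o)).
    by apply: does_dec_eq => [||z]; try lia; rewrite /J; solve_setr.
  apply: gP; first by lia.
  - split=> [z|z hz]; last by rewrite /J; solve_setr; apply: rdy.2; lia.
    rewrite inE => /predU1P [->|hz]; first by split=> //; rewrite /setr eqxx; lia.
    have [? ?] := rdy.1 z hz; split; first by lia.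
    by rewrite /J; solve_setr; rewrite hz in rvs.
  - by lia.
  - by rewrite inE negb_or rvs andbT; apply/eqP; lia.
  - by lia.
  move=> z; rewrite /= [setr _ d _ d]/setr eqxx map_setr // map_setr // map_setr // -/vv /J.
  rewrite [in LHS](@big_ltn _ _ _ (x - k.+1)); last by lia.
  by rewrite (_ : (x - k.+1).+1 = x - k); [solve_setr | lia].
Qed.

Fixpoint need_emit (p : emit) : nat :=
  match p with
  | EBit e => (need e).+1
  | ELoop e p => (maxn (need e) (need_emit p)).+1
  | ESeq p q => maxn (need_emit p) (need_emit q)
  end.

(* The output is written from right to left, which leaves the head on its first
   letter; the loop counters run downwards accordingly. *)
Fixpoint comp_emit (p : emit) (vs : seq nat) (d : nat) : prog K :=
  match p with
  | EBit e =>
      seqp (comp e vs d d.+1)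
        (condp (@reg K d) marked (seqp (loopp d (decp K d)) (emitp K true)) (emitp K false))
  | ELoop e p =>
      seqp (comp e vs d d.+1) (loopp d (seqp (decp K d) (comp_emit p (d :: vs) d.+1)))
  | ESeq p q => seqp (comp_emit q vs d) (comp_emit p vs d)
  end.

Lemma does_comp_emit p : exists2 f, poly_bounded f & forall w n vs d rho o,
  size w <= n -> ready n vs d rho -> d + need_emit p < K ->
  doesr w (comp_emit p vs d) (Registers 1 rho o)
    (Registers 1 rho (out w [seq rho x | x <- vs] p ++ o)) (f n).
Proof.
elim: p => [e|e p [g hg gP]|p IHp q [g hg gP]].
- have [f hf fP] := does_comp e; have [u hu uP] := eval_bounded e.
  exists (fun n => f n + u n * 3 + 7); first by solve_bounded.
  move=> w n vs d rho o hw rdy hK; rewrite /= in hK *; set x := eval _ _ e.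
  have d0 := rdy.2 d (leqnn d); have dvs := ready_notin rdy (leqnn d).
  have le : x <= u n by apply: uP => //; apply: ready_le rdy.
  apply: (@does_weakenr _ _ _ _ _ (f n + (x * 3 + 4).+1).+1); last by lia.
  apply: (does_seqr (s1 := Registers 1 (setr rho d x) o)).
    apply: fP => //; try lia; last by move=> z; rewrite d0.
    by split=> [z /rdy.1 []|z ?]; [lia | apply: rdy.2; lia].
  apply: does_condr; rewrite marked_reg /=; try lia.
  rewrite {1}/setr eqxx; case: ifP => hx; last first.
    rewrite (_ : setr rho d x = rho); last by apply/funext => z; solve_setr.
    by apply: (@does_weakenr _ _ _ _ _ 3); [exact: (does_emit K_gt0) | lia].
  rewrite (_ : _ + 4 = (x * 3 + 3).+1); last by lia.
  apply: (does_seqr (s1 := Registers 1 rho o)); last exact: (does_emit K_gt0).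
  apply: (@while_reg_eq _ _ _ (fun k => Registers 1 (setr rho d (x - k)) o)); first by lia.
  + by rewrite subn0.
  + by congr Registers; apply/funext => z; solve_setr.
  + by move=> k hk /=; rewrite /setr eqxx.
  by move=> k hk; apply: does_dec_eq => [||z]; try lia; solve_setr.
- have [f hf fP] := does_comp e; have [u hu uP] := eval_bounded e.
  exists (fun n => f n + (u n * (g (n + u n) + 4) + 1)).
    by solve_bounded; apply: (poly_bounded_comp hg); solve_bounded.
  move=> w n vs d rho o hw rdy hK; rewrite /= in hK *.
  set vv := [seq rho x | x <- vs]; set x := eval _ _ e.
  have d0 := rdy.2 d (leqnn d); have dvs := ready_notin rdy (leqnn d).
  have le : x <= u n by apply: uP => //; apply: ready_le rdy.
  apply: (@does_weakenr _ _ _ _ _ (f n + x * (1 + g (n + u n)).+3).+1); last first.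
    have : x * (g (n + u n) + 4) <= u n * (g (n + u n) + 4) by rewrite leq_mul2r le orbT.
    by lia.
  apply: (does_seqr (s1 := Registers 1 (setr rho d x) o)).
    apply: fP => //; try lia; last by move=> z; rewrite d0.
    by split=> [z /rdy.1 []|z ?]; [lia | apply: rdy.2; lia].
  pose J k := Registers 1 (setr rho d (x - k))
    (flatten [seq out w (i :: vv) p | i <- iota (x - k) k] ++ o).
  apply: (@while_reg_eq _ _ _ J); first by lia.
  + by rewrite /J subn0.
  + rewrite /J subnn (_ : setr _ _ _ = rho) //; by apply/funext => z; solve_setr.
  + by move=> k hk; rewrite /J /= /setr eqxx.
  move=> k hk; rewrite /J; set o1 := flatten _ ++ o.
  apply: (does_seqr (s1 := Registers 1 (setr rho d (x - k.+1)) o1)).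
    by apply: does_dec_eq => [||z]; try lia; solve_setr.
  have -> : flatten [seq out w (i :: vv) p | i <- iota (x - k.+1) k.+1] ++ o =
            out w [seq setr rho d (x - k.+1) z | z <- d :: vs] p ++ o1.
    rewrite /= map_setr // {1}/setr eqxx -catA; congr (_ ++ (_ ++ _)).
    by rewrite (_ : (x - k.+1).+1 = x - k) //; lia.
  apply: gP; [lia | | lia]; split=> [z|z hz]; last by solve_setr; apply: rdy.2; lia.
  rewrite inE => /predU1P [->|hz]; first by split=> //; rewrite /setr eqxx; lia.
  by have [? ?] := rdy.1 z hz; split; solve_setr.
have [f hf fP] := IHp; exists (fun n => f n + (g n + 1)); first by solve_bounded.
move=> w n vs d rho o hw rdy hK; rewrite /= in hK *.
apply: (@does_weakenr _ _ _ _ _ (g n + f n).+1); last by lia.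
apply: (does_seqr (s1 := Registers 1 rho (out w [seq rho x | x <- vs] q ++ o))).
  by apply: gP => //; lia.
by rewrite -catA; apply: fP => //; lia.
Qed.

End Compiler.

Lemma read_bits_nth (M : machine) (s : seq (symbol M)) (o : seq bool) :
  (forall k, nth None s k = nth None [seq Some (inl b) | b <- o] k) -> read_bits s = o.
Proof.
elim: o s => [|b o IH] [|a s] //= h.
- by have := h 0; rewrite /= => ->.
- by have := h 0.
by have /= -> := h 0; rewrite (IH s) // => k; apply: (h k.+1).
Qed.

Theorem out_polytime (p : emit) : polytime (fun w => out w [::] p).
Proof.
(* Of the [K.+1] tapes one holds the input and one the output, which leaves [need_emit p]
   registers. *)
pose K := (need_emit p).+1; have K_gt0 : 0 < K by [].
have [f [q fq] fP] := does_comp_emit K_gt0 p.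
exists (mach (comp_emit K p [::] 0)), q => w.
have rdy : ready (size w) [::] 0 (fun => 0) by split.
have [|n [s [T [ln eT es halts]]]] :=
  fP w (size w) [::] 0 (fun => 0) [::] (leqnn _) rdy (ltnSn _)
     (init (mach (comp_emit K p [::] 0)) w).2.
  apply/funext => i; rewrite /memory_of /view ffunE.
  have nil0 : nth (None : symbol_over void) [::] = fun=> None.
    by apply/funext => k; rewrite nth_nil.
  case: (boolP (i == ord0)) => h.
    by rewrite /cells_of /= nil0 /view_input /=; congr pair; apply/funext => -[].
  by rewrite /cells_of /= nil0; case: eqP => _; rewrite /view_output /= ?nil0.
exists (s, T); first by apply: (steps_run es) => //; apply: leq_trans ln (fq _).
apply: read_bits_nth => k; move: eT => /(congr1 (fun m => (m ord_max).2 k)).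
by rewrite (view_at_output K_gt0) /= cats0.
Qed.

(** * A categorical template from gluing types *)

Definition ternary (s : nat) : signature :=
  @Signature 'I_s (fun _ => 3) (fun _ => isT).

Definition relations (T : Type) := nat -> T -> T -> T -> Prop.

Definition relhom (T U : Type) (R : relations T) (R' : relations U) (f : T -> U) :=
  forall s x y z, R s x y z -> R' s (f x) (f y) (f z).

Definition fact := (nat * (nat * nat * nat))%type.

Definition rel_of (F : seq fact) : relations nat := fun s x y z => (s, (x, y, z)) \in F.

Definition map_fact (f : nat -> nat) (t : fact) : fact :=
  (t.1, (f t.2.1.1, f t.2.1.2, f t.2.2)).

Lemma rel_of_map F f s x y z : rel_of (map (map_fact f) F) s x y z ->
  exists x' y' z', [/\ rel_of F s x' y' z', x = f x', y = f y' & z = f z'].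
Proof. by move=> /mapP [[s' [[x' y'] z']] h [-> -> -> ->]]; exists x', y', z'. Qed.

Lemma map_rel_of F f : relhom (rel_of F) (rel_of (map (map_fact f) F)) f.
Proof. by move=> s x y z h; apply/mapP; exists (s, (x, y, z)). Qed.

Definition bounded_by M (F : seq fact) :=
  forall s x y z, rel_of F s x y z -> [/\ x < M, y < M & z < M].

(* The parameters [P] of [F] are sent to [a] and the other elements are made
   larger than [M]. *)
Definition plug M (a P : seq nat) (x : nat) : nat :=
  if x \in P then nth 0 a (index x P) else M + x.

Definition glue (F0 : seq fact) M a P (F : seq fact) : seq fact :=
  F0 ++ map (map_fact (plug M a P)) F.

Definition fact_bound (F : seq fact) : nat :=
  foldr (fun t m => maxn (maxn t.2.1.1 t.2.1.2).+1 (maxn t.2.2.+1 m)) 0 F.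

Lemma fact_boundP F M : fact_bound F <= M -> bounded_by M F.
Proof.
elim: F => [|[s' [[x' y'] z']] F IH] //= le s x y z.
rewrite /rel_of inE => /predU1P [[_ -> -> ->]|]; first by split; lia.
by apply: IH; lia.
Qed.

Definition seq_bound (a : seq nat) : nat := foldr (fun x m => maxn x.+1 m) 0 a.

Lemma seq_boundP a x : x \in a -> x < seq_bound a.
Proof. by elim: a => //= y a IH; rewrite inE => /predU1P [->|/IH]; lia. Qed.

Section Generic.
Variable s0 : nat.
Variable C : relations nat -> Prop.
Hypothesis C_hom : forall R R' f, relhom R R' f -> C R' -> C R.
Hypothesis C_empty : C (rel_of [::]).
Hypothesis C_disjoint : forall F0 M F, bounded_by M F0 ->
  C (rel_of F0) -> C (rel_of F) -> C (rel_of (glue F0 M [::] [::] F)).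
(** Types abstract a congruence of finite index: replacing a glued part by another one of the same
    type does not lead out of the class. Finiteness and [C_glue] are all that is assumed of them. *)
Variable T : nat -> finType.
Variable type : forall k, seq fact -> seq nat -> T k.
Hypothesis C_glue : forall k F0 M a P P' F F',
  bounded_by M F0 -> (forall x, x \in a -> x < M) -> uniq a -> uniq P -> uniq P' ->
  size a = k -> size P = k -> size P' = k ->
  type k F P = type k F' P' ->
  C (rel_of (glue F0 M a P F)) -> C (rel_of (glue F0 M a P' F')).

Definition bound F a := maxn (fact_bound F) (seq_bound a).

Definition valid (a P : seq nat) := [&& uniq a, uniq P & size a == size P].

(** Each task [(a, P, F)] is attempted once, when its number comes up. A later attempt could not
    succeed where the first one failed, because [C_hom] lets [C] pass from a stage to every earlier
    one. *)
Fixpoint stage (i : nat) : seq fact :=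
  if i is j.+1 then
    if unpickle j is Some (a, P, F) then
      let G := glue (stage j) (bound (stage j) a) a P F in
      if `[< valid a P /\ C (rel_of G) >] then G else stage j
    else stage j
  else [::].

Definition limit : relations nat := fun s x y z => exists i, rel_of (stage i) s x y z.

Lemma stage_C i : C (rel_of (stage i)).
Proof.
elim: i => //= i IH; case: unpickle => [[[a P] F]|] //.
by case: asboolP => // -[].
Qed.

Lemma stage_mono i j : i <= j -> relhom (rel_of (stage i)) (rel_of (stage j)) id.
Proof.
move=> le s x y z h; rewrite -(subnKC le); elim: (j - i) => [|n]; rewrite ?addn0 // addnS /=.
move=> h1; case: unpickle => [[[a P] F]|] //; case: asboolP => // _.
by rewrite /rel_of mem_cat [X in X || _]h1.
Qed.

Lemma stage_bounded F a : bounded_by (bound F a) F.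
Proof. by apply: fact_boundP; rewrite leq_maxl. Qed.

Lemma bound_param F a x : x \in a -> x < bound F a.
Proof. by move=> /seq_boundP; rewrite /bound; lia. Qed.

(** Compactness: finitely many facts appear in the union at a common stage. *)
Lemma limit_stage F f i0 : relhom (rel_of F) limit f ->
  exists2 j, i0 <= j & relhom (rel_of F) (rel_of (stage j)) f.
Proof.
elim: F => [|[s [[x y] z]] F IH] h; first by exists i0.
have [|j le hj] := IH; first by move=> s' x' y' z' h'; apply: h; rewrite /rel_of inE h' orbT.
have [i hi] : limit s (f x) (f y) (f z) by apply: h; rewrite /rel_of inE eqxx.
exists (maxn i j); first by lia.
move=> s' x' y' z'; rewrite /rel_of inE => /predU1P [[-> -> -> ->]|h'].
  by apply: (stage_mono (leq_maxl i j)).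
by apply: (stage_mono (leq_maxr i j)); apply: hj.
Qed.

Lemma limit_C F f : relhom (rel_of F) limit f -> C (rel_of F).
Proof. by move=> /(@limit_stage _ _ 0) [j _ h]; apply: C_hom h (stage_C j). Qed.

Definition compatible F0 a P F := exists R f g,
  [/\ C R, relhom (rel_of F0) R f, relhom (rel_of F) R g & map f a = map g P].

Lemma map_plug M a P : uniq P -> size a = size P -> map (plug M a P) P = a.
Proof.
move=> uP sz; apply: (@eq_from_nth _ 0); rewrite size_map // => i hi.
by rewrite (nth_map 0) // /plug mem_nth // index_uniq.
Qed.

(** The glued structure is the free amalgam: it maps to every other amalgam, so by [C_hom] it lies
    in the class as soon as one of them does. In particular the choice of [M] is immaterial. *)
Lemma compatible_glue F0 M a P F :
  bounded_by M F0 -> (forall x, x \in a -> x < M) -> valid a P ->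
  compatible F0 a P F <-> C (rel_of (glue F0 M a P F)).
Proof.
move=> bF ba /and3P [ua uP /eqP sz]; split=> [[R [f [g [cR hf hg e]]]]|h]; last first.
  exists (rel_of (glue F0 M a P F)), id, (plug M a P); split=> //.
  - by move=> s x y z; rewrite /rel_of mem_cat => ->.
  - by move=> s x y z /(@map_rel_of _ (plug M a P)); rewrite /rel_of mem_cat => ->; rewrite orbT.
  by rewrite map_id map_plug.
apply: (@C_hom _ R (fun x => if x < M then f x else g (x - M))) => //.
have plugE x : (if plug M a P x < M then f (plug M a P x) else g (plug M a P x - M)) = g x.
  rewrite /plug; case: (boolP (x \in P)) => xP; last by rewrite ltnNge leq_addr /= addKn.
  have ix : index x P < size a by rewrite sz index_mem.
  rewrite ba ?mem_nth // -(nth_map 0 0) // e (nth_map 0) ?index_mem //.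
  by rewrite nth_index.
move=> s x y z; rewrite /rel_of mem_cat => /orP [h|].
  by have [-> -> ->] := bF _ _ _ _ h; apply: hf.
by move=> /(@rel_of_map F) [x' [y' [z' [h -> -> ->]]]]; rewrite !plugE; apply: hg.
Qed.

Lemma compatible_type k F0 a P P' F F' : valid a P -> valid a P' -> size a = k ->
  type k F P = type k F' P' -> compatible F0 a P F -> compatible F0 a P' F'.
Proof.
move=> v v' sz et; have [bF ba] := (@stage_bounded F0 a, @bound_param F0 a).
move=> /(compatible_glue F bF ba v) h; apply/(compatible_glue F' bF ba v').
move: v v' => /and3P [ua uP /eqP sP] /and3P [_ uP' /eqP sP'].
by apply: (C_glue bF ba ua uP uP' sz _ _ et h); [rewrite -sP | rewrite -sP'].
Qed.

Lemma compatible_limit F0 a P F f g :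
  relhom (rel_of F0) limit f -> relhom (rel_of F) limit g -> map f a = map g P ->
  compatible F0 a P F.
Proof.
move=> /(@limit_stage _ _ 0) [i _ hf] /(@limit_stage _ _ i) [j le hg] e.
exists (rel_of (stage j)), f, g; split=> //; first exact: stage_C.
by move=> s x y z /hf; apply: stage_mono.
Qed.

Lemma stage_limit i : relhom (rel_of (stage i)) limit id.
Proof. by move=> s x y z h; exists i. Qed.

(** What is missing over [a] is missing for a reason visible at a finite stage. This turns the
    absence of a realization into a finitary fact that can be transported to another tuple. *)
Lemma stage_task a P F : valid a P ->
  (exists2 M, (forall x, x \in a -> x < M) & relhom (rel_of F) limit (plug M a P)) \/
  exists i, ~ compatible (stage i) a P F.
Proof.
move=> v; set i := pickle (a, P, F); set M := bound (stage i) a.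
have [bF ba] := (@stage_bounded (stage i) a, @bound_param (stage i) a).
have [h|h] := EM (C (rel_of (glue (stage i) M a P F))); last first.
  by right; exists i => /(compatible_glue F bF ba v).
left; exists M => // s x y z /(@map_rel_of _ (plug M a P)) hF; exists i.+1 => /=.
rewrite /i pickleK -/i; case: asboolP => [_|[]] //.
by rewrite /rel_of mem_cat [X in _ || X]hF orbT.
Qed.

Definition realizes a P F := exists2 f, relhom (rel_of F) limit f & map f P = a.

(** A realization makes [F] compatible with every stage over [a], and compatibility depends on the
    type only; so the copy of [F'] requested by its own task was really added. *)
Lemma realizes_type k a P P' F F' : valid a P -> valid a P' -> size a = k ->
  type k F P = type k F' P' -> realizes a P F ->
  exists2 M, (forall x, x \in a -> x < M) & relhom (rel_of F') limit (plug M a P').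
Proof.
move=> v v' sz et [f hf ef]; have [//|[i []]] := stage_task F' v'.
apply: (compatible_type v v' sz et).
by apply: (compatible_limit (@stage_limit i) hf); rewrite map_id ef.
Qed.

Definition types k (a : seq nat) (t : T k) :=
  exists F P, [/\ valid a P, type k F P = t & realizes a P F].

(** A single fact on [a] is a finite structure with parameters [a], realized by the identity. A
    realization of its type over [b] yields a copy of the fact there. *)
Lemma types_fact k a b s x y z : uniq a -> uniq b -> size a = k -> size b = k ->
  (forall t, types a t -> @types k b t) ->
  x \in a -> y \in a -> z \in a -> limit s x y z ->
  limit s (nth 0 b (index x a)) (nth 0 b (index y a)) (nth 0 b (index z a)).
Proof.
move=> ua ub sa sb h xa ya za hs; pose F : seq fact := [:: (s, (x, y, z))].
have [|F' [P' [vP' et re]]] := h (type k F a).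
  exists F, a; split; rewrite /valid ?ua ?eqxx //.
  exists id; last by rewrite map_id.
  by move=> s' x' y' z'; rewrite /rel_of inE => /eqP [-> -> -> ->].
have vb : valid b a by rewrite /valid ub ua sa sb eqxx.
have [M _ hM] := realizes_type vP' vb sb et re.
by have := hM s x y z; rewrite /plug xa ya za; apply; rewrite /rel_of inE.
Qed.

Lemma uniform_stage (X : finType) (Q : nat -> X -> Prop) :
  (forall i j x, i <= j -> Q i x -> Q j x) -> (forall x, exists i, Q i x) ->
  exists i, forall x, Q i x.
Proof.
move=> mono h; have [g hg] := choice h.
by exists (\max_x g x) => x; apply: mono (hg x); apply: leq_bigmax.
Qed.

(* The stage [i] of the proof decides every type over [d :: a]; the fresh copy of
   this stage over [b] provides [e]. *)
Lemma types_extend k a b d : uniq a -> uniq b -> size a = k -> size b = k ->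
  (forall t, types a t <-> @types k b t) -> d \notin a ->
  exists2 e, e \notin b & forall t, types (d :: a) t <-> @types k.+1 (e :: b) t.
Proof.
move=> ua ub sa sb h da.
have uda : uniq (d :: a) by rewrite /= da.
have [|t|i hi] := @uniform_stage (T k.+1) (fun i t =>
    (types (d :: a) t -> exists F P f, [/\ valid (d :: a) P, type k.+1 F P = t,
       relhom (rel_of F) (rel_of (stage i)) f & map f P = d :: a]) /\
    (~ types (d :: a) t -> forall F P, valid (d :: a) P -> type k.+1 F P = t ->
       ~ compatible (stage i) (d :: a) P F)).
- move=> i j t le [h1 h2]; split=> [/h1 [F [P [f [vP et hf ef]]]]|/h2 nc F P vP et].
    by exists F, P, f; split=> // s x y z /hf; apply: stage_mono.
  move=> [R [f [g [cR hf hg e]]]]; apply: (nc F P vP et); exists R, f, g; split=> //.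
  by move=> s x y z /(stage_mono le); apply: hf.
- have [ht|ht] := EM (types (d :: a) t).
    have [F [P [vP et [f hf ef]]]] := ht.
    by have [i _ hi] := @limit_stage F f 0 hf; exists i; split=> // _; exists F, P, f.
  have [[F [P [vP et]]]|none] := EM (exists F P, valid (d :: a) P /\ type k.+1 F P = t);
    last by exists 0; split=> // _ F P vP et; case: none; exists F, P.
  have [[M _ hM]|[i hi]] := stage_task F vP.
    case: ht; exists F, P; split=> //; exists (plug M (d :: a) P) => //.
    by move/and3P: vP => [_ uP /eqP sP]; rewrite map_plug.
  exists i; split=> // _ F' P' vP' et' c; apply: hi.
  by apply: (@compatible_type k.+1 _ _ _ _ _ _ vP' vP _ _ c); [rewrite /= sa | rewrite et et'].

have vaa : valid a a by rewrite /valid ua eqxx.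
have [|F [P [vP et re]]] := (h (type k (stage i) a)).1.
  by exists (stage i), a; split=> //; exists id; [apply: stage_limit | rewrite map_id].
have vba : valid b a by rewrite /valid ua ub sa sb eqxx.
have [M bM hM] := realizes_type vP vba sb et re.
have ed : plug M b a d = M + d by rewrite /plug (negbTE da).
have eda : map (plug M b a) (d :: a) = (M + d) :: b by rewrite /= ed map_plug // sa sb.
have eb : M + d \notin b by apply/negP => /bM; lia.
exists (M + d) => // t; split=> ht.
  have [F1 [P1 [f [vP1 et1 hf ef]]]] := (hi t).1 ht.
  exists F1, P1; split=> //.
    by move: vP1; rewrite /valid /= ub eb sa sb => /andP [_ ->].
  exists (plug M b a \o f); last by rewrite map_comp ef.
  by move=> s x y z /hf; apply: hM.
(* Suppose [t] is realized over the copy but not over [d :: a]. Since [plug] carries stage [i] into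
   the limit, with [d] going to [M + d], this realization would be compatible with stage [i] over
   [d :: a], which the choice of [i] excludes. *)
apply: contrapT => nt; have [F1 [P1 [vP1 et1 [f hf ef]]]] := ht.
have vP1' : valid (d :: a) P1.
  by move: vP1; rewrite /valid /= da ua sa sb => /andP [_ ->].
apply: ((hi t).2 nt F1 P1 vP1' et1).
by apply: (compatible_limit hM hf); rewrite ef.
Qed.

(** * Back-and-forth and omega-categoricity of the template *)

Definition template : structure (ternary s0) :=
  @Structure (ternary s0) nat
    (fun R t => limit R (nth 0 t 0) (nth 0 t 1) (nth 0 t 2)).

(** Gluing needs injective parameters, so tuples with repeated entries are read off injective lists;
    the common index list [idx] makes the equalities between entries agree on both sides. *)
Definition same_type (u v : seq nat) := exists a b idx,
  [/\ uniq a, uniq b, size a = size b &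
   [/\ forall i, i \in idx -> i < size a, u = map (nth 0 a) idx, v = map (nth 0 b) idx &
       forall t, types a t <-> @types (size a) b t]].

Lemma same_type_sym u v : same_type u v -> same_type v u.
Proof.
move=> [a [b [idx [ua ub sz [hi eu ev ht]]]]]; exists b, a, idx; split=> //.
by split=> //; rewrite -sz // => t; rewrite ht.
Qed.

Lemma same_type_extend u v d :
  same_type u v -> exists e, same_type (d :: u) (e :: v).
Proof.
move=> [a [b [idx [ua ub sz [hi eu ev ht]]]]].
have [da|da] := boolP (d \in a).
  exists (nth 0 b (index d a)), a, b, (index d a :: idx); split=> //.
  split=> //=; rewrite -?eu -?ev ?nth_index // => i.
  by rewrite inE => /predU1P [->|/hi]; rewrite ?index_mem.
have [e eb he] := types_extend ua ub erefl (esym sz) ht da.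
exists e, (d :: a), (e :: b), (0 :: map succn idx); split=> /=.
- by rewrite da.
- by rewrite eb.
- by rewrite sz.
split=> // [i||].
- by rewrite inE => /predU1P [->|/mapP [j /hi hj ->]].
- by rewrite -map_comp eu.
- by rewrite -map_comp ev.
Qed.

Lemma same_type_rel u v k (f : 'I_k -> nat) (g : 'I_k -> nat) s (x y z : 'I_k) :
  same_type u v -> (forall i, f i = nth 0 u i) -> (forall i, g i = nth 0 v i) ->
  size u = k -> limit s (f x) (f y) (f z) -> limit s (g x) (g y) (g z).
Proof.
move=> [a [b [idx [ua ub sz [hi eu ev ht]]]]] fE gE su.
have si : size idx = k by rewrite -su eu size_map.
have inI (i : 'I_k) : nth 0 idx i < size a by apply/hi/mem_nth; rewrite si.
have fa i : f i = nth 0 a (nth 0 idx i) by rewrite fE eu (nth_map 0) // si.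
have ga i : g i = nth 0 b (index (f i) a).
  by rewrite gE ev (nth_map 0) ?si // fa index_uniq.
rewrite !ga; apply: (types_fact ua ub erefl (esym sz)) => [t /ht //|||];
  by rewrite fa mem_nth.
Qed.

Lemma sat_same_type k (phi : formula (ternary s0) k) (u v : k.-tuple template) :
  same_type u v -> sat phi u -> sat phi v.
Proof.
suff: same_type u v -> (sat phi u <-> sat phi v) by move=> h /h [].
elim: k / phi u v => [k|k i j|k R args|k phi IH|k phi IHphi psi IHpsi|k phi IH] u v h //=.
- have eqE (w : k.-tuple nat) a idx (x y : 'I_k) : uniq a ->
      (forall i, i \in idx -> i < size a) -> w = map (nth 0 a) idx :> seq nat ->
      (tnth w x = tnth w y <-> nth 0 idx x = nth 0 idx y).
    move=> ua hi e; have si : size idx = k by rewrite -(size_tuple w) e size_map.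
    rewrite !(tnth_nth 0) e !(nth_map 0) ?si //; split=> [/eqP|->] //.
    by rewrite nth_uniq ?hi ?mem_nth ?si // => /eqP.
  move: h => [a [b [idx [ua ub sz [hi eu ev _]]]]].
  rewrite (eqE u a idx) // (eqE v b idx) //.
  by rewrite -sz.
- have nthE (w : k.-tuple nat) m : m < 3 ->
      nth 0 (map (tnth w) args) m = tnth w (nth (tnth args ord0) args m).
    by move=> hm; rewrite (nth_map (tnth args ord0)) ?size_tuple.
  rewrite !nthE //.
  have tnthE (w : k.-tuple nat) i : tnth w i = nth 0 w i by apply: tnth_nth.
  split.
    exact: (same_type_rel h (tnthE u) (tnthE v) (size_tuple u)).
  exact: (same_type_rel (same_type_sym h) (tnthE v) (tnthE u) (size_tuple v)).
- by rewrite (IH u v h).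
- by rewrite (IHphi u v h) (IHpsi u v h).
- split=> -[d hd].
    by have [e he] := same_type_extend d h; exists e; apply/(IH (cons_tuple d u)).
  have [e he] := same_type_extend d (same_type_sym h); exists e.
  by apply/(IH (cons_tuple d v)).
Qed.

Definition pattern k (v : k.-tuple nat) : {ffun 'I_k -> 'I_k.+1} :=
  [ffun i => inord (index (tnth v i) v)].

Definition representatives (v : seq nat) : seq nat :=
  [seq nth 0 v j | j <- undup [seq index x v | x <- v]].

(** A finite invariant: the pattern of equal entries, and the types realized over the distinct ones.
    The dependent pair accommodates every possible number of distinct entries. *)
Definition code k (v : k.-tuple nat) :
    {ffun 'I_k -> 'I_k.+1} * {set {m : 'I_k.+1 & T m}} :=
  (pattern v,
   [set t | (val (tag t) == size (representatives v)) &&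
            `[< types (representatives v) (tagged t) >]]%SET).

Lemma representatives_uniq v : uniq (representatives v).
Proof.
rewrite map_inj_in_uniq ?undup_uniq // => i j.
rewrite !mem_undup => /mapP [x xv ->] /mapP [y yv ->].
by rewrite !nth_index // => ->.
Qed.

Lemma code_same_type k (u v : k.-tuple nat) : code u = code v -> same_type u v.
Proof.
case=> /ffunP ep /setP et.
have eidx : [seq index x u | x <- u] = [seq index x v | x <- v].
  apply: (@eq_from_nth _ 0) => [|i]; rewrite !size_map !size_tuple // => hi.
  rewrite !(nth_map 0) ?size_tuple //; have := ep (Ordinal hi).
  rewrite !ffunE !(tnth_nth 0) => /(congr1 val) /=.
  by rewrite !inordK // ltnS -[leqRHS](size_tuple u) // ?index_size //
     (size_tuple u) -[leqRHS](size_tuple v) index_size.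
set J := undup [seq index x u | x <- u].
have sJ : size J <= k.
  by apply: leq_trans (size_undup _) _; rewrite size_map size_tuple.
have repE (w : k.-tuple nat) : [seq index x w | x <- w] = [seq index x u | x <- u] ->
    w = map (nth 0 (representatives w)) [seq index i J | i <- [seq index x u | x <- u]] :> seq nat.
  move=> e; rewrite /representatives e -/J -e -!map_comp -[LHS]map_id.
  apply/eq_in_map => x xw /=.
  have xJ : index x w \in J by rewrite mem_undup -e; apply/mapP; exists x.
  by rewrite (nth_map 0) ?index_mem // nth_index // nth_index.
have su : size (representatives u) = size J by rewrite size_map.
have sv : size (representatives v) = size J by rewrite size_map -eidx.
exists (representatives u), (representatives v), [seq index i J | i <- [seq index x u | x <- u]].
split; rewrite ?representatives_uniq // su ?sv //.
split=> [i|||t].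
- by move=> /mapP [j hj ->]; rewrite index_mem mem_undup.
- exact: repE.
- exact: repE.
have hm : size J < k.+1 by [].
have := et (Tagged (fun m : 'I_k.+1 => T m) (i := Ordinal hm) t).
by rewrite !inE /= su sv eqxx /=; apply: asbool_eq_equiv.
Qed.

Lemma template_categorical : omega_categorical template.
Proof.
split; first by rewrite /template /=; apply: countableP.
move=> k _.
pose pull (X : {set {ffun 'I_k -> 'I_k.+1} * {set {m : 'I_k.+1 & T m}}}) :
  set (k.-tuple template) := [set v | code v \in X]%classic.
apply: (@sub_finite_set _ _ (pull @` [set: _])%classic); last first.
  exact/finite_image/finite_finset.
(* Formulas do not separate tuples with the same code, so a definable set is the preimage of a set
   of codes, of which there are finitely many. *)
move=> S [phi ->].
exists [set c | `[< exists2 v : k.-tuple template, code (v :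
  k.-tuple nat) = c & sat phi v >]]%SET => //.
apply/seteqP; split=> v; rewrite /pull /= inE.
  by move=> /asboolP [u /code_same_type]; apply: sat_same_type.
by move=> h; apply/asboolP; exists v.
Qed.

(** * The CSP of the template *)

Definition facts_of (A : fin_structure (ternary s0)) : seq fact :=
  [seq (nat_of_ord R, (nat_of_ord (tnth t ord0), nat_of_ord (tnth t (inord 1)),
                       nat_of_ord (tnth t (inord 2))))
  | R <- enum 'I_s0, t <- enum (fin_rel A R)].

Lemma facts_ofP A s x y z : rel_of (facts_of A) s x y z <->
  exists (R : 'I_s0) (t : 3.-tuple 'I_(fin_card A)),
    [/\ t \in fin_rel A R, s = R & [:: x; y; z] = map val t].
Proof.
have tE (R : 'I_s0) (t : 3.-tuple 'I_(fin_card A)) :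
    [:: val (tnth t ord0); val (tnth t (inord 1)); val (tnth t (inord 2))] = map val t.
  have nE (i : 'I_3) : tnth t i = nth (tnth t ord0) t i by apply: tnth_nth.
  apply: (@eq_from_nth _ 0); rewrite /= ?size_map ?size_tuple // => -[|[|[|j]]] // _;
    rewrite (nth_map (tnth t ord0)) ?size_tuple //=.
  - by rewrite -(nE ord0).
  - by rewrite (nE (inord 1)) inordK.
  - by rewrite (nE (inord 2)) inordK.
split=> [/allpairsPdep [R [t [_ ht [-> -> -> ->]]]]|[R [t [ht -> e]]]].
  by exists R, t; rewrite mem_enum in ht; split=> //; apply: tE.
apply/allpairsPdep; exists R, t; rewrite !mem_enum; split=> //.
by move: e; rewrite -(tE R t) => -[-> -> ->].
Qed.

Lemma template_CSP w :
  CSP template w <-> exists A, w = encode A /\ C (rel_of (facts_of A)).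
Proof.
split=> -[A [-> hA]]; exists A; split=> //.
  move: hA => [h hh]; pose m := fin_card A.
  pose f x := if insub x : option 'I_m is Some i then h i else 0.
  apply: (@limit_C _ f) => s x y z /facts_ofP [R [t [ht -> e]]].
  have := hh R t ht.
  rewrite /= !(nth_map (tnth t ord0)) ?size_tuple //.
  have fE i : i < 3 -> h (nth (tnth t ord0) t i) = f (nth 0 [:: x; y; z] i).
    by move=> hi; rewrite e (nth_map (tnth t ord0)) ?size_tuple // /f valK.
  by rewrite !fE.
pose i := pickle ([::] : seq nat, [::] : seq nat, facts_of A).
(* The task without parameters asks for a disjoint copy of [A]. Closure under disjoint unions makes
   it compatible with every stage. *)
have hM : exists M, relhom (rel_of (facts_of A)) limit (plug M [::] [::]).
  have [//|[M _ hM]|[j []]] := @stage_task [::] [::] (facts_of A); first by exists M.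
  apply/(@compatible_glue _ _ [::] [::] _ (@stage_bounded _ [::])) => //.
  by apply: C_disjoint hA; [apply: stage_bounded | apply: stage_C].
have [M {}hM] := hM; exists (fun x : 'I_(fin_card A) => M + x) => R t ht.
rewrite /= !(nth_map (tnth t ord0)) ?size_tuple //.
apply: hM; apply/facts_ofP; exists R, t; split=> //.
by apply: (@eq_from_nth _ 0) => [|[|[|[|j]]]]; rewrite ?size_map ?size_tuple //=
  (nth_map (tnth t ord0)) ?size_tuple.
Qed.

End Generic.

(** * The game *)

(** The commitments made so far. They form a relation, not a partial function: an element may
    receive both values, and then no assignment extends them. *)
Definition literals (T : Type) := T -> bool -> Prop.

(* Symbol 0 is the clause [x /\ y -> z], symbol 1 is [x \/ y \/ z] and symbol 2
   is [~ x]. *)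
Definition satisfies (T : Type) (R : relations T) (c : T -> bool) : Prop :=
  forall x y z, [/\ (R 0 x y z -> c x -> c y -> c z),
                    (R 1 x y z -> [|| c x, c y | c z]) &
                    (R 2 x x x -> ~~ c x)].

(* A game on [R]: [true] in [qs] lets the existential player colour the elements
   of the unary relation of this level, and [false] lets the universal player pick
   a clique of the binary relation of this level, whose elements become true. *)
Fixpoint good (T : Type) (R : relations T) (qs : seq bool) (S : literals T) : Prop :=
  match qs with
  | [::] => exists2 c, (forall e b, S e b -> c e = b) & satisfies R c
  | true :: qs' => exists c : T -> bool,
      good R qs' (fun e b => S e b \/ b = c e /\ R (3 + size qs') e e e)
  | false :: qs' => forall X : T -> Prop,
      (forall x y, X x -> X y -> R (3 + size qs') x y y) ->
      good R qs' (fun e b => S e b \/ b = true /\ X e)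
  end.

(** With [f := id] this is antitonicity in the relations and in the literals, the form in which most
    later steps use it. *)
Lemma good_hom (T U : Type) (R : relations T) (R' : relations U) f qs S S' :
  relhom R R' f -> (forall e b, S e b -> S' (f e) b) ->
  good R' qs S' -> good R qs S.
Proof.
move=> hf; elim: qs S S' => [|[] qs IH] S S' hS /=.
- move=> [c hc sat]; exists (c \o f) => [e b /hS /hc //|x y z].
  have [h0 h1 h2] := sat (f x) (f y) (f z).
  by split=> [/hf/h0|/hf/h1|/hf/h2].
- move=> [c hc]; exists (c \o f); apply: IH hc => e b [/hS|[-> /hf]]; by [left|right].
move=> hX X cX; apply: IH (hX (fun u => exists2 x, X x & u = f x) _) => [e b [/hS|[-> Xe]]|].
- by left.
- by right; split=> //; exists e.
by move=> _ _ [x Xx ->] [y Xy ->]; apply/hf/cX.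
Qed.

(** * Game types of structures with parameters, and gluing *)

Fixpoint gtype (k : nat) (qs : seq bool) : finType :=
  match qs with
  | [::] => {set {ffun 'I_k -> bool}}
  | true :: qs' => {set {ffun 'I_k -> bool} * gtype k qs'}
  | false :: qs' => ({set 'I_k * 'I_k} * {ffun {set 'I_k} -> gtype k qs'} *
                     {set {set 'I_k} * gtype k qs'})%type
  end.

(** At a universal level three data matter: the edges among the parameters, the result of a clique
    that stays in the other part and meets this one in the parameters [J], and the results of the
    cliques of this part. In the last case two parameters may be joined by an edge of the other
    part, whence the alternative [x \in P /\ y \in P]. *)
Fixpoint type_of k (R : relations nat) (P : seq nat) qs (S : literals nat) : gtype k qs :=
  match qs return gtype k qs with
  | [::] => [set g : {ffun 'I_k -> bool} | `[< exists c,
      [/\ forall e b, S e b -> c e = b, satisfies R c & forall i : 'I_k,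
        c (nth 0 P i) = g i] >]]%SET
  | true :: qs' => [set gt : {ffun 'I_k -> bool} * gtype k qs' | `[< exists2 c,
      forall i : 'I_k, c (nth 0 P i) = gt.1 i &
      type_of k R P qs' (fun e b => S e b \/ b = c e /\ R (3 + size qs') e e e) = gt.2 >]]%SET
  | false :: qs' =>
     ([set ij : 'I_k * 'I_k |
        `[< R (3 + size qs') (nth 0 P ij.1) (nth 0 P ij.2) (nth 0 P ij.2) >]]%SET,
      [ffun J : {set 'I_k} => type_of k R P qs'
        (fun e b => S e b \/ b = true /\ exists2 i : 'I_k, i \in J & e = nth 0 P i)],
      [set Jt : {set 'I_k} * gtype k qs' | `[< exists X : nat -> Prop,
        [/\ forall x y, X x -> X y -> R (3 + size qs') x y y \/ x \in P /\ y \in P,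
            forall i : 'I_k, X (nth 0 P i) <-> i \in Jt.1 &
            type_of k R P qs' (fun e b => S e b \/ b = true /\ X e) = Jt.2] >]]%SET)
  end.

Definition lift_literals M a P (S0 S : literals nat) : literals nat :=
  fun u b => S0 u b \/ exists2 x, u = plug M a P x & S x b.

Lemma rel_of_glue (F0 : seq fact) M (a P : seq nat) F s u v w : rel_of (glue F0 M a P F) s u v w <->
  rel_of F0 s u v w \/ exists x y z,
    [/\ rel_of F s x y z, u = plug M a P x, v = plug M a P y & w = plug M a P z].
Proof.
rewrite /rel_of mem_cat; split=> [/orP [|/rel_of_map]|[->//|]]; [by left | by right |].
by move=> [x [y [z [h -> -> ->]]]]; rewrite (map_rel_of (F := F)) ?orbT.
Qed.

Section Glue.
Variables (k M : nat) (F0 : seq fact) (a : seq nat).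
Hypothesis F0_bounded : bounded_by M F0.
Hypothesis a_bounded : forall x, x \in a -> x < M.
Hypothesis a_uniq : uniq a.
Hypothesis a_size : size a = k.

Section Params.
Variable P : seq nat.
Hypothesis P_size : size P = k.

Lemma plug_param (i : 'I_k) : uniq P -> plug M a P (nth 0 P i) = nth 0 a i.
Proof. by move=> uP; rewrite /plug mem_nth ?P_size // index_uniq ?P_size. Qed.

Lemma plug_lt x : (plug M a P x < M) = (x \in P).
Proof.
rewrite /plug; case: ifP => xP; last by lia.
by rewrite a_bounded ?mem_nth // a_size -P_size index_mem.
Qed.

Lemma plug_inj : injective (plug M a P).
Proof.
move=> x y; have := plug_lt x; have := plug_lt y; rewrite /plug.
case: ifP => yP; case: ifP => xP; try lia.
move=> _ _ /eqP; rewrite nth_uniq ?a_size -?P_size ?index_mem // => /eqP.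
exact: index_inj.
Qed.

Lemma memP x : x \in P -> exists i : 'I_k, x = nth 0 P i.
Proof.
move=> xP; have h : index x P < k by rewrite -P_size index_mem.
by exists (Ordinal h); rewrite /= nth_index.
Qed.

Definition extend (A : Type) (c c' : nat -> A) u := if u < M then c u else c' (u - M).

Lemma extend_plug A (c c' : nat -> A) x :
  (forall i : 'I_k, c (nth 0 a i) = c' (nth 0 P i)) -> extend c c' (plug M a P x) = c' x.
Proof.
move=> h; rewrite /extend plug_lt; case: ifP => xP; last by rewrite /plug xP addKn.
have ix : index x P < k by rewrite -P_size index_mem.
by rewrite /plug xP (h (Ordinal ix)) /= nth_index.
Qed.

End Params.

(** Transfer of a strategy: existential moves are kept on [F0] and replaced on [F'] by moves of
    equal type that agree on the parameters. Universal moves travel the other way, from the new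
    glued structure to the old one. *)
Lemma good_glue qs P P' F F' S0 S S' :
  uniq P -> uniq P' -> size P = k -> size P' = k ->
  (forall u b, S0 u b -> u < M) ->
  type_of k (rel_of F) P qs S = type_of k (rel_of F') P' qs S' ->
  good (rel_of (glue F0 M a P F)) qs (lift_literals M a P S0 S) ->
  good (rel_of (glue F0 M a P' F')) qs (lift_literals M a P' S0 S').
Proof.
move=> uP uP' sP sP'.
have satisfies_extend c c' : satisfies (rel_of (glue F0 M a P F)) c ->
    satisfies (rel_of F') c' -> (forall i : 'I_k, c (nth 0 a i) = c' (nth 0 P' i)) ->
    satisfies (rel_of (glue F0 M a P' F')) (extend c c').
  move=> hc hc' e u v w.
  have G0 s x y z : rel_of F0 s x y z -> rel_of (glue F0 M a P F) s x y z.
    by move=> h; apply/rel_of_glue; left.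
  split=> /rel_of_glue [h|].
  - have [lu lv lw] := F0_bounded h; rewrite /extend lu lv lw.
    by have [h0 _ _] := hc u v w; apply/h0/G0.
  - move=> [x [y [z [h -> -> ->]]]]; rewrite !extend_plug //.
    by have [h0 _ _] := hc' x y z; apply: h0.
  - have [lu lv lw] := F0_bounded h; rewrite /extend lu lv lw.
    by have [_ h1 _] := hc u v w; apply/h1/G0.
  - move=> [x [y [z [h -> -> ->]]]]; rewrite !extend_plug //.
    by have [_ h1 _] := hc' x y z; apply: h1.
  - have [lu _ _] := F0_bounded h; rewrite /extend lu.
    by have [_ _ h2] := hc u u u; apply/h2/G0.
  - move=> [x [y [z [h -> /(plug_inj sP') ey /(plug_inj sP') ez]]]]; subst y z.
    by rewrite extend_plug //; have [_ _ h2] := hc' x x x; apply: h2.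
elim: qs S0 S S' => [|[] qs IH] S0 S S' bS0 /=.
- move=> /setP et [c hc sat].
  have: [ffun i : 'I_k => c (nth 0 a i)] \in
      [set g : {ffun 'I_k -> bool} | `[< exists c, [/\ forall e b, S e b -> c e = b,
        satisfies (rel_of F) c & forall i : 'I_k, c (nth 0 P i) = g i] >]]%SET.
    rewrite inE; apply/asboolP; exists (c \o plug M a P); split=> [e b h|x y z|i] /=.
    + by apply: hc; right; exists e.
    + have G x' y' z' s : rel_of F s x' y' z' -> rel_of (glue F0 M a P F) s
        (plug M a P x') (plug M a P y') (plug M a P z').
        by move=> h; apply/rel_of_glue; right; exists x', y', z'.
      have [h0 h1 h2] := sat (plug M a P x) (plug M a P y) (plug M a P z).
      by split=> [/G/h0|/G/h1|/G/h2].
    + by rewrite ffunE plug_param.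
  rewrite et inE => /asboolP [c' [hc' sat' ec]].
  have e (i : 'I_k) : c (nth 0 a i) = c' (nth 0 P' i) by rewrite ec ffunE.
  exists (extend c c'); last exact: satisfies_extend.
  move=> u b [h|[x -> h]]; last by rewrite extend_plug //; apply: hc'.
  by rewrite /extend (bS0 _ _ h); apply: hc; left.
- move=> /setP et [c hc].
  set S1 := fun e b => S e b \/ b = c (plug M a P e) /\ rel_of F (3 + size qs) e e e.
  have: ([ffun i : 'I_k => c (nth 0 a i)], type_of k (rel_of F) P qs S1) \in
     [set gt : {ffun 'I_k -> bool} * gtype k qs | `[< exists2 c,
      forall i : 'I_k, c (nth 0 P i) = gt.1 i &
      type_of k (rel_of F) P qs
        (fun e b => S e b \/ b = c e /\ rel_of F (3 + size qs) e e e) = gt.2 >]]%SET.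
    rewrite inE; apply/asboolP; exists (c \o plug M a P) => // i /=.
    by rewrite ffunE plug_param.
  rewrite et inE => /asboolP [c' /= ec et'].
  have e (i : 'I_k) : c (nth 0 a i) = c' (nth 0 P' i) by rewrite ec ffunE.
  exists (extend c c').
  set S1' := fun e b => _ in et'.
  pose S2 : literals nat := fun u b => S0 u b \/ b = c u /\ rel_of F0 (3 + size qs) u u u.
  have bS2 u b : S2 u b -> u < M by move=> [/bS0//|[_ /F0_bounded []]].
  apply: (good_hom (f := id) _ _ (IH S2 S1 S1' bS2 (esym et') _)) =>
    // [u b [[h|[x -> h]]|[-> /rel_of_glue [h|]]]|].
  + by left; left.
  + by right; exists x => //; left.
  + by left; right; split=> //; rewrite /extend; have [-> _ _] := F0_bounded h.
  + move=> [x [y [z [h -> /(plug_inj sP') ey /(plug_inj sP') ez]]]]; subst y z.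
    by right; exists x => //; right; rewrite extend_plug.
  apply: (good_hom (f := id) _ _ hc) => // u b [[h|[-> h]]|[x -> [h|[-> h]]]].
  + by left; left.
  + by right; split=> //; apply/rel_of_glue; left.
  + by left; right; exists x.
  + by right; split=> //; apply/rel_of_glue; right; exists x, x, x.
set n := 3 + size qs; case=> /setP eN /ffunP eJ /setP eX hX X cX.
have eN' (i j : 'I_k) : rel_of F n (nth 0 P i) (nth 0 P j) (nth 0 P j) <->
                        rel_of F' n (nth 0 P' i) (nth 0 P' j) (nth 0 P' j).
  by have := eN (i, j); rewrite !inE /=; apply: asbool_eq_equiv.
(* Edges at a fresh element come from [F'] only, and such an element of [X] is adjacent to all of
   [X]. So [X] stays below [M] or lies in the image of [F']. *)
have [lowX|[x0 Xx0 gex0]] : (forall x, X x -> x < M) \/ exists2 x, X x & M <= x.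
  have [h|h] := EM (exists2 x, X x & M <= x); [by right | left=> x Xx].
  by rewrite ltnNge; apply/negP => ge; apply: h; exists x.
  pose J := [set i : 'I_k | `[< X (nth 0 a i) >]]%SET.
  have cG x y : X x -> X y -> rel_of (glue F0 M a P F) n x y y.
    move=> Xx Xy; apply/rel_of_glue.
    have /rel_of_glue [|[x' [y' [z' [h ex ey ez]]]]] := cX x y Xx Xy; [by left | right].
    have x'P : x' \in P' by rewrite -(plug_lt sP') -ex; apply: lowX.
    have y'P : y' \in P' by rewrite -(plug_lt sP') -ey; apply: lowX.
    have ? : z' = y' by apply: (plug_inj sP'); rewrite -ez. subst z'.
    have [i ei] := memP sP' x'P; have [j ej] := memP sP' y'P; subst x' y'.
    exists (nth 0 P i), (nth 0 P j), (nth 0 P j).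
    by rewrite !plug_param // -(plug_param sP' i uP') -(plug_param sP' j uP'); split=> //;
      apply/eN'.
  have := hX X cG; pose S2 : literals nat := fun u b => S0 u b \/ b = true /\ X u.
  have bS2 u b : S2 u b -> u < M by move=> [/bS0//|[_ /lowX]].
  have := eJ J; rewrite !ffunE => etJ h.
  apply: (good_hom (f := id) _ _ (IH S2 _ _ bS2 etJ _)) => // [u b [[hu|[x -> hx]]|hu]|].
  + by left; left.
  + by right; exists x => //; left.
  + by left; right.
  apply: (good_hom (f := id) _ _ h) => // u b [[hu|hu]|[x -> [hx|[-> [i iJ ->]]]]].
  + by left; left.
  + by right.
  + by left; right; exists x.
  + by right; rewrite plug_param //; split=> //; move: iJ; rewrite inE => /asboolP.
pose X' x := X (plug M a P' x).
have XE u : X u -> exists2 x, u = plug M a P' x & X' x.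
  move=> Xu; have /rel_of_glue [/F0_bounded [lt _ _]|[x [y [z [_ ex ey _]]]]] := cX x0 u Xx0 Xu.
    by lia.
  by exists y => //; rewrite /X' -ey.
pose J := [set i : 'I_k | `[< X (nth 0 a i) >]]%SET.
have JE (i : 'I_k) : X (nth 0 a i) <-> i \in J by rewrite inE; split=> [h|/asboolP //];
  apply/asboolP.
set S1' := fun e b => S' e b \/ b = true /\ X' e.
have: (J, type_of k (rel_of F') P' qs S1') \in
   [set Jt : {set 'I_k} * gtype k qs | `[< exists X : nat -> Prop,
        [/\ forall x y, X x -> X y -> rel_of F' n x y y \/ x \in P' /\ y \in P',
            forall i : 'I_k, X (nth 0 P' i) <-> i \in Jt.1 &
            type_of k (rel_of F') P' qs (fun e b => S' e b \/ b = true /\ X e) = Jt.2] >]]%SET.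
  rewrite inE; apply/asboolP; exists X'; split=> // [x y Xx Xy|i].
    have /rel_of_glue [/F0_bounded [lx ly _]|[x1 [y1 [z1 [h ex ey ez]]]]] := cX _ _ Xx Xy.
      by right; rewrite -!(plug_lt sP').
    by left; rewrite (plug_inj sP' ex) {1}(plug_inj sP' ey) (plug_inj sP' ez).
  by rewrite /X' plug_param // JE.
rewrite -eX inE => /asboolP [Y /= [cY YJ etY]].
pose Z u := exists2 y, Y y & u = plug M a P y.
have cZ u v : Z u -> Z v -> rel_of (glue F0 M a P F) n u v v.
  move=> [x Yx ->] [y Yy ->]; apply/rel_of_glue; have [h|[xP yP]] := cY x y Yx Yy.
    by right; exists x, y, y.
  have [i ei] := memP sP xP; have [j ej] := memP sP yP; subst x y.
  rewrite !plug_param //; move/YJ/JE: Yx => Xi; move/YJ/JE: Yy => Xj.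
  have /rel_of_glue [|[x1 [y1 [z1 [h ex ey ez]]]]] := cX _ _ Xi Xj; [by left | right].
  exists (nth 0 P i), (nth 0 P j), (nth 0 P j); rewrite !plug_param //; split=> //; apply/eN'.
  move: ex ey ez; rewrite -(plug_param sP' i uP') -(plug_param sP' j uP').
  by move=> /(plug_inj sP') -> /(plug_inj sP') ey1 /(plug_inj sP') ez1; rewrite {1}ey1 ez1.
have h := hX Z cZ.
pose S2 : literals nat := fun u b => S0 u b \/ b = true /\ exists2 i : 'I_k,
  i \in J & u = nth 0 a i.
have bS2 u b : S2 u b -> u < M.
  by move=> [/bS0//|[_ [i _ ->]]]; apply/a_bounded/mem_nth; rewrite a_size.
apply: (good_hom (f := id) _ _ (IH S2 _ _ bS2 etY _)) =>
  // [u b [[hu|[x -> hx]]|[-> /XE [x -> Xx]]]|].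
+ by left; left.
+ by right; exists x => //; left.
+ by right; exists x => //; right.
apply: (good_hom (f := id) _ _ h) => // u b [[hu|[-> [i iJ ->]]]|[x -> [hx|[-> hx]]]].
+ by left; left.
+ right; split=> //; exists (nth 0 P i); [exact/YJ | by rewrite plug_param].
+ by left; right; exists x.
+ by right; split=> //; exists x.
Qed.

End Glue.

(** The two strategies are played side by side. A clique lies in one part, and in the other part the
    universal move counts as the empty clique. *)
Lemma good_disjoint qs (F0 : seq fact) M (F : seq fact) S0 S : bounded_by M F0 ->
  (forall u b, S0 u b -> u < M) -> good (rel_of F0) qs S0 -> good (rel_of F) qs S ->
  good (rel_of (glue F0 M [::] [::] F)) qs (lift_literals M [::] [::] S0 S).
Proof.
move=> bF; have plugE x : plug M [::] [::] x = M + x by [].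
have G s u v w : rel_of (glue F0 M [::] [::] F) s u v w -> rel_of F0 s u v w \/
    [/\ rel_of F s (u - M) (v - M) (w - M), M <= u, M <= v & M <= w].
  move=> /rel_of_glue [|[x [y [z [h -> -> ->]]]]]; [by left | right].
  by rewrite !plugE !addKn !leq_addr.
elim: qs S0 S => [|[] qs IH] S0 S bS0 /=.
- move=> [c hc sat] [c' hc' sat']; exists (extend M c c').
    move=> u b [h|[x -> h]]; rewrite /extend; first by rewrite (bS0 _ _ h); apply: hc.
    by rewrite plugE ltnNge leq_addr /= addKn; apply: hc'.
  move=> u v w; have [h0 h1 h2] := sat u v w.
  have [g0 g1 g2] := sat' (u - M) (v - M) (w - M).
  rewrite /extend; split=> /G [h|[h]].
  + by have [-> -> ->] := bF _ _ _ _ h; apply: h0.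
  + by move=> lu lv lw; rewrite !ltnNge lu lv lw; apply: g0.
  + by have [-> -> ->] := bF _ _ _ _ h; apply: h1.
  + by move=> lu lv lw; rewrite !ltnNge lu lv lw; apply: g1.
  + by have [-> _ _] := bF _ _ _ _ h; apply: h2.
  + by move=> lu _ _; rewrite !ltnNge lu; apply: g2.
- move=> [c hc] [c' hc']; exists (extend M c c').
  set S2 := fun e b => _ in hc; set S2' := fun e b => _ in hc'.
  have bS2 u b : S2 u b -> u < M by move=> [/bS0//|[_ /bF []]].
  apply: (good_hom (f := id) _ _ (IH S2 S2' bS2 hc hc')) =>
    // u b [[h|[x -> h]]|[-> /G [h|[h le _ _]]]].
  + by left; left.
  + by right; exists x => //; left.
  + by left; right; rewrite /extend; have [-> _ _] := bF _ _ _ _ h.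
  + right; exists (u - M); first by rewrite plugE subnKC.
    by right; rewrite /extend ltnNge le.
move=> h h' X cX.
have [lowX|[x0 Xx0 gex0]] : (forall x, X x -> x < M) \/ exists2 x, X x & M <= x.
  have [hx|hx] := EM (exists2 x, X x & M <= x); [by right | left=> x Xx].
  by rewrite ltnNge; apply/negP => ge; apply: hx; exists x.
  have hX : good (rel_of F0) qs (fun u b => S0 u b \/ b = true /\ X u).
    by apply: h => x y Xx Xy; have [//|[_ le _ _]] := G _ _ _ _ (cX x y Xx Xy);
      have := lowX _ Xx; lia.
  have hX' : good (rel_of F) qs S.
    by apply: (good_hom (f := id) _ _ (h' (fun _ => False) _)) => // e b; left.
  have bS2 u b : S0 u b \/ b = true /\ X u -> u < M by move=> [/bS0//|[_ /lowX]].
  apply: (good_hom (f := id) _ _ (IH _ _ bS2 hX hX')) => // u b [[hu|hu]|hu].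
  + by left; left.
  + by right.
  + by left; right.
have leX u : X u -> M <= u.
  by move=> Xu; have [/bF [lt _ _]|[_ _ -> _]] := G _ _ _ _ (cX x0 u Xx0 Xu) => //; lia.
have hX' : good (rel_of F) qs (fun u b => S u b \/ b = true /\ X (M + u)).
  apply: h' => x y Xx Xy; have [/bF [lt _ _]|[]] := G _ _ _ _ (cX _ _ Xx Xy); first by lia.
  by rewrite !addKn.
have hX : good (rel_of F0) qs S0.
  by apply: (good_hom (f := id) _ _ (h (fun _ => False) _)) => // e b; left.
apply: (good_hom (f := id) _ _ (IH _ _ bS0 hX hX')) => // u b [[hu|[x -> hx]]|[-> hu]].
+ by left.
+ by right; exists x => //; left.
+ right; exists (u - M); first by rewrite plugE subnKC ?leX.
  by right; rewrite subnKC ?leX.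
Qed.

Definition good_class qs (R : relations nat) : Prop := good R qs (fun _ _ => False).

Section Template.
Variables (s0 : nat) (qs : seq bool).

Let T k : finType := gtype k qs.
Let type k F P : T k := type_of k (rel_of F) P qs (fun _ _ => False).

Definition good_template := template s0 (good_class qs).

Lemma good_class_hom R R' f : relhom R R' f -> good_class qs R' -> good_class qs R.
Proof. by move=> h; apply: (good_hom h). Qed.

Lemma good_class_empty : good_class qs (rel_of [::]).
Proof.
(* Without facts only contradictory literals could do harm; the constant colouring [true] keeps all
   of them positive. *)
suff h S : (forall e b, S e b -> b = true) -> good (rel_of [::]) qs S by apply: h.
elim: qs S => [|[] qs' IH] S hS /=.
- by exists (fun => true) => [e b /hS|x y z].
- by exists (fun => true); apply: IH => e b [/hS|[->]].
by move=> X _; apply: IH => e b [/hS|[->]].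
Qed.

Lemma good_class_disjoint F0 M F : bounded_by M F0 ->
  good_class qs (rel_of F0) -> good_class qs (rel_of F) ->
  good_class qs (rel_of (glue F0 M [::] [::] F)).
Proof.
move=> bF h h'; apply: (good_hom (f := id) _ _ (good_disjoint bF _ h h')) => //.
Qed.

Lemma good_class_glue k F0 M a P P' F F' :
  bounded_by M F0 -> (forall x, x \in a -> x < M) -> uniq a -> uniq P -> uniq P' ->
  size a = k -> size P = k -> size P' = k -> type k F P = type k F' P' ->
  good_class qs (rel_of (glue F0 M a P F)) -> good_class qs (rel_of (glue F0 M a P' F')).
Proof.
move=> bF ba ua uP uP' sa sP sP' et h.
pose N : literals nat := fun _ _ => False.
have := @good_glue k M F0 a bF ba ua sa qs P P' F F' N N N uP uP' sP sP' _ et.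
move=> g; apply: (good_hom (f := id) _ _ (g _ _)) => //.
by apply: (good_hom (f := id) _ _ h) => // u b [//|[x _ []]].
Qed.

Lemma good_template_categorical : omega_categorical good_template.
Proof.
exact: (@template_categorical s0 _ good_class_hom good_class_empty T type good_class_glue).
Qed.

Lemma good_template_CSP w : CSP good_template w <->
  exists A : fin_structure (ternary s0), w = encode A /\ good_class qs (rel_of (facts_of A)).
Proof.
exact: (@template_CSP s0 _ good_class_hom good_class_empty good_class_disjoint w).
Qed.

End Template.

(** * The polynomial hierarchy with prefixed quantifiers *)

Fixpoint alternation (b : bool) (k : nat) : seq bool :=
  if k is k'.+1 then b :: alternation (~~ b) k' else [::].

Fixpoint nest (Q : seq (bool * {poly nat})) (V : language) (x : seq bool) : Prop :=
  match Q with
  | [::] => V x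
  | (true, p) :: Q' =>
      exists2 y, size y <= (p.[size x])%R & nest Q' V (pair_word x y)
  | (false, p) :: Q' =>
      forall y, size y <= (p.[size x])%R -> nest Q' V (pair_word x y)
  end.

Definition complement_if (b : bool) (L : language) : language :=
  if b then (~` L)%classic else L.

(** For [b = true] this is Sigma and for [b = false] it is Pi, so that one argument treats both
    families. *)
Definition level (b : bool) (k : nat) (L : language) := Sigma_P k (complement_if (~~ b) L).

Lemma complement_ifK b L : complement_if b (complement_if b L) = L.
Proof. by case: b; rewrite //= setCK. Qed.

Lemma complement_if_neg b L : complement_if b L = (~` complement_if (~~ b) L)%classic.
Proof. by case: b; rewrite //= setCK. Qed.

Lemma nest_cons b p Q V x : nest ((b, p) :: Q) V x <->
  complement_if (~~ b) (fun x : seq bool => exists2 y, size y <= (p.[size x])%R &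
    complement_if (~~ b) (nest Q V) (pair_word x y)) x.
Proof.
case: b => //=; split=> [h [y le]|h y le]; first by apply; apply: h.
by apply: contrapT => n; apply: h; exists y.
Qed.

(** Every level of [Sigma_P] complements its verifier; the parity [b (+) odd k] records whether the
    machine at the bottom decides [V] or its complement. *)
Lemma level_nest b k L : level b k L -> exists Q V,
  [/\ unzip1 Q = alternation b k, class_P (complement_if (~~ (b (+) odd k)) V) &
      forall x, L x <-> nest Q V x].
Proof.
elim: k b L => [|k IH] b L; rewrite /level /=.
  by move=> h; exists [::], L; split; rewrite ?addbF.
move=> [V [p [hV hL]]].
have [|Q [W [eQ hW hQ]]] := IH (~~ b) (complement_if (~~ b) V).
  by rewrite /level complement_if_neg negbK complement_ifK.
exists ((b, p) :: Q), W; split=> [/=|/=|x]; rewrite ?eQ //.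
  by move: hW; rewrite addNb addbN.
rewrite nest_cons -(_ : complement_if (~~ b) V = nest Q W); last first.
  by apply/funext => z; apply/propext.
rewrite complement_ifK; have {}hL := hL x; case: b hL {IH eQ hW hQ} => //= hL.
by rewrite -hL /setC /=; split=> [Lx n|/contrapT].
Qed.

Lemma nest_level b k L Q V : unzip1 Q = alternation b k ->
  class_P (complement_if (~~ (b (+) odd k)) V) -> (forall x, L x <-> nest Q V x) ->
  level b k L.
Proof.
elim: k b L Q => [|k IH] b L Q; rewrite /level /=.
  case: Q => // _ hV hL; rewrite addbF in hV.
  by rewrite (_ : L = V) //; apply/funext => z; apply/propext.
case: Q => // -[c p] Q [-> eQ] hV hL.
exists (complement_if (~~ b) (nest Q V)), p; split.
  rewrite -complement_if_neg; have := IH (~~ b) (nest Q V) Q eQ.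
  by rewrite /level negbK; apply=> //; rewrite addNb -addbN.
rewrite (_ : L = nest ((b, p) :: Q) V); last by apply/funext => z; apply/propext.
move=> x; have := nest_cons b p Q V x; case: b {IH eQ hV hL} => //= e.
by rewrite /setC /= e /setC /=; split=> [/contrapT|? []].
Qed.

(** * Formulas *)

Definition truth w v e : bool := 0 < eval w v e.

Definition Not a := Monus One a.
Definition And a b := Not (Plus (Not a) (Not b)).
Definition Or a b := Not (Not (Plus a b)).
Definition Le a b := Not (Monus a b).
Definition Lt a b := Le (Plus a One) b.
Definition Eq a b := And (Le a b) (Le b a).
Definition All n a := Not (Sum n (Not a)).
Definition Ex n a := Not (Not (Sum n a)).
Definition Zero := Monus One One.

Lemma eval_Not w v a : eval w v (Not a) = ~~ truth w v a.
Proof. by rewrite /truth /=; case: (eval w v a). Qed.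

Lemma truth_Not w v a : truth w v (Not a) = ~~ truth w v a.
Proof. by rewrite {1}/truth eval_Not; case: truth. Qed.

Lemma truth_Plus w v a b : truth w v (Plus a b) = truth w v a || truth w v b.
Proof. by rewrite /truth /= addn_gt0. Qed.

Lemma truth_And w v a b : truth w v (And a b) = truth w v a && truth w v b.
Proof. by rewrite truth_Not truth_Plus !truth_Not negb_or !negbK. Qed.

Lemma truth_Or w v a b : truth w v (Or a b) = truth w v a || truth w v b.
Proof. by rewrite !truth_Not truth_Plus negbK. Qed.

Lemma eval_And w v a b : eval w v (And a b) = truth w v a && truth w v b.
Proof. by rewrite -truth_And /And eval_Not truth_Not. Qed.

Lemma truth_Le w v a b : truth w v (Le a b) = (eval w v a <= eval w v b).
Proof. by rewrite truth_Not /truth /= -leqNgt leqn0 subn_eq0. Qed.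

Lemma truth_Lt w v a b : truth w v (Lt a b) = (eval w v a < eval w v b).
Proof. by rewrite truth_Le /= addn1. Qed.

Lemma truth_Eq w v a b : truth w v (Eq a b) = (eval w v a == eval w v b).
Proof. by rewrite truth_And !truth_Le eqn_leq. Qed.

Lemma eval_Eq w v a b : eval w v (Eq a b) = (eval w v a == eval w v b).
Proof. by rewrite -truth_Eq /Eq eval_And truth_And. Qed.

Lemma truth_Bit w v a : truth w v (Bit a) = nth false w (eval w v a).
Proof. by rewrite /truth /=; case: nth. Qed.

Lemma truth_ExP w v n a :
  reflect (exists2 i, i < eval w v n & truth w (i :: v) a) (truth w v (Ex n a)).
Proof.
rewrite !truth_Not negbK /truth /= lt0n sum_nat_seq_neq0.
apply: (iffP hasP) => [[i]|[i lt h]].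
  by rewrite mem_index_iota => /= h; rewrite -lt0n => hi; exists i.
by exists i; rewrite ?mem_index_iota //= -lt0n.
Qed.

Lemma truth_AllP w v n a :
  reflect (forall i, i < eval w v n -> truth w (i :: v) a) (truth w v (All n a)).
Proof.
rewrite (_ : truth w v (All n a) = ~~ truth w v (Ex n (Not a))); last first.
  by rewrite /All /Ex !truth_Not negbK.
apply: (iffP idP) => [h i lt|h].
  by apply: contraNT h => h; apply/truth_ExP; exists i; rewrite ?truth_Not.
by apply/truth_ExP => -[i lt]; rewrite truth_Not h.
Qed.

Lemma eval_All w v n a : eval w v (All n a) = truth w v (All n a).
Proof. by rewrite /All eval_Not truth_Not. Qed.

Fixpoint rename (f : nat -> nat) (e : expr) : expr :=
  match e with
  | Var i => Var (f i)
  | One => One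
  | Len => Len
  | Bit a => Bit (rename f a)
  | Plus a b => Plus (rename f a) (rename f b)
  | Monus a b => Monus (rename f a) (rename f b)
  | Sum a b => Sum (rename f a) (rename (fun i => if i is j.+1 then (f j).+1 else 0) b)
  end.

Lemma eval_rename w v v' f e : (forall i, nth 0 v' (f i) = nth 0 v i) ->
  eval w v' (rename f e) = eval w v e.
Proof.
elim: e v v' f => //= [a IH|a IHa b IHb|a IHa b IHb|a IHa b IHb] v v' f h;
  rewrite ?(IH v) ?(IHa v) ?(IHb v) //.
by apply: eq_bigr => i _; apply: IHb => -[].
Qed.

Definition shift := rename succn.

Lemma eval_shift w i v e : eval w (i :: v) (shift e) = eval w v e.
Proof. by apply: eval_rename => -[]. Qed.

Definition Mul a b := Sum a (shift b).

Lemma eval_Mul w v a b : eval w v (Mul a b) = eval w v a * eval w v b.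
Proof.
rewrite /= (eq_bigr (fun => eval w v b)) => [|i _]; last exact: eval_shift.
by rewrite sum_nat_const_nat subn0.
Qed.

(* [Let a b] evaluates [b] with variable 0 bound to the value of [a]. *)
Definition Let a b := Sum (Plus a One) (Mul (Eq (Var 0) (shift a)) b).

Opaque Not And Or Le Lt Eq All Ex Mul.

Lemma eval_Let w v a b : eval w v (Let a b) = eval w (eval w v a :: v) b.
Proof.
rewrite /Let [LHS]/= addn1 big_nat_recr //= big1_seq ?add0n => [|i].
  by rewrite eval_Mul eval_Eq eval_shift eqxx mul1n.
by rewrite mem_index_iota eval_Mul eval_Eq eval_shift /= => lt; rewrite ltn_eqF.
Qed.

Lemma truth_Let w v a b : truth w v (Let a b) = truth w (eval w v a :: v) b.
Proof. by rewrite /truth eval_Let. Qed.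

Fixpoint Const (c : nat) : expr := if c is c'.+1 then Plus (Const c') One else Zero.

Opaque Let.

Lemma eval_Const w v c : eval w v (Const c) = c.
Proof. by elim: c => //= c ->; rewrite addn1. Qed.

Opaque Const.

Definition Horner (p : {poly nat}) (a : expr) : expr :=
  foldr (fun c e => Plus (Mul e a) (Const c)) Zero p.

Lemma eval_Horner w v p a : eval w v (Horner p a) = (p.[eval w v a])%R.
Proof.
rewrite /Horner /horner; elim: (polyseq p) => [|c s IH] /=; first by rewrite subnn.
by rewrite eval_Mul eval_Const IH.
Qed.

Opaque Horner.

(* The number of the letters before the first 0. *)
Definition Ones (bit : expr -> expr) := Sum Len (All (Plus (Var 0) One) (bit (Var 0))).

Lemma eval_Ones bit w v n :
  (forall v i, i <= n -> truth w (i :: v) (bit (Var 0)) = (i < n)) -> n <= size w ->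
  eval w v (Ones bit) = n.
Proof.
move=> h le; rewrite /Ones /=.
rewrite (eq_big_seq (fun i => nat_of_bool (i < n))) => [|i _].
  have sumE N : \sum_(0 <= i < N) (i < n) = minn n N.
    elim: N => [|N IH]; first by rewrite big_geq // minn0.
    by rewrite big_nat_recr //= IH; lia.
  by rewrite sumE; apply/minn_idPl.
have := truth_AllP w (i :: v) (Plus (Var 0) One) (bit (Var 0)).
rewrite eval_All => hr; congr nat_of_bool.
apply/hr/idP => [h1|lt j]; last by rewrite /= addn1 ltnS => le1; rewrite h; lia.
by rewrite ltnNge; apply/negP => ge; have := h1 n; rewrite h // ltnn /= addn1 ltnS => /(_ ge).
Qed.

Opaque Ones.

(** Relativization: expressions access a word only through its length and its bits, so those about a
    coded word become expressions about the coding word. Variables hold numbers and stay as they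
    are. *)
Fixpoint in_word (len : expr) (bit : expr -> expr) (e : expr) : expr :=
  match e with
  | Var i => Var i
  | One => One
  | Len => len
  | Bit a => bit (in_word len bit a)
  | Plus a b => Plus (in_word len bit a) (in_word len bit b)
  | Monus a b => Monus (in_word len bit a) (in_word len bit b)
  | Sum a b => Sum (in_word len bit a) (in_word len bit b)
  end.

Lemma eval_in_word w w' len bit v e :
  (forall v, eval w v len = size w') ->
  (forall v a, eval w v (bit a) = nth false w' (eval w v a)) ->
  eval w v (in_word len bit e) = eval w' v e.
Proof.
move=> hl hb; elim: e v => //= [a IH|a IHa b IHb|a IHa b IHb|a IHa b IHb] v;
  rewrite ?hb ?IH ?IHa ?IHb //.
by apply: eq_bigr => i _; apply: IHb.
Qed.

Section PairWord.
Variables x y : seq bool.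

Lemma size_pair_word : size (pair_word x y) = (size x).*2.+1 + size y.
Proof. by rewrite /pair_word size_cat /=; elim: x => //= b s IH; lia. Qed.

Lemma nth_pair_even i : i <= size x -> nth false (pair_word x y) (i + i) = (i < size x).
Proof.
by rewrite /pair_word addnn; elim: x i => [|b s IH] [|i] //=; rewrite ?doubleS !ltnS => /IH.
Qed.

Lemma nth_pair_odd i : i < size x -> nth false (pair_word x y) (i + i + 1) = nth false x i.
Proof.
by rewrite /pair_word addnn addn1; elim: x i => [|b s IH] [|i] //=; rewrite ?doubleS ltnS => /IH.
Qed.

Lemma nth_pair_snd i :
  nth false (pair_word x y) (size x + size x + 1 + i) = nth false y i.
Proof.
by rewrite /pair_word addnn addn1; elim: x => [|b s IH] //=; rewrite ?doubleS.
Qed.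

(** The letters at even positions are 1 up to the separator and thus give the length of [x] in
    unary; the guard in [fst_bit] restores the default [false] beyond the end. *)
Definition fst_len := Ones (fun a => Bit (Plus a a)).
Definition fst_bit a := And (Lt a fst_len) (Bit (Plus (Plus a a) One)).
Definition snd_start := Plus (Plus fst_len fst_len) One.

Lemma eval_fst_len v : eval (pair_word x y) v fst_len = size x.
Proof.
apply: eval_Ones => [{}v i le|]; last by rewrite size_pair_word; lia.
by rewrite truth_Bit /= nth_pair_even.
Qed.

Definition in_fst := in_word fst_len fst_bit.
Definition in_snd := in_word (Monus Len snd_start) (fun a => Bit (Plus snd_start a)).

Lemma eval_in_fst v e : eval (pair_word x y) v (in_fst e) = eval x v e.
Proof.
apply: eval_in_word => [{}v|{}v a]; first exact: eval_fst_len.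
rewrite eval_And truth_Lt eval_fst_len truth_Bit.
have [lt|ge] := ltnP (eval (pair_word x y) v a) (size x); last by rewrite (nth_default _ ge).
by rewrite /= nth_pair_odd.
Qed.

Lemma eval_in_snd v e : eval (pair_word x y) v (in_snd e) = eval y v e.
Proof.
apply: eval_in_word => [{}v|{}v a] /=.
  by rewrite eval_fst_len size_pair_word; lia.
by rewrite eval_fst_len nth_pair_snd.
Qed.

End PairWord.

Lemma class_P_truth e : class_P [set w | truth w [::] e]%classic.
Proof.
exists (fun w => out w [::] (EBit e)); first exact: out_polytime.
by move=> w /=; rewrite -/(truth w [::] e); case: truth.
Qed.

(** * Encoded structures *)

Lemma size_flatten_const (A B : Type) (f : A -> seq B) b (s : seq A) :
  (forall i, size (f i) = b) -> size (flatten [seq f i | i <- s]) = size s * b.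
Proof. by move=> h; elim: s => //= i s IH; rewrite size_cat h IH. Qed.

Lemma nth_flatten_const (A B : Type) (f : A -> seq B) b (s : seq A) a0 x0 i j :
  (forall i, size (f i) = b) -> i < size s -> j < b ->
  nth x0 (flatten [seq f i | i <- s]) (i * b + j) = nth x0 (f (nth a0 s i)) j.
Proof.
move=> h hi hj; elim: s i hi => //= c s IH [|i] hi; rewrite nth_cat h /= ?hj //.
by rewrite mulSn -addnA ltnNge leq_addr /= addKn IH.
Qed.

Lemma size_lex_tuples (A : Type) (s : seq A) k : size (lex_tuples s k) = size s ^ k.
Proof.
elim: k => //= k IH; rewrite (@size_flatten_const _ _ _ (size s ^ k)) ?expnS //.
by move=> x; rewrite size_map IH.
Qed.

Lemma nth_lex_tuples (A : Type) (s : seq A) k t0 t1 x0 i j :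
  i < size s -> j < size s ^ k ->
  nth t1 (lex_tuples s k.+1) (i * size s ^ k + j) =
  cons_tuple (nth x0 s i) (nth t0 (lex_tuples s k) j).
Proof.
move=> hi hj; rewrite /= (nth_flatten_const x0 t1) //.
  by rewrite (nth_map t0) ?size_lex_tuples.
by move=> x; rewrite size_map size_lex_tuples.
Qed.

(** The offset [m.+1] skips the unary cardinality and its delimiter. The rest is the numeral with
    digits [s], [x], [y], [z] in base [m], because the tuples come in lexicographic order. *)
Definition fact_pos m s x y z := m.+1 + (((s * m + x) * m + y) * m + z).

(* The number of elements of the structure encoded by [w], and its relations. *)
Definition card_of (w : seq bool) := index false w.
Definition rel_at (w : seq bool) s x y z := nth false w (fact_pos (card_of w) s x y z).
Definition well_formed s0 (w : seq bool) := size w = (card_of w).+1 + s0 * card_of w ^ 3.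
Definition word_relations s0 (w : seq bool) : relations nat := fun s x y z =>
  [/\ s < s0, x < card_of w, y < card_of w, z < card_of w & rel_at w s x y z].

Section Encode.
Variables (s0 : nat) (A : fin_structure (ternary s0)).
Let m := fin_card A.

Lemma card_of_encode : card_of (encode A) = m.
Proof.
rewrite /card_of /encode -/m index_cat (_ : false \in nseq m true = false).
  by rewrite size_nseq /= addn0.
by rewrite mem_nseq andbF.
Qed.

Lemma size_encode : size (encode A) = m.+1 + s0 * m ^ 3.
Proof.
rewrite /encode size_cat /= size_nseq -/m addnS; congr (_.+1 + _).
rewrite (@size_flatten_const _ _ _ (m ^ 3)) ?size_enum_ord // => R.
by rewrite size_map size_lex_tuples size_enum_ord.
Qed.

Lemma nth_encode (R : 'I_s0) (x y z : 'I_m) :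
  nth false (encode A) (fact_pos m R x y z) = ([tuple x; y; z] \in fin_rel A R).
Proof.
have lt k (u : 'I_m) v : v < m ^ k -> u * m ^ k + v < m ^ k.+1.
  by move=> hv; rewrite expnS; have := ltn_ord u; nia.
have lz : z * m ^ 0 + 0 < m ^ 1 by apply: lt.
have ly := lt 1 y _ lz; have lx := lt 2 x _ ly.
have sE : size (enum 'I_m) = m by rewrite size_enum_ord.
have tE : nth [tuple x; y; z] (lex_tuples (enum 'I_m) 3)
    (x * m ^ 2 + (y * m ^ 1 + (z * m ^ 0 + 0))) = [tuple x; y; z].
  have h2 := @nth_lex_tuples _ (enum 'I_m) 2 [tuple y; z] [tuple x; y; z] x x.
  have h1 := @nth_lex_tuples _ (enum 'I_m) 1 [tuple z] [tuple y; z] x y.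
  have h0 := @nth_lex_tuples _ (enum 'I_m) 0 [tuple] [tuple z] x z.
  move: h2 h1 h0; rewrite !sE => -> //; move=> -> //; move=> -> //.
  by apply/val_inj; rewrite /= !nth_ord_enum.
rewrite /encode nth_cat size_nseq -/m ltnNge (leq_trans (leqnSn m)) ?leq_addr //.
rewrite /fact_pos addSn subSn ?leq_addr // addKn.
rewrite (_ : ((R * m + x) * m + y) * m + z =
  R * m ^ 3 + (x * m ^ 2 + (y * m ^ 1 + (z * m ^ 0 + 0)))); last by rewrite !expnS; nia.
set q := x * _ + _ in lx tE *; rewrite [LHS]/=.
rewrite (@nth_flatten_const _ _ _ (m ^ 3) _ R) ?size_enum_ord // => [|S]; last first.
  by rewrite size_map size_lex_tuples size_enum_ord.
by rewrite nth_ord_enum (nth_map [tuple x; y; z]) ?size_lex_tuples ?sE // tE.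
Qed.

Lemma encode_relations s x y z :
  rel_of (facts_of A) s x y z <-> word_relations s0 (encode A) s x y z.
Proof.
rewrite /word_relations /rel_at card_of_encode; split.
  move=> /facts_ofP [R [t [ht -> e]]].
  case: t ht e => [[|a [|b [|c [|? ?]]]] //= i] ht [-> -> ->]; rewrite !ltn_ord; split=> //.
  rewrite nth_encode (_ : [tuple a; b; c] = @Tuple 3 'I_m [:: a; b; c] i) //.
  exact/val_inj.
move=> [hs hx hy hz]; rewrite (@nth_encode (Ordinal hs) (Ordinal hx) (Ordinal hy) (Ordinal hz)).
by move=> h; apply/facts_ofP; exists (Ordinal hs), [tuple Ordinal hx; Ordinal hy; Ordinal hz].
Qed.

End Encode.

Lemma fact_pos_inv m p s0 : m.+1 <= p -> p < m.+1 + s0 * m ^ 3 -> exists s x y z,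
  [/\ s < s0, x < m, y < m & z < m /\ p = fact_pos m s x y z].
Proof.
move=> ge lt; have m0 : 0 < m by case: m lt ge => //; rewrite exp0n // muln0 addn0 => h;
  rewrite leqNgt h.
pose q := p - m.+1.
have e1 := divn_eq q m; have e2 := divn_eq (q %/ m) m; have e3 := divn_eq (q %/ m %/ m) m.
exists (q %/ m %/ m %/ m), ((q %/ m %/ m) %% m), ((q %/ m) %% m), (q %% m).
rewrite !ltn_mod m0; split=> //; last by split=> //; rewrite /fact_pos -e3 -e2 -e1 /q; lia.
by rewrite !ltn_divLR // -!mulnA -(expnS m 1) -expnS /q; lia.
Qed.

(** Any bit string of the right length describes relations, so a length check is the whole syntax
    check of the verifier. *)
Lemma well_formed_encode s0 w :
  well_formed s0 w -> exists A : fin_structure (ternary s0), w = encode A.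
Proof.
move=> hw; set m := card_of w.
pose rel (R : 'I_s0) : {set 3.-tuple 'I_m} :=
  [set t : 3.-tuple 'I_m | rel_at w R (nth 0 (map val t) 0) (nth 0 (map val t) 1)
                                      (nth 0 (map val t) 2)]%SET.
exists (@FinStructure (ternary s0) m rel); set A := FinStructure _.
have cA := card_of_encode A; rewrite /= in cA.
apply: (@eq_from_nth _ false) => [|p]; first by rewrite size_encode hw.
rewrite hw -/m => hp; have [lt|ge] := ltnP p m.+1.
  have hm v : card_of v = m -> m < size v -> nth false v p = (p < m).
    rewrite /card_of => e h; have [ltp|gep] := ltnP p m.
      have := @before_find _ false (pred1 false) v p.
      by rewrite -/(index false v) e ltp => /(_ isT) /=; case: nth.
    have -> : p = m by lia.
    by rewrite -{1}e nth_index // -index_mem e.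
  rewrite (hm w) // ?hw ?leq_addr // (hm (encode A)) //.
  by rewrite size_encode leq_addr.
have [s [x [y [z [hs hx hy [hz ->]]]]]] := fact_pos_inv ge hp.
rewrite (@nth_encode s0 A (Ordinal hs) (Ordinal hx) (Ordinal hy) (Ordinal hz)).
by rewrite inE.
Qed.

Lemma good_template_word s0 qs w : CSP (good_template s0 qs) w <->
  well_formed s0 w /\ good_class qs (word_relations s0 w).
Proof.
rewrite good_template_CSP; split=> [[A [-> h]]|[hw h]].
  split; first by rewrite /well_formed card_of_encode size_encode.
  by apply: (good_class_hom (f := id) _ h) => s x y z /encode_relations.
have [A e] := well_formed_encode hw; exists A; split=> //.
by apply: (good_class_hom (f := id) _ h) => s x y z; rewrite e => /encode_relations.
Qed.

(** * Membership *)

Lemma eval_first_word w ys v e :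
  eval (foldl pair_word w ys) v (iter (size ys) in_fst e) = eval w v e.
Proof.
elim/last_ind: ys e => [|ys y IH] e //.
by rewrite size_rcons -cats1 foldl_cat /= eval_in_fst IH.
Qed.

Lemma eval_later_word w ys y zs v e :
  eval (foldl pair_word w (ys ++ y :: zs)) v (iter (size zs) in_fst (in_snd e)) = eval y v e.
Proof.
rewrite foldl_cat /=; elim/last_ind: zs e => [|zs z IH] e /=; first exact: eval_in_snd.
by rewrite size_rcons -cats1 foldl_cat /= eval_in_fst IH.
Qed.

Lemma truth_bigOr (A : Type) w v (s : seq A) f :
  truth w v (foldr Or Zero [seq f i | i <- s]) = has (fun i => truth w v (f i)) s.
Proof. by elim: s => //= i s IH; rewrite truth_Or IH. Qed.

Lemma truth_bigAnd (A : Type) w v (s : seq A) f :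
  truth w v (foldr And One [seq f i | i <- s]) = all (fun i => truth w v (f i)) s.
Proof. by elim: s => //= i s IH; rewrite truth_And IH. Qed.

Lemma eval_Plus w v a b : eval w v (Plus a b) = eval w v a + eval w v b.
Proof. by []. Qed.

Section Membership.
Variable qs : seq bool.
Let K := size qs.
Let symbol i := 3 + (K - i.+1).

Definition Card := iter K.+1 in_fst (Ones Bit).
(** The index is computed over the whole paired word, while the bit is read in its first component.
    [Let] hands the number over: environments are shared between a word and its components. *)
Definition Rel s a b c :=
  Let (Plus (Plus Card One) (Plus (Mul (Plus (Mul (Plus (Mul (Const s) Card) a) Card) b) Card) c))
      (iter K.+1 in_fst (Bit (Var 0))).
Definition Letter i a := Let a (iter (K - i) in_fst (in_snd (Bit (Var 0)))).

Definition WellFormed := Eq (iter K.+1 in_fst Len)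
  (Plus (Plus Card One) (Mul (Const (3 + K)) (Mul Card (Mul Card Card)))).
Definition NotClique i :=
  if nth true qs i then Zero
  else Ex Card (Ex Card (And (And (Letter i (Var 1)) (Letter i (Var 0)))
                             (Not (Rel (symbol i) (Var 1) (Var 0) (Var 0))))).
Definition Marked i :=
  if nth true qs i then
    Or (Not (Rel (symbol i) (Var 0) (Var 0) (Var 0))) (Eq (Letter i (Var 0)) (Letter K (Var 0)))
  else Or (Not (Letter i (Var 0))) (Letter K (Var 0)).
Definition Clauses :=
  And (And (Or (Not (Rel 0 (Var 2) (Var 1) (Var 0)))
           (Or (Not (And (Letter K (Var 2)) (Letter K (Var 1)))) (Letter K (Var 0))))
           (Or (Not (Rel 1 (Var 2) (Var 1) (Var 0)))
           (Or (Letter K (Var 2)) (Or (Letter K (Var 1)) (Letter K (Var 0))))))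
      (Or (Not (Rel 2 (Var 2) (Var 2) (Var 2))) (Not (Letter K (Var 2)))).
(** A universal word that is not a clique is an illegal move, which the existential player wins at
    once; hence the disjunction. *)
Definition Verifier :=
  And WellFormed (Or (foldr Or Zero [seq NotClique i | i <- iota 0 K])
    (All Card (And (foldr And One [seq Marked i | i <- iota 0 K]) (All Card (All Card Clauses))))).

Variable w : seq bool.
Let R := word_relations (3 + K) w.
Let m := card_of w.

Definition not_clique n ys := exists i x y,
  [/\ i < n, nth true qs i = false, x < m /\ y < m,
      nth false (nth [::] ys i) x && nth false (nth [::] ys i) y & ~ R (symbol i) x y y].

Definition marks n (ys : seq (seq bool)) : literals nat := fun e b => exists2 i, i < n &
  if nth true qs i then b = nth false (nth [::] ys i) e /\ R (symbol i) e e e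
  else [/\ b = true, e < m & nth false (nth [::] ys i) e].

Section Words.
Variable ys : seq (seq bool).
Hypothesis ys_size : size ys = K.+1.
Let u := foldl pair_word w ys.

Lemma eval_Card v : eval u v Card = m.
Proof.
rewrite /Card -ys_size eval_first_word.
apply: eval_Ones; rewrite /m /card_of ?index_size // => v' i le.
rewrite truth_Bit /=; have [lt|ge] := ltnP i (index false w).
    by have := @before_find _ false (pred1 false) w i lt => /=; case: nth.
have -> : i = index false w by lia.
have [h|h] := boolP (false \in w); first exact: nth_index.
by rewrite nth_default // leqNgt index_mem.
Qed.

Lemma truth_Rel v s a b c : truth u v (Rel s a b c) =
  rel_at w s (eval u v a) (eval u v b) (eval u v c).
Proof.
rewrite truth_Let /truth -ys_size eval_first_word -/(truth _ _ _) truth_Bit.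
by rewrite /rel_at /fact_pos /= !(eval_Plus, eval_Mul, eval_Const, eval_Card) /= addn1.
Qed.

Lemma eval_Letter v i a : i <= K ->
  eval u v (Letter i a) = nth false (nth [::] ys i) (eval u v a).
Proof.
move=> le; rewrite eval_Let.
have e : ys = take i ys ++ nth [::] ys i :: drop i.+1 ys.
  by rewrite -drop_nth ?cat_take_drop // ys_size.
have := eval_later_word w (take i ys) (nth [::] ys i) (drop i.+1 ys).
rewrite -e size_drop ys_size subSS => h.
by rewrite h.
Qed.

Lemma truth_Letter v i a : i <= K ->
  truth u v (Letter i a) = nth false (nth [::] ys i) (eval u v a).
Proof. by move=> le; rewrite /truth eval_Letter //; case: nth. Qed.

Lemma truth_WellFormed : truth u [::] WellFormed <-> well_formed (3 + K) w.
Proof.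
rewrite truth_Eq -ys_size eval_first_word /= !eval_Mul eval_Const eval_Card /well_formed.
by rewrite !expnS expn0 muln1 -/m addn1; split=> /eqP.
Qed.

Lemma truth_NotClique :
  truth u [::] (foldr Or Zero [seq NotClique i | i <- iota 0 K]) <-> not_clique K ys.
Proof.
rewrite truth_bigOr; split=> [/hasP [i]|[i [x [y [lt hi [hx hy] hl nr]]]]].
  rewrite mem_iota add0n => /andP [_ lt]; rewrite /NotClique.
  case hi: (nth true qs i) => //.
  move=> /truth_ExP [x hx /truth_ExP [y hy]].
  rewrite !eval_Card in hx hy; rewrite !truth_And truth_Not truth_Rel !truth_Letter ?(ltnW lt) //=.
  move=> /andP [hl nr]; exists i, x, y; split=> //.
  by case=> _ _ _ _; apply/negP.
apply/hasP; exists i; first by rewrite mem_iota.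
rewrite /NotClique hi; apply/truth_ExP; exists x; rewrite ?eval_Card //.
apply/truth_ExP; exists y; rewrite ?eval_Card //.
rewrite !truth_And truth_Not truth_Rel !truth_Letter ?(ltnW lt) //= hl /=.
apply/negP => h; apply: nr; split=> //; rewrite /symbol; lia.
Qed.

Lemma truth_Final :
  truth u [::] (All Card (And (foldr And One [seq Marked i | i <- iota 0 K])
                         (All Card (All Card Clauses)))) <->
  (forall e b, marks K ys e b -> nth false (nth [::] ys K) e = b) /\
  satisfies R (nth false (nth [::] ys K)).
Proof.
split=> [/truth_AllP h|[hc sat]].
  split=> [e b [i lt]|x y z].
    have marked_at : e < m -> truth u [:: e] (Marked i).
      move=> hm; have := h e; rewrite eval_Card hm => /(_ isT).
      by rewrite truth_And truth_bigAnd => /andP [/allP + _]; apply; rewrite mem_iota.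
    rewrite /Marked in marked_at; case hi: (nth true qs i) marked_at => marked_at.
      move=> [-> [_ hm _ _ hr]]; have := marked_at hm.
      rewrite truth_Or truth_Not truth_Rel /= hr /= truth_Eq !eval_Letter ?(ltnW lt) //=.
      by case: (nth false (nth _ _ i) e); case: nth.
    move=> [-> hm hl]; have := marked_at hm.
    by rewrite truth_Or truth_Not !truth_Letter ?(ltnW lt) //= hl.
  have clauses : x < m -> y < m -> z < m -> truth u [:: z; y; x] Clauses.
    move=> hx hy hz; have := h x; rewrite eval_Card hx => /(_ isT).
    rewrite truth_And => /andP [_ /truth_AllP /(_ y)]; rewrite eval_Card hy => /(_ isT).
    by move=> /truth_AllP /(_ z); rewrite eval_Card hz => /(_ isT).
  have diag : x < m -> truth u [:: x; x; x] Clauses.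
    move=> hx; have := h x; rewrite eval_Card hx => /(_ isT).
    rewrite truth_And => /andP [_ /truth_AllP /(_ x)]; rewrite eval_Card hx => /(_ isT).
    by move=> /truth_AllP /(_ x); rewrite eval_Card hx => /(_ isT).
  rewrite /Clauses !(truth_And, truth_Or, truth_Not, truth_Rel) !truth_Letter //= in clauses.
  rewrite /Clauses !(truth_And, truth_Or, truth_Not, truth_Rel) !truth_Letter //= in diag.
  split=> [[_ hx hy hz hr]|[_ hx hy hz hr]|[_ hx _ _ hr]].
  - by have := clauses hx hy hz; rewrite hr /= => /andP [/andP [+ _] _] cx cy; rewrite cx cy.
  - by have := clauses hx hy hz; rewrite hr /= => /andP [/andP [_ +] _].
  - by have := diag hx; rewrite hr /= => /andP [_ +].
apply/truth_AllP => x; rewrite eval_Card => hx; rewrite truth_And; apply/andP; split.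
  rewrite truth_bigAnd; apply/allP => i; rewrite mem_iota add0n => /andP [_ lt].
  have hs : symbol i < 3 + K by rewrite /symbol; lia.
  rewrite /Marked; case hi: (nth true qs i); rewrite truth_Or truth_Not.
    rewrite truth_Rel truth_Eq !eval_Letter ?(ltnW lt) //= -implybE; apply/implyP => hr.
    by rewrite (hc x (nth false (nth [::] ys i) x)) //; exists i => //; rewrite hi.
  rewrite !truth_Letter ?(ltnW lt) //= -implybE; apply/implyP => hl.
  by rewrite (hc x true) //; exists i => //; rewrite hi.
apply/truth_AllP => y; rewrite eval_Card => hy; apply/truth_AllP => z; rewrite eval_Card => hz.
rewrite /Clauses !(truth_And, truth_Or, truth_Not, truth_Rel) !truth_Letter //= -!implybE.
have [h0 h1 h2] := sat x y z.
apply/andP; split; [apply/andP; split|].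
- by apply/implyP => hr; apply/implyP => /andP [cx cy]; apply: h0.
- by apply/implyP => hr; apply: h1.
- by apply/implyP => hr; have [_ _ h3] := sat x x x; apply: h3.
Qed.

End Words.

Lemma nth_rcons_lt (ys : seq (seq bool)) y i : i < size ys ->
  nth [::] (rcons ys y) i = nth [::] ys i.
Proof. by rewrite nth_rcons => ->. Qed.

Lemma not_clique_rcons n ys y : size ys = n -> not_clique n ys -> not_clique n.+1 (rcons ys y).
Proof.
move=> sn [i [x [z [lt hi hxz hl nr]]]]; exists i, x, z.
by rewrite nth_rcons_lt ?sn //; split=> //; apply: leqW.
Qed.

Lemma marks_rcons n ys y e b : size ys = n -> marks n.+1 (rcons ys y) e b <->
  marks n ys e b \/ if nth true qs n then b = nth false y e /\ R (symbol n) e e e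
                    else [/\ b = true, e < m & nth false y e].
Proof.
move=> sn; have last_y : nth [::] (rcons ys y) n = y by rewrite nth_rcons sn ltnn eqxx.
split=> [[i]|[[i lt h]|h]].
- rewrite ltnS leq_eqVlt => /predU1P [->|lt]; first by rewrite last_y; right.
  by rewrite nth_rcons_lt ?sn // => h; left; exists i.
- by exists i; [apply: leqW | rewrite nth_rcons_lt ?sn].
- by exists n => //; rewrite last_y.
Qed.

Definition verified : language := [set u | truth u [::] Verifier]%classic.

Lemma card_of_foldl ys : m <= size (foldl pair_word w ys).
Proof.
apply: (@leq_trans (size w)); first exact: index_size.
elim/last_ind: ys => //= ys y IH; rewrite -cats1 foldl_cat /= size_pair_word; lia.
Qed.

Lemma nest_verified d n ys : n + d = K -> size ys = n ->
  nest (zip (rcons (drop n qs) true) (nseq d.+1 'X%R)) verified (foldl pair_word w ys) <->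
  well_formed (3 + K) w /\ (not_clique n ys \/ good R (drop n qs) (marks n ys)).
Proof.
(* A move is written as a characteristic word of length [m]. Every paired word is at least that
   long, so ['X] is a sufficient length bound for all quantifiers. *)
have short (c : nat -> bool) zs : size (mkseq c m) <= (('X :
  {poly nat}).[size (foldl pair_word w zs)])%R.
  by rewrite hornerX size_mkseq card_of_foldl.
have foldl_rcons zs y : pair_word (foldl pair_word w zs) y = foldl pair_word w (rcons zs y).
  by rewrite -cats1 foldl_cat.
elim: d n ys => [|d IH] n ys.
  rewrite addn0 => -> sK; rewrite drop_size /=.
  have verifiedE y : verified (pair_word (foldl pair_word w ys) y) <->
      well_formed (3 + K) w /\ (not_clique K ys \/
        (forall e b, marks K ys e b -> nth false y e = b) /\ satisfies R (nth false y)).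
    have sy : size (rcons ys y) = K.+1 by rewrite size_rcons sK.
    rewrite /verified /= foldl_rcons truth_And truth_Or.
    have yK : nth [::] (rcons ys y) K = y by rewrite nth_rcons sK ltnn eqxx.
    have e1 := truth_WellFormed sy; have e2 := truth_NotClique sy; have := truth_Final sy.
    rewrite yK => e3.
    have e4 : not_clique K (rcons ys y) <-> not_clique K ys.
      by split=> -[i [x [z [lt hi hxz hl nr]]]]; exists i, x, z; move: hl;
        rewrite nth_rcons_lt ?sK.
    have e5 e b : marks K (rcons ys y) e b <-> marks K ys e b.
      by split=> -[i lt h]; exists i => //; move: h; rewrite nth_rcons_lt ?sK.
    split=> [/andP [/e1 hw /orP [/e2/e4|/e3 [hc sat]]]|[/e1 -> [/e4/e2 ->//|[hc sat]]]].
    - by split=> //; left.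
    - by split=> //; right; split=> // e b /e5; apply: hc.
    - by apply/orP; right; apply/e3; split=> // e b /e5; apply: hc.
  split=> [[y _ /verifiedE [hw [h|[hc sat]]]]|[hw [h|[c hc sat]]]].
  - by split=> //; left.
  - by split=> //; right; exists (nth false y).
  - exists (mkseq (fun => false) m); first exact: short.
    by apply/verifiedE; split=> //; left.
  exists (mkseq c m); first exact: short.
  apply/verifiedE; split=> //; right; split=> [e b h|x y z].
    have hm : e < m by case: h => i _; case: nth => [[_ []]|[]].
    by rewrite nth_mkseq //; apply: hc.
  have [h0 h1 h2] := sat x y z.
  by split=> hr; have [_ hx hy hz _] := hr; rewrite !nth_mkseq //;
    [apply: h0 | apply: h1 | apply: h2].
rewrite addnS => nd sn; have lt : n < K by lia.
have sz y : size (rcons ys y) = n.+1 by rewrite size_rcons sn.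
rewrite (drop_nth true) -/K //= size_drop -/K -/(symbol n).
have IHn y : nest (zip (rcons (drop n.+1 qs) true) (nseq d.+1 'X%R)) verified
    (pair_word (foldl pair_word w ys) y) <->
    well_formed (3 + K) w /\ (not_clique n.+1 (rcons ys y) \/
      good R (drop n.+1 qs) (marks n.+1 (rcons ys y))).
  by rewrite foldl_rcons; apply: IH; rewrite ?sz //; lia.
case hn: (nth true qs n).
  have nc y : not_clique n.+1 (rcons ys y) -> not_clique n ys.
    move=> [i [x [z []]]]; rewrite ltnS leq_eqVlt => /predU1P [->|lti hi hxz hl nr].
      by rewrite hn.
    by exists i, x, z; move: hl; rewrite nth_rcons_lt ?sn.
  split=> [[y _ /IHn [hw [/nc h|h]]]|[hw [h|[c hc]]]].
  - by split=> //; left.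
  - split=> //; right; exists (nth false y).
    apply: (good_hom (f := id) _ _ h) => // e b hb; apply/(marks_rcons _ _ _ sn).
    by rewrite hn.
  - exists (mkseq (fun => false) m); first exact: short.
    by apply/IHn; split=> //; left; apply: not_clique_rcons.
  exists (mkseq c m); first exact: short.
  apply/IHn; split=> //; right; apply: (good_hom (f := id) _ _ hc) => // e b.
  move/(marks_rcons _ _ _ sn); rewrite hn => -[|[-> hr]]; [by left | right].
  by have [_ hm _ _ _] := hr; rewrite nth_mkseq.
split=> [h|[hw [h|h]] y _]; last first.
- apply/IHn; split=> //.
  have [nc|nc] := EM (not_clique n.+1 (rcons ys y)); [by left | right].
  apply: (good_hom (f := id) _ _ (h (fun e => e < m /\ nth false y e) _)) =>
    // [e b|x z [hx yx] [hz yz]].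
    move/(marks_rcons _ _ _ sn); rewrite hn => -[|[-> hm hl]]; [by left | by right].
  apply: contrapT => nr; apply: nc; exists n, x, z.
  by rewrite nth_rcons sn ltnn eqxx yx yz.
- by apply/IHn; split=> //; left; apply: not_clique_rcons.
(* Well-formedness does not depend on the move and can be read off from an arbitrary one. *)
have [hw _] := (IHn _).1 (h (mkseq (fun => false) m) (short _ _)).
split=> //; have [nc|nc] := EM (not_clique n ys); [by left | right].
move=> X cX; pose y := mkseq (fun e => `[< X e >]) m.
have yE e : e < m -> nth false y e = `[< X e >] by move=> hm; rewrite nth_mkseq.
have [_ [[i [x [z []]]]|hy]] := (IHn y).1 (h y (short _ _)).
  rewrite ltnS leq_eqVlt => /predU1P [->|lti hi hxz]; last first.
    by rewrite nth_rcons_lt ?sn // => hl nr; case: nc; exists i, x, z.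
  move=> _ [hx hz]; rewrite nth_rcons sn ltnn eqxx !yE // => /andP [/asboolP Xx /asboolP Xz] [].
  exact: cX.
apply: (good_hom (f := id) _ _ hy) => // e b [hb|[-> Xe]]; apply/(marks_rcons _ _ _ sn);
  [by left|right].
have [_ hm _ _ _] := cX e e Xe Xe.
by rewrite hn yE //; split=> //; apply/asboolP.
Qed.

End Membership.

Lemma size_alternation b k : size (alternation b k) = k.
Proof. by elim: k b => //= k IH b; rewrite IH. Qed.

(** The parity condition under which the innermost of [k.+1] alternating quantifiers is
    existential. *)
Lemma alternation_rcons b k : b (+) odd k ->
  rcons (alternation b k) true = alternation b k.+1.
Proof. by elim: k b => [|k IH] b /=; [rewrite addbF => -> | rewrite addbN -addNb => /IH ->]. Qed.

Theorem template_level b k : b (+) odd k ->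
  level b k.+1 (CSP (good_template (3 + k) (alternation b k))).
Proof.
move=> hb; have sk := size_alternation b k; have alt_rcons := alternation_rcons hb.
apply: (@nest_level _ _ _ (zip (alternation b k.+1) (nseq k.+1 'X%R)) (verified (alternation b k))).
- by rewrite unzip1_zip // size_nseq size_alternation.
- rewrite /= addbN hb /=.
  rewrite (_ : (~` _)%classic = [set u | truth u [::] (Not (Verifier (alternation b k)))]%classic).
    exact: class_P_truth.
  by apply/seteqP; split=> u /=; rewrite truth_Not => /negP.
move=> w; rewrite good_template_word.
have := @nest_verified (alternation b k) w k 0 [::]; rewrite sk drop0 alt_rcons => -> //.
split=> [[hw h]|[hw [[i [x [y []]]]//|h]]]; split=> //.
  by right; apply: (good_hom (f := id) _ _ h) => // e b' [].
by apply: (good_hom (f := id) _ _ h).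
Qed.

(** * Hardness *)

Section Trace.
Variables (M : machine) (z : seq bool) (T : nat).
Local Notation tapes := 'I_(extra_tapes M).+1.

Definition conf n : config M := iter n (fun c => odflt c (step c)) (init M z).

Definition scan n (i : tapes) : symbol M := scanned ((conf n).2 i).

Definition action n := delta (conf n).1 [ffun i => scan n i].

(* The position of the head on an absolute scale, the input starting in cell [T];
   the cells read by [cell] do not depend on the head. *)
Fixpoint pos n (i : tapes) : nat :=
  if n is n'.+1 then
    if action n' is Some (_, a) then
      match (a i).2 with
      | MoveLeft => (pos n' i).-1
      | Stay => pos n' i
      | MoveRight => (pos n' i).+1
      end
    else pos n' i
  else T.

Definition cell n (i : tapes) p : symbol M :=
  let t := (conf n).2 i in
  if p < pos n i then nth None t.1 (pos n i - p.+1) else nth None t.2 (p - pos n i).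

Lemma scan_cell n i : scan n i = cell n i (pos n i).
Proof. by rewrite /cell ltnn subnn nth0. Qed.

Lemma step_action n : step (conf n) =
  if action n is Some (q, a) then Some (q, [ffun i => write_move ((conf n).2 i) (a i)])
  else None.
Proof. by []. Qed.

Lemma conf_halt n : action n = None -> conf n.+1 = conf n.
Proof. by move=> h; rewrite /conf iterS -/(conf n) step_action h. Qed.

Lemma conf_step n q a : action n = Some (q, a) ->
  conf n.+1 = (q, [ffun i => write_move ((conf n).2 i) (a i)]).
Proof. by move=> h; rewrite {1}/conf iterS -/(conf n) step_action h. Qed.

Lemma cell_halt n i p : action n = None -> cell n.+1 i p = cell n i p.
Proof. by move=> h; rewrite /cell conf_halt //= h. Qed.

(** A nonzero position excludes a truncated predecessor in a left move, which would shift the scale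
    against the tape. *)
Lemma cell_step n q a i p : action n = Some (q, a) -> 0 < pos n i ->
  cell n.+1 i p = if p == pos n i then (a i).1 else cell n i p.
Proof.
move=> h p0; rewrite /cell (conf_step h) [pos n.+1 i]/= h /= ffunE.
case: ((conf n).2 i) => l r; case: (a i) => s d; rewrite /write_move /=.
move: (pos n i) p0 => [//|k] _; case: d => /=.
- have [e|e] := eqVneq p k.+1; first by rewrite e ltnNge leqnSn /= subSnn.
  have [lt|ge] := ltnP p k; first by rewrite ltnW // nth_behead subSS -subSn.
  have [e1|e1] := eqVneq p k; first by rewrite e1 ltnSn subnn subSS subnn nth0.
  rewrite ltnNge ltn_neqAle eq_sym e1 ge /=.
  rewrite (_ : p - k = (p - k.+2).+2) /=; last by lia.
  by rewrite nth_behead; congr nth; lia.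
- have [e|e] := eqVneq p k.+1; first by rewrite e ltnn subnn.
  have [lt|ge] := ltnP p k.+1; first by [].
  rewrite (_ : p - k.+1 = (p - k.+2).+1) /=; last by lia.
  by rewrite nth_behead.
have [e|e] := eqVneq p k.+1; first by rewrite e ltnSn subnn.
have [lt|ge] := ltnP p k.+1.
  by rewrite ltnW // subSn.
rewrite ltnNge ltn_neqAle eq_sym e ge /= nth_behead; congr nth; lia.
Qed.

Lemma pos_range n i : T - n <= pos n i <= T + n.
Proof.
elim: n => [|n /andP [h1 h2]] /=; first by lia.
by case: (action n) => [[q a]|]; [case: (a i).2|]; lia.
Qed.

Lemma run_conf k c : run k (init M z) = Some c -> exists h,
  [/\ h <= k, conf h = c, action h = None & forall n, n < h -> action n <> None].
Proof.
have gen j : run k (conf j) = Some c -> (forall n, n < j -> action n <> None) -> exists h,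
    [/\ h <= j + k, conf h = c, action h = None & forall n, n < h -> action n <> None].
  elim: k j => [|k IH] j /=; rewrite step_action; case e: (action j) => [[q a]|] //.
  - by move=> [<-] hj; exists j; rewrite addn0.
  - rewrite -(conf_step e) => h hj; have [n|h' [le]] := IH j.+1 h.
      by rewrite ltnS leq_eqVlt => /predU1P [->|/hj //]; rewrite e.
    by rewrite addSnnS in le; exists h'.
  - by move=> [<-] hj; exists j; rewrite leq_addr.
by move=> h; apply: (gen 0).
Qed.

Lemma conf_stable h n : action h = None -> h <= n -> conf n = conf h.
Proof.
move=> ah le; rewrite -(subnKC le); elim: (n - h) => [|j IH]; rewrite ?addn0 // addnS.
by rewrite conf_halt // /action /scan IH.
Qed.

End Trace.

(* [None] stands for the end of the word. *)
Definition letter (z : seq bool) j : option bool :=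
  if j < size z then Some (nth false z j) else None.

(** Every choice function yields a word of length at most [p], cut at the first [None] or at the
    bound; so there are no malformed choices to rule out. *)
Fixpoint decode (p : nat) (F : nat -> option bool) : seq bool :=
  if p is p'.+1 then if F 0 is Some b then b :: decode p' (F \o succn) else [::] else [::].

Lemma size_decode p F : size (decode p F) <= p.
Proof. by elim: p F => //= p IH F; case: (F 0) => //= b; rewrite ltnS. Qed.

Lemma decode_lt p F l : l < size (decode p F) -> F l = Some (nth false (decode p F) l).
Proof.
elim: p F l => //= p IH F l; case e: (F 0) => [b|] //=.
by case: l => //= l; rewrite ltnS => /IH.
Qed.

Lemma decode_end p F : size (decode p F) < p -> F (size (decode p F)) = None.
Proof.
elim: p F => //= p IH F; case e: (F 0) => [b|] //=.
by rewrite ltnS => /IH.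
Qed.

Lemma decode_letter p y : size y <= p -> decode p (letter y) = y.
Proof.
elim: y p => [|b y IH] [|p] //= le; rewrite /letter /=; congr cons.
by rewrite -[RHS](IH p).
Qed.

Lemma decode_Some p F l b : l <= size (decode p F) -> l < p -> F l = Some b ->
  l < size (decode p F).
Proof.
by move=> le lt; rewrite ltn_neqAle le andbT; apply: contra_eqN => /eqP e; rewrite e decode_end -?e.
Qed.

Lemma decode_None p F l : l <= size (decode p F) -> F l = None -> l = size (decode p F).
Proof.
by rewrite leq_eqVlt => /predU1P [//|/decode_lt ->].
Qed.

(** * Words paired from the choices at the successive levels *)

Section Words.
Variables (P : nat -> {poly nat}) (x : seq bool).

Fixpoint word (F : nat -> nat -> option bool) (i : nat) : seq bool :=
  if i is j.+1 then pair_word (word F j) (decode (P j).[size (word F j)]%R (F j)) else x.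

Lemma wordS F i :
  word F i.+1 = pair_word (word F i) (decode (P i).[size (word F i)]%R (F i)).
Proof. by []. Qed.

Lemma eq_word F F' i : (forall j, j < i -> F j = F' j) -> word F i = word F' i.
Proof.
elim: i => // i IH h; rewrite !wordS IH => [|j lt]; last by apply/h/leqW.
by rewrite h.
Qed.

Lemma letter_pair y z j : letter (pair_word y z) j =
  if j < size y + size y then Some (if odd j then nth false y j./2 else true)
  else if j == size y + size y then Some false
  else letter z (j - (size y + size y + 1)).
Proof.
rewrite /letter size_pair_word; have [lt|ge] := ltnP j (size y + size y).
  rewrite ifT; last by lia.
  congr Some; have := odd_double_half j; case: odd => /= e.
    by rewrite -(@nth_pair_odd y z); [congr nth; lia | lia].
  by rewrite -{1}e -addnn add0n (@nth_pair_even y z); lia.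
have [->|ne] := eqVneq j (size y + size y).
  by rewrite ifT; [rewrite (@nth_pair_even y z) ?ltnn | lia].
have -> : (j < (size y).*2.+1 + size z) = (j - (size y + size y + 1) < size z) by lia.
by rewrite -(@nth_pair_snd y z); case: ifP => // _; congr (Some (nth _ _ _)); lia.
Qed.

End Words.

Arguments word : simpl never.

(** * Atoms and rules of the reduction *)

Section Rules.
Variables (M : machine) (k : nat) (P : nat -> {poly nat}) (flag : nat -> bool).
Variables (pT pN : {poly nat}).
Local Notation tapes := 'I_(extra_tapes M).+1.
Local Notation vector := {ffun 'I_(extra_tapes M).+1 -> symbol M}.

(* An atom is a tag with two numbers:
   [TY i d], [l]: letter [l] of the word chosen at level [i] is [d];
   [TW i d], [j]: letter [j] of the word composed of the first [i] choices is [d];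
   [TU i], [j], [l]: that word has [j] letters and choice [i] has at least [l];
   [TState q], [n], and likewise [THead], [TCell], [TScan]: the machine at time [n];
   [TRead j q f], [n]: the state is [q] and the tapes below [j] scan [f];
   [TEnd], [n]: no bit follows the scanned cell of the output tape;
   [TBad]: the output is [:: true]. *)
Inductive tag :=
| TY of 'I_k.+1 & option bool
| TW of 'I_k.+2 & option bool
| TU of 'I_k.+1
| TState of state M
| THead of tapes
| TCell of tapes & symbol M
| TScan of tapes & symbol M
| TRead of 'I_(extra_tapes M).+2 & state M & vector
| TEnd
| TBad.

Definition tag_sum : finType :=
  ('I_k.+1 * option bool + ('I_k.+2 * option bool + ('I_k.+1 + (state M + (tapes +
   (tapes * symbol M + (tapes * symbol M +
   ('I_(extra_tapes M).+2 * state M * vector + bool))))))))%type.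

Definition sum_of_tag (t : tag) : tag_sum :=
  match t with
  | TY i c => inl (i, c)
  | TW i c => inr (inl (i, c))
  | TU i => inr (inr (inl i))
  | TState q => inr (inr (inr (inl q)))
  | THead i => inr (inr (inr (inr (inl i))))
  | TCell i s => inr (inr (inr (inr (inr (inl (i, s))))))
  | TScan i s => inr (inr (inr (inr (inr (inr (inl (i, s)))))))
  | TRead j q f => inr (inr (inr (inr (inr (inr (inr (inl (j, q, f))))))))
  | TEnd => inr (inr (inr (inr (inr (inr (inr (inr true)))))))
  | TBad => inr (inr (inr (inr (inr (inr (inr (inr false)))))))
  end.

Lemma sum_of_tag_inj : injective sum_of_tag.
Proof. by case=> [? ?|? ?|?|?|?|? ?|? ?|? ? ?||] [? ?|? ?|?|?|?|? ?|? ?|? ? ?||] //= [] -> // -> // ->. Qed.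

Definition tag_count := #|tag_sum|.
Definition tag_number (t : tag) : nat := enum_rank (sum_of_tag t).

Definition term := (tag * expr * expr)%type.
Record rule := Rule {
  rsym : nat; rcond : expr; rterm1 : term; rterm2 : term; rterm3 : term
}.

Definition horn c p q r := Rule 0 c p q r.
Definition unit_clause c r := Rule 1 c r r r.

Inductive rule_index :=
| I_input of bool
| I_input_end
| I_double1 of 'I_k.+1 & bool
| I_double2 of 'I_k.+1 & bool
| I_double_end of 'I_k.+1
| I_later of 'I_k.+1
| I_later_next of 'I_k.+1 & bool
| I_later_letter of 'I_k.+1 & bool
| I_later_end of 'I_k.+1
| I_later_cut of 'I_k.+1
| I_choice of 'I_k.+1
| I_level of 'I_k & option bool & option bool
| I_tape of bool
| I_tape_right
| I_tape_left
| I_tape_blank of tapes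
| I_head of tapes
| I_start
| I_scan of tapes & symbol M
| I_read of state M & vector
| I_read_next of tapes & state M & vector
| I_state of state M & vector
| I_write of tapes & state M & vector
| I_move of tapes & state M & vector
| I_keep of tapes & symbol M
| I_end of symbol M
| I_bad of state M & vector
| I_not_bad.

Section Terms.
Let a := Var 0.
Let b := Var 1.
Let c := Var 2.
Let two e := Plus e e.
Let T := Horner pT Len.
Let bound (i : 'I_k.+1) e := Horner (P i) e.
Let lower (i : 'I_k.+1) : 'I_k.+2 := widen_ord (leqnSn _) i.
Let upper (i : 'I_k.+1) : 'I_k.+2 := lift ord0 i.
Let this (i : tapes) : 'I_(extra_tapes M).+2 := widen_ord (leqnSn _) i.
Let next (i : tapes) : 'I_(extra_tapes M).+2 := lift ord0 i.
Let all_read q f : term := (TRead ord_max q f, a, Zero).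

Definition is_bit (s : symbol M) : bool := if s is Some (inl _) then true else false.

Definition truth_value (t : bool) := if t then One else Zero.

(** A Horn clause has two premises, so the vector of scanned symbols is collected tape by tape in
    [TRead], and a transition is spread over rules for the state, the written cells, the heads and
    the unchanged cells. Where [delta] gives no transition, the condition [Zero] keeps the rule from
    firing. *)
Definition rule_of (j : rule_index) : rule :=
  match j with
  | I_input d => unit_clause (And (Lt a Len) (Eq (Bit a) (truth_value d)))
      (TW ord0 (Some d), a, Zero)
  | I_input_end => unit_clause (Eq a Len) (TW ord0 None, a, Zero)
  | I_double1 i d => let p := (TW (lower i) (Some d), a, Zero) in
      horn One p p (TW (upper i) (Some true), two a, Zero)
  | I_double2 i d => let p := (TW (lower i) (Some d), a, Zero) in
      horn One p p (TW (upper i) (Some d), Plus (two a) One, Zero)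
  | I_double_end i => let p := (TW (lower i) None, a, Zero) in
      horn One p p (TW (upper i) (Some false), two a, Zero)
  | I_later i => let p := (TW (lower i) None, a, Zero) in
      horn One p p (TU i, a, Zero)
  | I_later_next i d => horn (Lt b (bound i a))
      (TU i, a, b) (TY i (Some d), b, Zero) (TU i, a, Plus b One)
  | I_later_letter i d => horn (Lt b (bound i a))
      (TU i, a, b) (TY i (Some d), b, Zero)
      (TW (upper i) (Some d), Plus (Plus (two a) One) b, Zero)
  | I_later_end i => horn (Lt b (bound i a))
      (TU i, a, b) (TY i None, b, Zero)
      (TW (upper i) None, Plus (Plus (two a) One) b, Zero)
  | I_later_cut i => horn (Eq b (bound i a)) (TU i, a, b) (TU i, a, b)
      (TW (upper i) None, Plus (Plus (two a) One) b, Zero)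
  | I_choice i => Rule 1 One
      (TY i (Some true), a, Zero) (TY i (Some false), a, Zero) (TY i None, a, Zero)
  | I_level i d d' =>
      let i' := widen_ord (leqnSn _) i in
      let p := (TY i' d, a, Zero) in
      let q := (TY i' d', b, Zero) in
      if flag i then Rule (3 + (k - i.+1)) One p p p
      else Rule (3 + (k - i.+1)) (Or (truth_value (d == d')) (Not (Eq a b))) p q q
  | I_tape d => let p := (TW ord_max (Some d), a, Zero) in
      horn One p p (TCell ord0 (Some (inl d)), Zero, Plus T a)
  | I_tape_right => let p := (TW ord_max None, a, Zero) in
      horn One p p (TCell ord0 None, Zero, Plus (Plus T a) b)
  | I_tape_left => unit_clause (Lt a T) (TCell ord0 None, Zero, a)
  | I_tape_blank i => unit_clause (truth_value (i != ord0)) (TCell i None, Zero, a)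
  | I_head i => unit_clause One (THead i, Zero, T)
  | I_start => unit_clause One (TState (start M), Zero, Zero)
  | I_scan i s => horn One (THead i, a, b) (TCell i s, a, b) (TScan i s, a, Zero)
  | I_read q f => let p := (TState q, a, Zero) in
      horn One p p (TRead ord0 q f, a, Zero)
  | I_read_next i q f => horn One (TRead (this i) q f, a, Zero) (TScan i (f i), a, Zero)
      (TRead (next i) q f, a, Zero)
  | I_state q f => let p := all_read q f in
      if delta q f is Some (q', _) then horn One p p (TState q', Plus a One, Zero)
      else horn Zero p p p
  | I_write i q f => let p := all_read q f in
      if delta q f is Some (_, w) then
        horn One p (THead i, a, b) (TCell i (w i).1, Plus a One, b)
      else horn Zero p p p
  | I_move i q f => let p := all_read q f in
      if delta q f is Some (_, w) then
        horn One p (THead i, a, b) (THead i, Plus a One,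
          match (w i).2 with MoveLeft => Monus b One | Stay => b | MoveRight => Plus b One end)
      else horn Zero p p p
  | I_keep i s => horn (Not (Eq b c)) (THead i, a, b) (TCell i s, a, c)
      (TCell i s, Plus a One, c)
  | I_end s => horn (truth_value (~~ is_bit s))
      (THead ord_max, a, b) (TCell ord_max s, a, Plus b One) (TEnd, a, Zero)
  | I_bad q f => horn (truth_value (~~ isSome (delta q f) && (f ord_max == Some (inl true))))
      (all_read q f) (TEnd, a, Zero) (TBad, Zero, Zero)
  | I_not_bad => let p := (TBad, Zero, Zero) in Rule 2 One p p p
  end.

End Terms.

HB.instance Definition _ := gen_eqMixin rule_index.

Definition all_rules : seq rule_index :=
  let levels := enum 'I_k.+1 in
  let bits := enum {: bool} in
  let letters := enum {: option bool} in
  let heads := enum tapes in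
  let states := enum {: state M} in
  let vectors := enum {: vector} in
  let symbols := enum {: symbol M} in
  [:: I_input_end; I_tape_right; I_tape_left; I_start; I_not_bad] ++
  [seq I_input d | d <- bits] ++
  [seq I_double1 i d | i <- levels, d <- bits] ++
  [seq I_double2 i d | i <- levels, d <- bits] ++
  [seq I_double_end i | i <- levels] ++
  [seq I_later i | i <- levels] ++
  [seq I_later_next i d | i <- levels, d <- bits] ++
  [seq I_later_letter i d | i <- levels, d <- bits] ++
  [seq I_later_end i | i <- levels] ++
  [seq I_later_cut i | i <- levels] ++
  [seq I_choice i | i <- levels] ++
  [seq f d' | f <- [seq I_level i d | i <- enum 'I_k, d <- letters], d' <- letters] ++
  [seq I_tape d | d <- bits] ++
  [seq I_tape_blank i | i <- heads] ++
  [seq I_head i | i <- heads] ++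
  [seq I_scan i s | i <- heads, s <- symbols] ++
  [seq I_read q f | q <- states, f <- vectors] ++
  [seq g f | g <- [seq I_read_next i q | i <- heads, q <- states], f <- vectors] ++
  [seq I_state q f | q <- states, f <- vectors] ++
  [seq g f | g <- [seq I_write i q | i <- heads, q <- states], f <- vectors] ++
  [seq g f | g <- [seq I_move i q | i <- heads, q <- states], f <- vectors] ++
  [seq I_keep i s | i <- heads, s <- symbols] ++
  [seq I_end s | s <- symbols] ++
  [seq I_bad q f | q <- states, f <- vectors].

Lemma mem_all_rules j : j \in all_rules.
Proof.
have h3 (A B C : finType) (h : A -> B -> C -> rule_index) i d e :
    h i d e \in [seq g e | g <- [seq h i d | i <- enum A, d <- enum B], e <- enum C].
  apply/allpairsP; exists (h i d, e); split; rewrite ?mem_enum //.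
  by apply/allpairsP; exists (i, d); rewrite !mem_enum.
have h2 (A B : finType) (h : A -> B -> rule_index) i d :
    h i d \in [seq h i d | i <- enum A, d <- enum B].
  by apply/allpairsP; exists (i, d); rewrite !mem_enum.
have h1 (A : finType) (h : A -> rule_index) i : h i \in [seq h i | i <- enum A].
  by apply/mapP; exists i; rewrite ?mem_enum.
by rewrite /all_rules !mem_cat; case: j => *; rewrite ?h1 ?h2 ?h3 ?inE ?eqxx ?orbT.
Qed.

Lemma eval_truth_value w v t : eval w v (truth_value t) = t.
Proof. by case: t => //=; rewrite subnn. Qed.

Lemma truth_truth_value w v t : truth w v (truth_value t) = t.
Proof. by rewrite /truth eval_truth_value; case: t. Qed.

Section Structure.
Variable x : seq bool.
Let N := (pN.[size x])%R.
Let T := (pT.[size x])%R.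

Definition atom := (tag * nat * nat)%type.
Definition atom_code (X : atom) : nat := (tag_number X.1.1 * N + X.1.2) * N + X.2.
Definition in_range (X : atom) : bool := (X.1.2 < N) && (X.2 < N).
Definition atom_of v (t : term) : atom := (t.1.1, eval x v t.1.2, eval x v t.2).

(* The terms of a rule only use the variables 0, 1 and 2; the rest of the
   environment is there for the formula that defines the encoded structure. *)
Definition fires j s (X Y Z : atom) v := [/\ s = rsym (rule_of j),
  truth x v (rcond (rule_of j)), X = atom_of v (rterm1 (rule_of j)),
  Y = atom_of v (rterm2 (rule_of j)) & Z = atom_of v (rterm3 (rule_of j))].

Definition atom_relations : relations atom := fun s X Y Z => exists j a b c,
  [/\ [&& a < N, b < N & c < N], [&& in_range X, in_range Y & in_range Z] &
      fires j s X Y Z [:: a; b; c; atom_code Z; atom_code Y; atom_code X; s]].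

Section Intended.
Variable F : nat -> nat -> option bool.
Local Notation word := (word P x F).
Local Notation z := (word k.+1).
Local Notation tconf := (@conf M z).
Local Notation tpos := (@pos M z T).
Local Notation tcell := (@cell M z T).
Local Notation tscan := (@scan M z).
Local Notation taction := (@action M z).

Definition choice_word i := decode (P i).[size (word i)]%R (F i).

Definition intended (X : atom) : Prop :=
  let: (t, n, m) := X in
  match t with
  | TY i d => d = F i n
  | TW i d => n <= size (word i) /\ d = letter (word i) n
  | TU i => n = size (word i) /\ m <= size (choice_word i)
  | TState q => (tconf n).1 = q
  | THead i => m = tpos n i
  | TCell i s => tcell n i m = s
  | TScan i s => tscan n i = s
  | TRead j q f => (tconf n).1 = q /\ forall i : tapes, i < j -> tscan n i = f i
  | TEnd => ~~ is_bit (tcell n ord_max (tpos n ord_max).+1)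
  | TBad => False
  end.

Definition color (X : atom) : bool := `[< intended X >].

Lemma colorP X : color X <-> intended X.
Proof. by split=> /asboolP. Qed.

Section Soundness.
Hypothesis accepts : exists2 n, run n (init M z) <> None & n <= T.
Hypothesis accepts_output : forall n c, run n (init M z) = Some c -> output c <> [:: true].

Lemma all_read_action q (f : vector) n : (tconf n).1 = q ->
  (forall i : tapes, i < (extra_tapes M).+1 -> tscan n i = f i) -> taction n = delta q f.
Proof. by move=> <- h; rewrite /taction; congr delta; apply/ffunP => i; rewrite ffunE h. Qed.

(** A machine that still acts at time [n] has made fewer than [T] steps, too few to bring a head
    from cell [T] to cell 0. *)
Lemma pos_gt0 n i q w : taction n = Some (q, w) -> 0 < tpos n i.
Proof.
move=> h; have [m hm le] := accepts; case e: (run m (init M z)) hm => [c|] // _.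
have [h0 [le0 _ h1 _]] := run_conf e.
have := pos_range z T n i; suff : n < h0 by lia.
rewrite ltnNge; apply/negP => le1; move: h.
by rewrite /taction (conf_stable h1 le1) /tscan (conf_stable h1 le1) -/(taction h0) h1.
Qed.

Lemma cell0 i p : tcell 0 i p =
  if p < T then None else if i == ord0 then nth None [seq Some (inl b) | b <- z] (p - T) else None.
Proof.
by rewrite /cell /= ffunE; case: ifP => _; case: ifP => _ /=; rewrite ?nth_nil.
Qed.

Lemma accepts_halt q (f : vector) n : (tconf n).1 = q ->
  (forall i : tapes, i < (extra_tapes M).+1 -> tscan n i = f i) -> delta q f = None ->
  f ord_max = Some (inl true) -> ~~ is_bit (tcell n ord_max (tpos n ord_max).+1) -> False.
Proof.
move=> eq hf hd h1 h2; have [m hm _] := accepts; case e: (run m (init M z)) hm => [c|] // _.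
have hn : taction n = None by rewrite (all_read_action eq hf).
have [h0 [_ ec a0 _]] := run_conf e; have := accepts_output e.
have -> : c = tconf n.
  by rewrite -ec; have [le|/ltnW le] := leqP h0 n; rewrite (conf_stable _ le).
apply; rewrite /output; move: h2 (hf ord_max (ltn_ord _)); rewrite h1 (scan_cell z T).
rewrite /cell ltnNge leqnSn /= subSnn ltnn subnn.
by case: ((tconf n).2 ord_max).2 => [|s [|[[d|?]|] r]] //= _ ->.
Qed.

Ltac fire := rewrite /atom_of /= ?eval_Horner /= ?subnn;
  move=> -> /[swap] -> /[swap] -> /[swap] ->.

Lemma satisfies_intended : satisfies atom_relations color.
Proof.
suff h s X Y Z : atom_relations s X Y Z -> match s with
    | 0 => color X -> color Y -> color Z
    | 1 => [|| color X, color Y | color Z]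
    | 2 => ~~ color X
    | _ => True end.
  by move=> X Y Z; split=> [/h|/h|/h].
have upperE (i : 'I_k.+1) d n : intended (TW (lift ord0 i) d, n, 0) <->
    n <= size (pair_word (word i) (choice_word i)) /\
    d = letter (pair_word (word i) (choice_word i)) n by [].
have lowerE (i : 'I_k.+1) d n : intended (TW (widen_ord (leqnSn _) i) d, n, 0) <->
    n <= size (word i) /\ d = letter (word i) n by [].
have size_later i : size (choice_word i) <= (P i).[size (word i)]%R by apply: size_decode.
have hornI (A : bool) X' Y' Z' : (A -> intended X' -> intended Y' -> intended Z') ->
    A -> color X' -> color Y' -> color Z'.
  by move=> h hA /colorP hX /colorP hY; apply/colorP/h.
have unitI (A : bool) X' : (A -> intended X') -> A -> [|| color X', color X' | color X'].
  by move=> h hA; rewrite !orbb; apply/colorP/h.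
move=> [j [a [b [c [_ _ []]]]]]; case: j.
- move=> d; fire; apply: unitI; rewrite truth_And truth_Lt truth_Eq eval_truth_value /=.
  move=> /andP [lt e]; split; [exact: ltnW | rewrite /letter lt; congr Some].
  by move: e; case: (d); case: nth.
- by fire; apply: unitI; rewrite truth_Eq /= => /eqP ->; rewrite /letter ltnn.
- move=> i d; fire; apply: hornI => _ /lowerE [le e] _; apply/upperE;
  rewrite size_pair_word letter_pair.
  move: e; rewrite /letter; case: ltnP => // lt _; rewrite ifT; last by lia.
  by rewrite addnn odd_double; split=> //; lia.
- move=> i d; fire; apply: hornI => _ /lowerE [le e] _; apply/upperE;
  rewrite size_pair_word letter_pair.
  move: e; rewrite /letter; case: ltnP => // lt [->]; rewrite ifT; last by lia.
  by rewrite addnn addn1 /= odd_double /= uphalf_double; split=> //; lia.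
- move=> i; fire; apply: hornI => _ /lowerE [le e] _; apply/upperE;
  rewrite size_pair_word letter_pair.
  move: e; rewrite /letter; case: ltnP => // ge _.
  have -> : a = size (word i) by apply/eqP; rewrite eqn_leq le.
  by rewrite ltnn eqxx; split=> //; lia.
- move=> i; fire; apply: hornI => _ /lowerE [le e] _.
  by move: e; rewrite /letter; case: ltnP => // ge _; split=> //; apply/eqP; rewrite eqn_leq le.
- move=> i d; fire; apply: hornI; rewrite truth_Lt eval_Horner /= => lt [e le] eY; split=> //.
  by rewrite addn1; apply: (decode_Some le _ (esym eY)); rewrite -e.
- move=> i d; fire; apply: hornI; rewrite truth_Lt eval_Horner /= => lt [e le] eY; apply/upperE.
  have lt1 : b < size (choice_word i) by apply: (decode_Some le _ (esym eY)); rewrite -e.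
rewrite size_pair_word letter_pair e ifF; last by lia.
  rewrite ifF; last by lia.
  rewrite addKn /letter lt1; split; first by lia.
  by rewrite eY (decode_lt lt1).
- move=> i; fire; apply: hornI; rewrite truth_Lt eval_Horner /= => lt [e le] eY; apply/upperE.
  have eb : b = size (choice_word i) by apply: decode_None le (esym eY).
  rewrite size_pair_word letter_pair e ifF; last by lia.
  rewrite ifF; last by lia.
  by rewrite addKn /letter eb ltnn; split=> //; lia.
- move=> i; fire; apply: hornI; rewrite truth_Eq eval_Horner /= => /eqP eb [e le] _; apply/upperE.
  have {}eb : b = size (choice_word i).
    by apply/eqP; rewrite eqn_leq le eb e size_later.
  rewrite size_pair_word letter_pair e ifF; last by lia.
  rewrite ifF; last by lia.
  by rewrite addKn /letter eb ltnn; split=> //; lia.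
- move=> i; fire => _; case e: (F i a) => [[]|].
  + by rewrite (_ : color _) //; apply/colorP.
  + by rewrite (_ : color (TY i (Some false), a, 0)) ?orbT //; apply/colorP.
  + by rewrite (_ : color (TY i None, a, 0)) ?orbT //; apply/colorP.
- by move=> i d d'; rewrite /=; case: ifP => _ /= ->.
- move=> d; fire; apply: hornI => _ [le e] _ /=; rewrite cell0 ltnNge leq_addr /= addKn.
  by move: e; rewrite /letter; case: ltnP => // lt [->]; rewrite (nth_map false).
- fire; apply: hornI => _ [le e] _ /=.
  rewrite cell0 -addnA ltnNge leq_addr /= addKn nth_default // size_map.
  by move: e; rewrite /letter; case: ltnP => // ge _; rewrite (leq_trans ge) ?leq_addr.
- by fire; apply: unitI; rewrite truth_Lt eval_Horner /= cell0 => ->.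
- move=> i; fire; apply: unitI; rewrite truth_truth_value /= cell0 => /negbTE ->.
  by case: ifP.
- by move=> i; fire; apply: unitI.
- by fire; apply: unitI.
- by move=> i d; fire; apply: hornI => _ /= -> <-; rewrite (scan_cell z T).
- by move=> q f; fire; apply: hornI => _ /= ->.
- move=> i q f; fire; apply: hornI => _ /= [-> h] hi; split=> // i'.
  by rewrite /bump /= add1n ltnS leq_eqVlt => /predU1P [/val_inj ->|/h].
- move=> q f; rewrite /=; case e: (delta q f) => [[q' w]|]; fire; apply: hornI;
  rewrite /truth /= ?subnn //.
  by move=> _ [h1 h2] _; rewrite addn1 (conf_step (q := q') (a := w)) // (all_read_action h1 h2).
- move=> i q f; rewrite /=; case e: (delta q f) => [[q' w]|]; fire; apply: hornI;
  rewrite /truth /= ?subnn //.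
  move=> _ [h1 h2] ->; have ea : taction a = Some (q', w) by rewrite (all_read_action h1 h2).
  by rewrite addn1 (cell_step _ ea (pos_gt0 _ ea)) eqxx.
- move=> i q f; rewrite /=; case e: (delta q f) => [[q' w]|]; fire; apply: hornI;
  rewrite /truth /= ?subnn //.
  move=> _ [h1 h2] ->; have ea : taction a = Some (q', w) by rewrite (all_read_action h1 h2).
  by rewrite addn1 /= ea; case: (w i).2 => /=; rewrite ?subn1 ?addn1.
- move=> i d; fire; apply: hornI; rewrite truth_Not truth_Eq /= addn1 => ne eb ec.
  case ea: (taction a) => [[q w]|]; last by rewrite cell_halt.
  by rewrite (cell_step _ ea (pos_gt0 _ ea)) -eb eq_sym (negbTE ne).
- by move=> d; fire; apply: hornI; rewrite truth_truth_value /= addn1 => hd -> ->.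
- move=> q f; fire; apply: hornI; rewrite truth_truth_value /= => /andP [hd /eqP hf] [h1 h2] h3.
  by apply: (accepts_halt h1 h2 _ hf h3); case: (delta q f) hd.
by fire => _; apply/negP => /colorP.
Qed.

End Soundness.

Section Derivation.
Variables (B : nat) (col : atom -> bool).
(** Within [T] steps the heads stay at or below [T + T], and the input ends by [T + B]. The surplus
    leaves room for the cell beside the output head and makes [N] positive. *)
Hypothesis N_large : T + T + B + 3 <= N.
Hypothesis word_bounded : forall i, i <= k.+1 -> size (word i) <= B.
Hypothesis sat : satisfies atom_relations col.
Hypothesis choices : forall (i : 'I_k.+1) l, l < N -> col (TY i (F i l), l, 0).

Lemma derive j a b d X Y Z :
  fires j 0 X Y Z [:: a; b; d; atom_code Z; atom_code Y; atom_code X; 0] ->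
  [&& a < N, b < N & d < N] -> [&& in_range X, in_range Y & in_range Z] ->
  col X -> col Y -> col Z.
Proof. by move=> h1 h2 h3; have [+ _ _] := sat X Y Z; apply; exists j, a, b, d. Qed.

Lemma derive_unit j a b d X :
  fires j 1 X X X [:: a; b; d; atom_code X; atom_code X; atom_code X; 1] ->
  [&& a < N, b < N & d < N] -> in_range X -> col X.
Proof.
move=> h1 h2 h3; have [_ + _] := sat X X X; rewrite !orbb; apply.
by exists j, a, b, d; rewrite h3.
Qed.

Ltac fires := rewrite /fires /atom_of /= ?eval_Horner /= ?subnn;
  rewrite ?(truth_And, truth_Not, truth_Lt, truth_Eq, truth_truth_value, eval_truth_value,
            eval_Horner) /= ?eqxx -?/T.

Lemma N_gt0 : 0 < N. Proof. by lia. Qed.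

(** Before the separator, letters come in pairs from the shorter word. Behind it, [TU] walks along
    the latest choice until that ends, either by a [None] or at the length bound; these are the two
    rules for the end of the word. *)
Lemma derive_word (i : 'I_k.+2) n : n <= size (word i) ->
  col (TW i (letter (word i) n), n, 0).
Proof.
have N0 := N_gt0.
case: i => i; elim: i n => [|i IH] n hi /= le.
  have leB : n <= B by apply: leq_trans le (word_bounded (leq0n _)).
  rewrite (_ : Ordinal hi = ord0); last exact/val_inj.
  rewrite /letter; case: ltnP => [lt|ge].
    apply: (@derive_unit (I_input (nth false x n)) n 0 0); rewrite /in_range /=; try lia.
    by fires; rewrite lt.
  apply: (@derive_unit I_input_end n 0 0); rewrite /in_range /=; try lia.
  by fires; rewrite (eqn_leq n) le ge.
have hi' : i < k.+1 by [].
pose i' : 'I_k.+1 := Ordinal hi'.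
rewrite (_ : Ordinal hi = lift ord0 i'); last exact/val_inj.
have {}IH m : m <= size (word i) ->
    col (TW (widen_ord (leqnSn _) i') (letter (word i) m), m, 0).
  move=> lem; have := IH m (ltnW hi) lem; congr (is_true (col (TW _ _, _, _))); exact/val_inj.
have bB := @word_bounded i.+1 hi; rewrite wordS size_pair_word in bB.
rewrite wordS size_pair_word in le; rewrite wordS letter_pair.
set y := decode _ _ in le bB *; set sz := size (word i) in le bB *.
have yP : size y <= (P i').[sz]%R by apply: size_decode.
have last_z : col (TW (widen_ord (leqnSn _) i') None, sz, 0).
  by have := IH sz (leqnn _); rewrite /letter ltnn.
have later l : l <= size y -> col (TU i', sz, l).
  elim: l => [_|l IHl lt].
    by apply: (derive (j := I_later i') (a := sz) (b := 0) (d := 0) _ _ _ last_z last_z);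
      rewrite /in_range /=; try lia; fires.
  have := @choices i' l; rewrite (decode_lt lt) => hc.
  apply: (derive (j := I_later_next i' (nth false y l)) (a := sz) (b := l) (d := 0)
    _ _ _ (IHl (ltnW lt)) (hc _)); rewrite /in_range /=; try lia.
  by fires; rewrite addn1 (leq_trans lt yP).
case: ltnP => [lt|ge].
  have lt2 : n./2 < sz by lia.
  have := IH n./2 (ltnW lt2); rewrite /letter lt2 => h.
  have := odd_double_half n; case: odd => e.
    apply: (derive (j := I_double2 i' (nth false (word i) n./2)) (a := n./2) (b := 0) (d := 0) _ _ _ h h);
      rewrite /in_range /=; try lia.
    by fires; split=> //; congr (_, _, _); lia.
  apply: (derive (j := I_double1 i' (nth false (word i) n./2)) (a := n./2) (b := 0) (d := 0) _ _ _ h h);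
    rewrite /in_range /=; try lia.
  by fires; split=> //; congr (_, _, _); lia.
case: eqP => [->|ne].
  apply: (derive (j := I_double_end i') (a := sz) (b := 0) (d := 0) _ _ _ last_z last_z);
    rewrite /in_range /=; try lia.
  by fires.
set l := n - (sz + sz + 1); have ley : l <= size y by lia.
have en : n = sz + sz + 1 + l by lia.
rewrite /letter; case: ltnP => [lt|gel].
  have := @choices i' l; rewrite (decode_lt lt) => hc.
  apply: (derive (j := I_later_letter i' (nth false y l)) (a := sz) (b := l) (d := 0)
    _ _ _ (later l ley) (hc _)); rewrite /in_range /=; try lia.
  by fires; rewrite (leq_trans lt yP) en.
have el : l = size y by lia.
have [lt|geP] := ltnP l (P i').[sz]%R.
  have eF : F i l = None by rewrite el; apply: decode_end; move: lt; rewrite {1}el.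
  have := @choices i' l; rewrite [F _ _]eF => hc.
  apply: (derive (j := I_later_end i') (a := sz) (b := l) (d := 0)
    _ _ _ (later l ley) (hc _)); rewrite /in_range /=; try lia.
  by fires; rewrite lt en.
apply: (derive (j := I_later_cut i') (a := sz) (b := l) (d := 0)
  _ _ _ (later l ley) (later l ley)); rewrite /in_range /=; try lia.
have leP : l <= (P i').[sz]%R by rewrite el.
by fires; rewrite en (eqn_leq l) geP leP.
Qed.

Definition derived n :=
  [/\ col (TState (tconf n).1, n, 0),
      forall i, col (THead i, n, tpos n i) &
      forall i p, p < N -> col (TCell i (tcell n i p), n, p)].

Lemma pos_lt n i : n <= T -> tpos n i < N.
Proof. by move=> le; have := pos_range z T n i; lia. Qed.

Lemma derived0 : derived 0.
Proof.
have N0 := N_gt0; have zB := word_bounded (leqnn _); split=> [|i|i p lt].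
- apply: (@derive_unit I_start 0 0 0); rewrite /in_range /=; try lia.
  by fires.
- apply: (@derive_unit (I_head i) 0 0 0); rewrite /in_range /=; try lia.
  by fires.
rewrite cell0; case: ltnP => [ltT|ge].
  have [->|i0] := eqVneq i ord0.
    apply: (@derive_unit I_tape_left p 0 0); rewrite /in_range /=; try lia.
    by fires; rewrite ltT.
  apply: (@derive_unit (I_tape_blank i) p 0 0); rewrite /in_range /=; try lia.
  by fires.
have [->|i0] := eqVneq i ord0; last first.
  apply: (@derive_unit (I_tape_blank i) p 0 0); rewrite /in_range /=; try lia.
  by fires.
have [lt1|ge1] := ltnP (p - T) (size z).
  have := @derive_word ord_max (p - T) (ltnW lt1); rewrite /letter lt1 => h.
  rewrite (nth_map false) //.
  apply: (derive (j := I_tape (nth false z (p - T))) (a := p - T) (b := 0) (d := 0) _ _ _ h h);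
    rewrite /in_range /=; try lia.
  by fires; rewrite subnKC.
rewrite nth_default ?size_map //.
have := @derive_word ord_max (size z) (leqnn _); rewrite /letter ltnn.
move: (size z) ge1 zB => sz ge1 zB h.
apply: (derive (j := I_tape_right) (a := sz) (b := p - T - sz) (d := 0) _ _ _ h h);
  rewrite /in_range /=; try lia.
by fires; split=> //; congr (_, _, _); lia.
Qed.

Lemma derive_read n : n <= T -> derived n ->
  col (TRead ord_max (tconf n).1 [ffun i => tscan n i], n, 0).
Proof.
move=> le [hq hh hc]; have N0 := N_gt0.
have scanned_at i : col (TScan i (tscan n i), n, 0).
  have lt := pos_lt i le; rewrite (scan_cell z T).
  apply: (derive (j := I_scan i (tcell n i (tpos n i))) (a := n) (b := tpos n i) (d := 0)
    _ _ _ (hh i) (hc i _ lt)); rewrite /in_range /=; try lia.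
  by fires.
suff h j (hj : j < (extra_tapes M).+2) :
    col (TRead (Ordinal hj) (tconf n).1 [ffun i => tscan n i], n, 0).
  by have := h _ (ltnSn _); rewrite (_ : Ordinal _ = ord_max) //; apply/val_inj.
elim: j hj => [|j IH] hj.
  rewrite (_ : Ordinal hj = ord0); last exact/val_inj.
  apply: (derive (j := I_read (tconf n).1 [ffun i =>
    tscan n i]) (a := n) (b := 0) (d := 0) _ _ _ hq hq);
    rewrite /in_range /=; try lia.
  by fires.
have hj' : j < (extra_tapes M).+1 by [].
have {}IH := IH (ltnW hj).
rewrite (_ : Ordinal hj = lift ord0 (Ordinal hj')); last exact/val_inj.
apply: (derive (j := I_read_next (Ordinal hj') (tconf n).1 [ffun i => tscan n i])
  (a := n) (b := 0) (d := 0) _ _ _ IH (scanned_at (Ordinal hj'))); rewrite /in_range /=; try lia.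
by fires; split=> //; rewrite ?ffunE //; congr (TRead _ _ _, _, _); apply/val_inj.
Qed.

Lemma derived_step n : n < T -> taction n <> None -> derived n -> derived n.+1.
Proof.
move=> lt ha hd; have N0 := N_gt0; have hr := derive_read (ltnW lt) hd.
have [hq hh hc] := hd; set f := [ffun i => tscan n i] in hr.
case ea: (taction n) ha => [[q w]|] // _.
have ed : delta (tconf n).1 f = Some (q, w) by [].
have lt1 i : tpos n i < N by apply/pos_lt/ltnW.
split=> [|i|i p hp].
- rewrite (conf_step ea) /=.
  apply: (derive (j := I_state (tconf n).1 f) (a := n) (b := 0) (d := 0) _ _ _ hr hr);
    rewrite /in_range /=; try lia.
  by rewrite /fires /= ed; fires; rewrite addn1.
- have lt2 := @pos_lt n.+1 i lt.
  apply: (derive (j := I_move i (tconf n).1 f) (a := n) (b := tpos n i) (d := 0) _ _ _ hr (hh i));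
    rewrite /in_range; try lia.
    rewrite /fires /rule_of ed /= ea; split; rewrite ?/atom_of //= ?subnn //.
    by case: (w i).2 => /=; rewrite ?subn1 ?addn1.
  by rewrite lt1 /=; lia.
  by apply/and3P; split; (apply/andP; split); first [exact: lt2 | exact: lt1 | rewrite /=; lia].
have p0 : 0 < tpos n i by have := pos_range z T n i; lia.
rewrite (cell_step p ea p0); case: eqP => [->|ne].
  apply: (derive (j := I_write i (tconf n).1 f) (a := n) (b := tpos n i) (d := 0) _ _ _ hr (hh i));
    rewrite /in_range /= ?lt1 ?andbT; try lia.
  by rewrite /fires /= ed; fires; rewrite addn1.
apply: (derive (j := I_keep i (tcell n i p)) (a := n) (b := tpos n i) (d := p) _ _ _ (hh i) (hc i p hp));
  rewrite /in_range /= ?lt1 ?hp ?andbT; try lia.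
by fires; rewrite addn1 eq_sym; split=> //; apply/eqP.
Qed.

(** The colouring may contain more than the intended atoms, but it is closed under the Horn rules.
    The answer [[:: true]] would therefore force [TBad] to be true, against [I_not_bad]. *)
Lemma derived_output n d : run n (init M z) = Some d -> n <= T -> output d <> [:: true].
Proof.
move=> /run_conf [h [le1 <- ha hs]] le2; have le := leq_trans le1 le2; have N0 := N_gt0.
have hd : derived h.
  suff g m : m <= h -> derived m by apply: g.
  elim: m => [_|m IH lt]; first exact: derived0.
  by apply: derived_step (IH (ltnW lt)); [apply: leq_trans lt le | apply: hs].
have hr := derive_read le hd; have [hq hh hc] := hd.
set f := [ffun i => tscan h i] in hr.
have ed : delta (tconf h).1 f = None by [].
have lt := @pos_range M z T h ord_max.
rewrite /output => ho.
have [f_true next_end] : f ord_max = Some (inl true) /\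
    ~~ is_bit (tcell h ord_max (tpos h ord_max).+1).
  rewrite ffunE (scan_cell z T) /cell ltnn subnn ltnNge leqnSn /= subSnn.
  by case: ((tconf h).2 ord_max).2 ho => [|[[[]|?]|] [|[[?|?]|] r]] //=.
have lt1 : (tpos h ord_max).+1 < N by lia.
have h_end : col (TEnd, h, 0).
  apply: (derive (j := I_end (tcell h ord_max (tpos h ord_max).+1)) (a := h)
    (b := tpos h ord_max) (d := 0) _ _ _ (hh ord_max) (hc ord_max _ lt1));
    rewrite /in_range /=; try lia.
  by fires; rewrite next_end addn1.
have h_bad : col (TBad, 0, 0).
  apply: (derive (j := I_bad (tconf h).1 f) (a := h) (b := 0) (d := 0) _ _ _ hr h_end);
    rewrite /in_range /=; try lia.
  by fires; rewrite ed f_true eqxx.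
have [_ _] := sat (TBad, 0, 0) (TBad, 0, 0) (TBad, 0, 0).
rewrite h_bad => /(_ _)/negP []//; exists I_not_bad, 0, 0, 0; rewrite /in_range /= N0.
by split=> //; fires.
Qed.

End Derivation.
End Intended.
End Structure.
End Rules.

Lemma run_det (M : machine) w n n' (c c' : config M) :
  run n (init M w) = Some c -> run n' (init M w) = Some c' -> c = c'.
Proof.
move=> /run_conf [h [_ <- a1 _]] /run_conf [h' [_ <- a2 _]].
by have [le|/ltnW le] := leqP h h'; rewrite (conf_stable _ le).
Qed.

(** * The game on the atoms against the quantified sentence *)

Section Game.
Variables (M : machine) (k : nat) (P : nat -> {poly nat}) (flag : nat -> bool).
Variables (pT pN : {poly nat}) (x : seq bool) (V : language) (B : nat).
Let N := (pN.[size x])%R.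
Let T := (pT.[size x])%R.
Local Notation word := (word P x).
Local Notation atom := (atom M k).
Local Notation relations_x := (@atom_relations M k P flag pT pN x).

Hypothesis flag_last : flag k.
Hypothesis N_large : T + T + B + 3 <= N.
Hypothesis word_bounded : forall F i, i <= k.+1 -> size (word F i) <= B.
(** The machine decides the complement of [V]: Horn rules can only refute, so the answer they detect
    has to be the one that defeats the existential player. *)
Hypothesis machine_decides : forall w, size w <= B -> exists n c,
  [/\ n <= T, run n (init M w) = Some c & output c = [:: true] <-> ~ V w].

(** Symbols from 3 on occur in [I_level] only, and [k - i.+1] determines [i]. At a universal level
    an edge joins equal letters or different positions, so a clique has at most one letter at each
    position. *)
Lemma level_fact (i : 'I_k) X Y Z : relations_x (3 + (k - i.+1)) X Y Z ->
  let i' := widen_ord (leqnSn _) i in exists a b d d',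
  [/\ a < N, b < N, X = (TY M i' d, a, 0), Y = (TY M i' d', b, 0) &
      flag i \/ d = d' \/ a <> b].
Proof.
move=> [j [a [b [c [hr _ []]]]]]; have /and3P [ha hb _] := hr.
case: j => [d||i' d|i' d|i'|i'|i' d|i' d|i'|i'|i'|i' d d'|d|||i'|i'||i' s|q f|i' q f|q f|i' q f|i' q f|i' s|s|q f|] /=;
  try by []; try by case: (delta q f) => [[]|].
move=> es; have {es} ei : i' = i.
  apply/val_inj; move: es; case: ifP => _ /= es; have := ltn_ord i; have := ltn_ord i'; lia.
rewrite ei; case: ifP => hf /=; rewrite /atom_of /= ?subnn.
  by move=> _ -> -> _; exists a, a, d, d; split=> //; left.
rewrite truth_Or truth_Not truth_Eq truth_truth_value /= => hc -> -> _.
exists a, b, d, d'; split=> //; right.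
by case/orP: hc => [/eqP ->|/eqP ne]; [left | right].
Qed.

Lemma level_true (i : 'I_k) d l : flag i -> l < N ->
  let X := (TY M (widen_ord (leqnSn _) i) d, l, 0) in relations_x (3 + (k - i.+1)) X X X.
Proof.
move=> hf lt; exists (I_level M i d d), l, 0, 0; rewrite /in_range /=.
have N0 : 0 < N by lia.
by rewrite !lt N0; split=> //; rewrite /fires /= hf /= /atom_of /= subnn.
Qed.

Lemma level_false (i : 'I_k) d d' l l' : flag i = false -> l < N -> l' < N ->
  d = d' \/ l <> l' ->
  let i' := widen_ord (leqnSn _) i in let Y := (TY M i' d', l', 0) in
  relations_x (3 + (k - i.+1)) (TY M i' d, l, 0) Y Y.
Proof.
move=> hf lt lt' h; exists (I_level M i d d'), l, l', 0; rewrite /in_range /=.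
have N0 : 0 < N by lia.
rewrite !lt !lt' N0; split=> //; rewrite /fires /= hf /= /atom_of /= subnn.
split=> //; rewrite truth_Or truth_Not truth_Eq truth_truth_value /=.
by case: h => [->|/eqP ->]; rewrite ?eqxx ?orbT.
Qed.

Definition set_choice (F : nat -> nat -> option bool) i f j := if j == i then f else F j.

Lemma word_set_choice F i f : word (set_choice F i f) i.+1 =
  pair_word (word F i) (decode (P i).[size (word F i)]%R f).
Proof.
rewrite wordS (@eq_word P x _ F) => [|j lt]; last by rewrite /set_choice ltn_eqF.
by rewrite /set_choice eqxx.
Qed.

(** A colouring may make several letters true at one position. Any of them will do, as the
    computation is derived for whichever word is read off. *)
Definition choice_of (col : atom -> bool) (i : 'I_k.+1) l : option bool :=
  if col (TY M i (Some true), l, 0) then Some true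
  else if col (TY M i (Some false), l, 0) then Some false else None.

Lemma col_choice_of col (i : 'I_k.+1) l :
  satisfies relations_x col -> l < N -> col (TY M i (choice_of col i l), l, 0).
Proof.
move=> sat lt; rewrite /choice_of; case h1: (col (TY M i (Some true), l, 0)) => //.
case h2: (col (TY M i (Some false), l, 0)) => //.
have [_ + _] := sat (TY M i (Some true), l, 0) (TY M i (Some false), l, 0) (TY M i None, l, 0).
rewrite h1 h2 /=; apply; exists (I_choice M i), l, 0, 0; rewrite /in_range /=.
have N0 : 0 < N by lia.
by rewrite !lt N0; split=> //; rewrite /fires /= /atom_of /= subnn.
Qed.

Lemma decided w : size w <= B -> V w ->
  (exists2 n, run n (init M w) <> None & n <= T) /\
  (forall n c, run n (init M w) = Some c -> output c <> [:: true]).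
Proof.
move=> le hV; have [n [c [ln er ho]]] := machine_decides le; split; first by exists n; rewrite ?er.
by move=> n' c' /(run_det er) <- /ho.
Qed.

(** The literals have to hold in the intended colouring of every continuation [F'] of the first [i]
    choices, since the later choices are still open. *)
Lemma nest_good d i F (S : literals atom) : i + d = k ->
  (forall e b, S e b -> forall F', (forall j, j < i -> F' j = F j) ->
     color P pT x F' e = b) ->
  nest [seq (flag j, P j) | j <- iota i d.+1] V (word F i) ->
  good relations_x [seq flag j | j <- iota i d] S.
Proof.
have letter_choice F0 i0 y : size y <= (P i0).[size (word F0 i0)]%R ->
    word (set_choice F0 i0 (letter y)) i0.+1 = pair_word (word F0 i0) y.
  by move=> le; rewrite word_set_choice decode_letter.
elim: d i F S => [|d IH] i F S.
  rewrite addn0 => -> hS /=; rewrite flag_last => -[y le hV].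
  pose F' := set_choice F k (letter y).
  exists (color P pT x F') => [e b /hS -> //|].
    by move=> j lt; rewrite /F' /set_choice ltn_eqF.
  have hV' : V (word F' k.+1) by rewrite /F' letter_choice.
  have [h1 h2] := decided (word_bounded F' (leqnn _)) hV'.
  exact: satisfies_intended.
rewrite addnS => ik hS; have lt : i < k by lia.
pose i' : 'I_k := Ordinal lt; pose i1 : 'I_k.+1 := widen_ord (leqnSn _) i'.
rewrite [iota i d.+2]/= [iota i d.+1]/= !map_cons.
have symE : size [seq flag j | j <- iota i.+1 d] = k - i.+1 by rewrite size_map size_iota; lia.
have agree f F' : (forall j, j < i.+1 -> F' j = set_choice F i f j) ->
    (forall j, j < i -> F' j = F j) /\ F' i = f.
  move=> h; split=> [j ltj|]; last by rewrite h // /set_choice eqxx.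
  by rewrite h ?ltnS ?(ltnW ltj) // /set_choice ltn_eqF.
case hf: (flag i) => /=; rewrite symE.
  move=> [y le hn]; pose F1 := set_choice F i (letter y).
  have eF1 : word F1 i.+1 = pair_word (word F i) y by rewrite /F1 letter_choice.
  exists (color P pT x F1); apply: (IH i.+1 F1); [by lia | | by rewrite eF1].
  move=> e b [/hS h|[-> /(@level_fact i') [a [b' [d1 [d2 [_ _ -> _ _]]]]]]] F' /agree [h1 h2].
    exact: h.
  by rewrite /color /= h2 /F1 /set_choice eqxx.
move=> hn X cX.
(* Positions without a letter in the clique get [None]. This is harmless: the sentence holds for
   every word, and a missing mark imposes no literal. *)
pose f l := if `[< X (TY M i1 (Some true), l, 0) >] then Some true
            else if `[< X (TY M i1 (Some false), l, 0) >] then Some false else None.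
have fE e : X e -> exists d l, e = (TY M i1 d, l, 0) /\ d = f l.
  move=> Xe; have /(@level_fact i') [a [b' [d1 [d2 [_ _ e1 _ _]]]]] := cX e e Xe Xe.
  exists d1, a; split=> //; rewrite e1 in Xe.
  have uniq d3 : X (TY M i1 d3, a, 0) -> d1 = d3.
    move=> X3; have /(@level_fact i') [a1 [b1 [d4 [d5 [_ _ [-> ->] [-> ->]]]]]] := cX _ _ Xe X3.
    by case=> [|[]//]; rewrite /= hf.
  rewrite /f; case: asboolP => [/uniq //|n1]; case: asboolP => [/uniq //|n2].
  by case: d1 Xe uniq e1 => [[]|].
pose F1 := set_choice F i f.
apply: (IH i.+1 F1); [by lia | | by rewrite word_set_choice; apply: hn; apply: size_decode].
  move=> e b [/hS h|[-> /fE [d1 [l [-> ed]]]]] F' /agree [h1 h2]; first exact: h.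
by apply/colorP; rewrite /= h2.
Qed.

(** The final colouring is not known during the game, so the invariant speaks of all satisfying
    colourings that respect the literals: each contains the letters chosen so far. *)
Lemma good_nest d i (F : nat -> nat -> option bool) (S : literals atom) : i + d = k ->
  (forall col, (forall e b, S e b -> col e = b) -> satisfies relations_x col ->
     forall j : 'I_k.+1, j < i -> forall l, l < N -> col (TY M j (F j l), l, 0)) ->
  good relations_x [seq flag j | j <- iota i d] S ->
  nest [seq (flag j, P j) | j <- iota i d.+1] V (word F i).
Proof.
have extend_choices i0 (i1 : 'I_k.+1) (F0 : nat -> nat -> option bool) f (col : atom -> bool) :
  i1 = i0 :> nat ->
    (forall j : 'I_k.+1, j < i0 -> forall l, l < N -> col (TY M j (F0 j l), l, 0)) ->
    (forall l, l < N -> col (TY M i1 (f l), l, 0)) ->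
    forall j : 'I_k.+1, j < i0.+1 -> forall l, l < N ->
      col (TY M j (set_choice F0 i0 f j l), l, 0).
  move=> ei h1 h2 j; rewrite ltnS leq_eqVlt => /predU1P [ej|lt] l ll.
    have -> : j = i1 by apply/val_inj; rewrite /= ej ei.
    by rewrite /set_choice ei eqxx; apply: h2.
  by rewrite /set_choice ltn_eqF //; apply: h1.
elim: d i F S => [|d IH] i F S.
  rewrite addn0 => -> hS /=; rewrite flag_last => -[col hcol sat].
  pose f := choice_of col ord_max; pose F' := set_choice F k f.
  exists (decode (P k).[size (word F k)]%R f); first exact: size_decode.
  rewrite -word_set_choice -/F'.
  have ch : forall (j : 'I_k.+1) l, l < N -> col (TY M j (F' j l), l, 0).
    move=> j; apply: (extend_choices k ord_max) (ltn_ord j) => // [|l]; first exact: hS.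
    exact: col_choice_of.
  have wB := word_bounded F' (leqnn _).
  have [n [c [ln er ho]]] := machine_decides wB.
  apply: contrapT => /ho; apply: (derived_output (B := B) N_large _ sat ch er ln).
  by move=> i0; apply: word_bounded.
rewrite addnS => ik hS; have lt : i < k by lia.
pose i' : 'I_k := Ordinal lt; pose i1 : 'I_k.+1 := widen_ord (leqnSn _) i'.
rewrite [iota i d.+2]/= [iota i d.+1]/= !map_cons.
have symE : size [seq flag j | j <- iota i.+1 d] = k - i.+1 by rewrite size_map size_iota; lia.
case hf: (flag i) => /=; rewrite symE.
  move=> [c0 hg]; pose f := choice_of c0 i1.
  exists (decode (P i).[size (word F i)]%R f); first exact: size_decode.
  rewrite -word_set_choice; apply: (IH i.+1) hg; first by lia.
  move=> col hcol sat; apply: (extend_choices i i1) => // [|l ll].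
    by apply: hS => // e b h; apply: hcol; left.
  (* The move [c0] need not satisfy any clause, but the letter atoms of this level belong to its
     unary relation. So [col] agrees with [c0] on them, and the clauses of [I_choice] may be applied
     to [col]. *)
  have e1 d1 : col (TY M i1 d1, l, 0) = c0 (TY M i1 d1, l, 0).
    by apply: hcol; right; split=> //; apply: level_true.
  by rewrite /f /choice_of -!e1; apply: col_choice_of.
move=> hg y le; rewrite -(decode_letter le) -word_set_choice.
pose X (e : atom) := exists2 l, l < N & e = (TY M i1 (letter y l), l, 0).
apply: (IH i.+1 _ _ _ _ (hg X _)); first by lia.
- move=> col hcol sat; apply: (extend_choices i i1) => // [|l ll].
    by apply: hS => // e b h; apply: hcol; left.
  by apply: hcol; right; split=> //; exists l.
move=> _ _ [l ll ->] [l' ll' ->]; apply: level_false => //.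
by have [->|/eqP ne] := eqVneq l l'; [left | right].
Qed.

End Game.

(** * The reduction as an output program *)

Section Encoding.
Variables (M : machine) (k : nat) (P : nat -> {poly nat}) (flag : nat -> bool).
Variables (pT pN : {poly nat}).
Let s0 := 3 + k.
Let NE := Horner pN Len.

Definition Same_term v (t : term M k) :=
  And (Lt t.1.2 NE) (And (Lt t.2 NE)
    (Eq v (Plus (Mul (Plus (Mul (Const (tag_number t.1.1)) NE) t.1.2) NE) t.2))).

(** Under the three quantifiers the environment is [a], [b], [c], [Z], [Y], [X], [s], whence the
    indices 3 to 6. It is the environment used in [atom_relations], so conditions and terms of a
    rule are evaluated unchanged. *)
Definition Fire j := let r := rule_of P flag pT j in
  Ex NE (Ex NE (Ex NE (And (And (Eq (Var 6) (Const (rsym r))) (rcond r))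
    (And (Same_term (Var 5) (rterm1 r))
    (And (Same_term (Var 4) (rterm2 r)) (Same_term (Var 3) (rterm3 r))))))).

Definition Fact_formula := foldr Or Zero [seq Fire j | j <- all_rules M k].
Definition Size := Mul (Const (tag_count M k)) (Mul NE NE).
Definition Encoding :=
  ESeq (ELoop Size (EBit One)) (ESeq (EBit Zero)
    (ELoop (Const s0) (ELoop Size (ELoop Size (ELoop Size (EBit Fact_formula)))))).

Variable x : seq bool.
Let N := (pN.[size x])%R.
Let m := tag_count M k * (N * N).
Let w := out x [::] Encoding.
Local Notation atom := (atom M k).
Local Notation relations_x := (@atom_relations M k P flag pT pN x).
Local Notation code := (@atom_code M k pN x).
Local Notation ranged := (@in_range M k pN x).

Lemma eval_Size v : eval x v Size = m.
Proof. by rewrite !eval_Mul eval_Const eval_Horner. Qed.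

Lemma truth_And3 v a b c :
  truth x v (And a (And b c)) = [&& truth x v a, truth x v b & truth x v c].
Proof. by rewrite !truth_And. Qed.

Lemma truth_And5 v a b c d e : truth x v (And (And a b) (And c (And d e))) =
  (truth x v a && truth x v b) && [&& truth x v c, truth x v d & truth x v e].
Proof. by rewrite !truth_And. Qed.

Lemma truth_Same_term v e t : truth x v (Same_term e t) =
  ranged (atom_of x v t) && (eval x v e == code (atom_of x v t)).
Proof.
rewrite truth_And3 !truth_Lt truth_Eq !(eval_Plus, eval_Mul, eval_Const, eval_Horner).
by rewrite andbA.
Qed.

Lemma truth_Fact s X Y Z : truth x [:: Z; Y; X; s] Fact_formula <->
  exists X' Y' Z', [/\ relations_x s X' Y' Z', X = code X', Y = code Y' & Z = code Z'].
Proof.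
rewrite truth_bigOr; split=> [/hasP [j _]|[X' [Y' [Z' [[j [a [b [c [h1 h2 h3]]]]] -> -> ->]]]]].
  move=> /truth_ExP [c hc /truth_ExP [b hb /truth_ExP [a ha]]].
  rewrite !eval_Horner -/N in hc hb ha.
  rewrite truth_And5 !truth_Same_term truth_Eq eval_Const /=.
  move=> /andP [/andP [/eqP es hcond] /and3P [/andP [r1 /eqP e1] /andP [r2 /eqP e2] /andP [r3 /eqP e3]]].
  set v := [:: a, b, c, Z, Y, X & _] in e1 e2 e3 r1 r2 r3 hcond.
  exists (atom_of x v (rterm1 (rule_of P flag pT j))), (atom_of x v (rterm2 (rule_of P flag pT j))),
    (atom_of x v (rterm3 (rule_of P flag pT j))); split=> //.
  by exists j, a, b, c; rewrite ha hb hc r1 r2 r3 /fires -e1 -e2 -e3.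
apply/hasP; exists j; first exact: mem_all_rules.
move: h1 => /and3P [ha hb hc].
apply/truth_ExP; exists c; rewrite ?eval_Horner //.
apply/truth_ExP; exists b; rewrite ?eval_Horner //.
apply/truth_ExP; exists a; rewrite ?eval_Horner //.
rewrite truth_And5 !truth_Same_term truth_Eq eval_Const /=.
move: h3 => [es hcond e1 e2 e3]; rewrite hcond -e1 -e2 -e3 !eqxx -es eqxx.
by move: h2 => /and3P [-> -> ->].
Qed.

Let row s X Y := flatten [seq [:: truth x [:: Z; Y; X; s] Fact_formula] | Z <- iota 0 m].
Let plane s X := flatten [seq row s X Y | Y <- iota 0 m].
Let cube s := flatten [seq plane s X | X <- iota 0 m].
Let bits := flatten [seq cube s | s <- iota 0 s0].

Lemma out_Encoding : w = nseq m true ++ false :: bits.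
Proof.
have ones n j : flatten [seq [:: 0 < 1] | _ <- iota j n] = nseq n true.
  by elim: n j => //= n IH j; rewrite IH.
rewrite /w /Encoding [LHS]/= subnn eval_Const !eval_Size; congr (_ ++ _ :: flatten _).
  exact: ones.
apply: eq_map => s; rewrite eval_Size; congr flatten.
apply: eq_map => X; rewrite eval_Size; congr flatten.
by apply: eq_map => Y; rewrite eval_Size.
Qed.

Lemma card_of_Encoding : card_of w = m.
Proof.
by rewrite out_Encoding /card_of index_cat size_nseq mem_nseq andbF /= addn0.
Qed.

Lemma size_row s X Y : size (row s X Y) = m.
Proof. by rewrite (@size_flatten_const _ _ _ 1) // size_iota muln1. Qed.

Lemma size_plane s X : size (plane s X) = m * m.
Proof. by rewrite (size_flatten_const _ (size_row s X)) size_iota. Qed.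

Lemma size_cube s : size (cube s) = m * (m * m).
Proof. by rewrite (size_flatten_const _ (size_plane s)) size_iota. Qed.

Lemma size_bits : size bits = s0 * (m * (m * m)).
Proof. by rewrite (size_flatten_const _ size_cube) size_iota. Qed.

Lemma well_formed_Encoding : well_formed s0 w.
Proof.
rewrite /well_formed card_of_Encoding out_Encoding size_cat size_nseq.
by rewrite -cat1s size_cat size_bits addnA addn1 !expnS expn0 muln1.
Qed.

Lemma rel_at_Encoding s X Y Z : s < s0 -> X < m -> Y < m -> Z < m ->
  rel_at w s X Y Z = truth x [:: Z; Y; X; s] Fact_formula.
Proof.
move=> hs hX hY hZ; rewrite /rel_at card_of_Encoding /fact_pos out_Encoding.
rewrite nth_cat size_nseq addSn ltnNge ltnW ?ltnS ?leq_addr // subSn ?leq_addr // addKn.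
have -> : ((s * m + X) * m + Y) * m + Z = s * (m * (m * m)) + (X * (m * m) + (Y * m + Z)) by nia.
have lt1 : Y * m + Z < m * m by nia.
have lt2 : X * (m * m) + (Y * m + Z) < m * (m * m) by nia.
have unit_size Z' : size [:: truth x [:: Z'; Y; X; s] Fact_formula] = 1 by [].
rewrite [LHS](nth_flatten_const 0 _ size_cube) ?size_iota // nth_iota // add0n.
rewrite (nth_flatten_const 0 _ (size_plane s)) ?size_iota // nth_iota // add0n.
rewrite (nth_flatten_const 0 _ (size_row s X)) ?size_iota // nth_iota // add0n.
have := nth_flatten_const 0 false unit_size (s := iota 0 m) (i := Z) (j := 0).
by rewrite muln1 addn0 size_iota => -> //; rewrite nth_iota.
Qed.

Lemma code_inj X Y : ranged X -> ranged Y -> code X = code Y -> X = Y.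
Proof.
move: X Y => [[t a] b] [[t' a'] b'] /andP [/= ha hb] /andP [/= ha' hb'].
rewrite /atom_code /= -/N => e.
have eb : b = b' by have := congr1 (modn^~ N) e; rewrite !modnMDl !modn_small.
move: e; rewrite eb => /addIn /eqP; rewrite eqn_pmul2r; last by apply: leq_trans hb.
move=> /eqP e; have ea : a = a' by have := congr1 (modn^~ N) e; rewrite !modnMDl !modn_small.
move: e; rewrite ea => /addIn /eqP; rewrite eqn_pmul2r; last by apply: leq_trans hb.
by move=> /eqP /val_inj /enum_rank_inj /sum_of_tag_inj ->.
Qed.

Lemma code_lt X : ranged X -> code X < m.
Proof.
move: X => [[t a] b] /andP [/= ha hb]; rewrite /atom_code /= -/N /m.
have ht : tag_number t < tag_count M k by apply: ltn_ord.
have h1 : tag_number t * N + a < tag_count M k * N by nia.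
by rewrite mulnA; nia.
Qed.

Lemma rsym_lt s X Y Z : relations_x s X Y Z -> s < s0.
Proof.
move=> [j [a [b [c [_ _ [-> _ _ _ _]]]]]].
have lt (i : 'I_k) : 3 + (k - i.+1) < s0 by have := ltn_ord i; rewrite /s0; lia.
case: j => [d||i' d|i' d|i'|i'|i' d|i' d|i'|i'|i'|i' d d'|d|||i'|i'||i' s'|q f|i' q f|q f|i' q f|i' q f|i' s'|s'|q f|] //=;
  try by case: (delta q f) => [[]|].
by case: ifP => _ /=; apply: lt.
Qed.

(** The encoded structure and the atoms are homomorphically equivalent, and [good_hom] applies in
    both directions. The default value of [dec] is irrelevant, since all facts are about codes of
    atoms in range. *)
Lemma good_Encoding qs :
  good_class qs (word_relations s0 w) <-> good relations_x qs (fun _ _ => False).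
Proof.
pose dec n : atom := if pselect (exists2 X, ranged X & code X = n) is left h
  then projT1 (cid2 h) else (TBad M k, 0, 0).
have decK X : ranged X -> dec (code X) = X.
  move=> hX; rewrite /dec; case: pselect => [h|[]]; last by exists X.
  by case: (cid2 h) => Y /= hY e; apply: code_inj.
split=> h; last first.
  apply: (good_hom (f := dec) _ _ h) => // s X Y Z [hs hX hY hZ].
  rewrite rel_at_Encoding -?card_of_Encoding // => /truth_Fact [X' [Y' [Z' [hr -> -> ->]]]].
  by have [j [a [b [c [_ /and3P [r1 r2 r3] _]]]]] := hr; rewrite !decK.
apply: (good_hom (f := code) _ _ h) => // s X Y Z hr.
have [j [a [b [c [_ /and3P [r1 r2 r3] _]]]]] := hr.
rewrite /word_relations card_of_Encoding !code_lt //; split=> //; first exact: rsym_lt hr.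
rewrite rel_at_Encoding ?code_lt //; last exact: rsym_lt hr.
by apply/truth_Fact; exists X, Y, Z.
Qed.

End Encoding.

(** * Length bounds and completeness *)

Section WordBound.
Variables (P : nat -> {poly nat}).

Fixpoint word_bound i n :=
  if i is j.+1 then word_bound j n + word_bound j n + 1 + ((P j).[word_bound j n])%R else n.

Lemma word_bound_poly i : poly_bounded (word_bound i).
Proof.
elim: i => [|i IH] /=; first exact: poly_bounded_id.
apply: poly_bounded_add; last exact: (poly_bounded_comp (poly_bounded_poly _) IH).
by apply: poly_bounded_add; [apply: poly_bounded_add | apply: poly_bounded_const].
Qed.

Lemma size_word x F i : size (word P x F i) <= word_bound i (size x).
Proof.
elim: i => //= i IH; rewrite wordS size_pair_word.
have := size_decode (P i).[size (word P x F i)]%R (F i); have := poly_mono (P i) IH; lia.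
Qed.

Lemma word_bound_mono i j n : i <= j -> word_bound i n <= word_bound j n.
Proof.
move=> le; rewrite -(subnKC le); elim: (j - i) => [|d IH]; rewrite ?addn0 // addnS /=; lia.
Qed.

End WordBound.

Theorem level_reduces b k L : b (+) odd k -> level b k.+1 L ->
  poly_reduces L (CSP (good_template (3 + k) (alternation b k))).
Proof.
move=> hb /level_nest [Q [V [eQ [f [M [p hM]] hV] hL]]].
(* At level [k.+1] the parity is opposite to that of [b (+) odd k], so the function [f] decides the
   complement of [V], as the rules require. *)
have hVn w : ~ V w <-> f w = [:: true] by move: (hV w); rewrite /= addbN hb.
pose P i := nth 0%R (unzip2 Q) i; pose flag i := nth true (alternation b k.+1) i.
have flag_last : flag k.
  by rewrite /flag -(alternation_rcons hb) nth_rcons size_alternation ltnn eqxx.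
have sQ : size Q = k.+1 by rewrite -(size_alternation b k.+1) -eQ size_map.
have QE : Q = [seq (flag i, P i) | i <- iota 0 k.+1].
  apply: (@eq_from_nth _ (true, 0%R)) => [|i]; rewrite sQ ?size_map ?size_iota // => hi.
  rewrite (nth_map 0) ?size_iota // nth_iota // add0n /flag -eQ /P.
  by rewrite !(nth_map (true, 0%R)) ?sQ // -surjective_pairing.
have qsE : alternation b k = [seq flag i | i <- iota 0 k].
  apply: (@eq_from_nth _ true) => [|i]; rewrite size_alternation ?size_map ?size_iota // => hi.
  rewrite (nth_map 0) ?size_iota // nth_iota // add0n /flag -(alternation_rcons hb).
  by rewrite nth_rcons size_alternation hi.
have [pT hT] := poly_bounded_comp (poly_bounded_poly p) (word_bound_poly P k.+1).
have [pN hN] : poly_bounded (fun n => (pT.[n])%R + (pT.[n])%R + word_bound P k.+1 n + 3).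
  apply: poly_bounded_add; last exact: poly_bounded_const.
  apply: poly_bounded_add; last exact: word_bound_poly.
  by apply: poly_bounded_add; apply: poly_bounded_poly.
exists (fun x => out x [::] (@Encoding M k P flag pT pN)); first exact: out_polytime.
move=> x; rewrite hL good_template_word.
have large := hN (size x).
have bounded F i : i <= k.+1 -> size (word P x F i) <= word_bound P k.+1 (size x).
  by move=> le; apply: leq_trans (size_word _ _ _ _) (word_bound_mono _ _ le).
have decides w : size w <= word_bound P k.+1 (size x) -> exists n c,
    [/\ n <= (pT.[size x])%R, run n (init M w) = Some c & output c = [:: true] <-> ~ V w].
  move=> le; have [c er eo] := hM w; exists (p.[size w])%R, c; split=> //.
    by apply: leq_trans (hT _); apply: poly_mono.
  by rewrite eo hVn.
rewrite QE qsE; split=> [h|[_ h]].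
  split; first exact: well_formed_Encoding.
  apply/good_Encoding.
  by apply: (nest_good flag_last large bounded decides (F := fun _ _ => None)) => //.
rewrite -[X in nest _ _ X]/(word P x (fun _ _ => None) 0).
have h1 := (good_Encoding _ _ _ _ _ _ _ _).1 h.
by apply: (good_nest flag_last large bounded decides (add0n k) _ h1).
Qed.

Lemma template_complete b k : b (+) odd k -> exists (sigma : signature) (D : structure sigma),
  omega_categorical D /\ complete_for (level b k.+1) (CSP D).
Proof.
move=> hb; exists (ternary (3 + k)), (good_template (3 + k) (alternation b k)).
split; first exact: good_template_categorical.
by split=> [|L]; [apply: template_level | apply: level_reduces].
Qed.

Theorem theorem1p3 (n : nat) (hn : 1 <= n) :
  (exists (sigma : signature) (D : structure sigma),
     omega_categorical D /\ complete_for (Sigma_P (2 * n + 1)) (CSP D)) /\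
  (exists (sigma' : signature) (D' : structure sigma'),
     omega_categorical D' /\ complete_for (Pi_P (2 * n)) (CSP D')).
Proof.
split.
  have hb : true (+) odd (2 * n) by rewrite mul2n odd_double.
  by rewrite addn1; apply: (template_complete hb).
(* Here [k.+1] has to be [2 * n], which is possible because [n] is positive. *)
have hb : false (+) odd (2 * n).-1 by case: n hn => // n _; rewrite mul2n doubleS /= odd_double.
by have := template_complete hb; rewrite prednK //; lia.
Qed.
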